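(* Let $\mathcal S$ be the unit sphere $S^2$, the Euclidean plane $E^2$, or the Lobachevskij (hyperbolic) plane $\mathbb{H}^2$ of curvature $-1$, and let $\gamma:[a,b]\to\mathcal S$ be a $\mathcal G$-curve. If $\mathcal S=S^2$, assume also that $\operatorname{diameter}(\gamma([a,b]))<\frac{\pi}{2}$. Then the length $\ell(\gamma)$ of $\gamma$ is less than or equal to the perimeter $\mathfrak p(\widehat\gamma)$ of the convex hull $\widehat\gamma$ of $\gamma([a,b])$.
   Context: A line of $\mathcal S$ is the trace of a maximal geodesic; a (geodesic) segment joining two points is an arc of minimal length between them. A subset $Q\subset\mathcal S$ is convex if for any two points $x,x'\in Q$ there exists a unique segment joining $x$ to $x'$ and this segment is entirely contained in $Q$. The convex hull of $A\subset\mathcal S$ is the intersection of all convex sets of $\mathcal S$ containing $A$ (when some such set exists). For a bounded convex set $Q$, the perimeter $\mathfrak p(Q)$ is the length of its boundary $\partial Q$, measured as the supremum of lengths of closed polygonal curves inscribed in it (so that, if $Q$ degenerates to a segment, its perimeter is twice the length of the segment). An absolutely continuous curve $\gamma:[a,b]\to\mathcal S$, $\gamma_s=\gamma(s)$, is a $\mathcal G$-curve if for any $s_o\in[a,b]$ for which $\dot\gamma_{s_o}$ exists and is different from $0$, all points $\gamma_s$ with $s\le s_o$ lie in the same closed half space (half-plane, or hemisphere if $\mathcal S=S^2$) bounded by the normal line to $\gamma$ at $\gamma_{s_o}$, i.e. the line through $\gamma_{s_o}$ orthogonal to $\dot\gamma_{s_o}$. *)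

(* Defs.v *)
From HB Require Import structures.
From mathcomp Require Import all_boot all_order all_algebra.
From mathcomp Require Import all_classical all_reals all_analysis.

Set Implicit Arguments.
Unset Strict Implicit.
Unset Printing Implicit Defensive.

Import Order.TTheory GRing.Theory Num.Theory.
Import numFieldNormedType.Exports.

Local Open Scope classical_set_scope.
Local Open Scope ring_scope.

(* The three surfaces are embedded in R^3 so that their lines are exactly the
   nonempty traces of planes through the origin: the unit sphere, the affine
   plane x_0 = 1, and the upper sheet of the hyperboloid. *)
Inductive surface := Sphere | Euclidean | Hyperbolic.

Section Defs.
Variable R : realType.
Local Notation pt := 'rV[R]_3.
Implicit Types (k : surface) (x y z u v : pt) (A Q L H : set pt).

Definition c0 x : R := x ord0 (inord 0).
Definition c1 x : R := x ord0 (inord 1).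
Definition c2 x : R := x ord0 (inord 2).

(* On tangent vectors (those with c0 v = 0 in the Euclidean case), form is the
   Riemannian metric. *)
Definition form k u v : R :=
  match k with
  | Sphere => c0 u * c0 v + c1 u * c1 v + c2 u * c2 v
  | Euclidean => c1 u * c1 v + c2 u * c2 v
  | Hyperbolic => c1 u * c1 v + c2 u * c2 v - c0 u * c0 v
  end.

Definition points k : set pt :=
  match k with
  | Sphere => [set x | form Sphere x x = 1]
  | Euclidean => [set x | c0 x = 1]
  | Hyperbolic => [set x | form Hyperbolic x x = -1 /\ 0 < c0 x]
  end.

Definition arcosh (t : R) : R := ln (t + Num.sqrt (t ^+ 2 - 1)).

Definition dist k x y : R :=
  match k with
  | Sphere => acos (form Sphere x y)
  | Euclidean => Num.sqrt (form Euclidean (x - y) (x - y))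
  | Hyperbolic => arcosh (- form Hyperbolic x y)
  end.

Definition diameter k A : \bar R :=
  ereal_sup [set (dist k p.1 p.2)%:E | p in A `*` A].

(** Curves; only the values on [a, b] matter. *)

Definition curve_length k (a b : R) (g : R -> pt) : \bar R :=
  ereal_sup [set (\sum_(0 <= i < size s)
      dist k (g (nth b (a :: s) i)) (g (nth b (a :: s) i.+1)))%:E
    | s in itv_partition a b].

Definition continuous_curve k (a b : R) (g : R -> pt) : Prop :=
  (forall s, s \in `[a, b] -> points k (g s)) /\
  {within `[a, b], continuous g}.

Definition ac_curve k (a b : R) (g : R -> pt) : Prop :=
  (forall s, s \in `[a, b] -> points k (g s)) /\
  forall e : R, 0 < e -> exists2 d : R, 0 < d &
    forall (n : nat) (s t : 'I_n -> R),
      (forall i, [/\ a <= s i, s i <= t i & t i <= b]) ->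
      (forall i j, i != j -> t i <= s j \/ t j <= s i) ->
      \sum_(i < n) (t i - s i) < d ->
      \sum_(i < n) dist k (g (s i)) (g (t i)) < e.

(* One-sided at the endpoints of [a, b]. *)
Definition has_velocity (a b : R) (g : R -> pt) (s : R) v : Prop :=
  (t - s)^-1 *: (g t - g s) @[t --> within `[a, b] s^'] --> v.

(** Lines, half-spaces and convexity. *)

(* The three surfaces being complete, the maximal geodesics (here parametrized
   by arc length) are defined on the whole of R. *)
Definition maximal_geodesic k (c : R -> pt) : Prop :=
  (forall t, points k (c t)) /\
  forall t, exists2 e : R, 0 < e & forall r s,
    `|r - t| < e -> `|s - t| < e -> dist k (c r) (c s) = `|r - s|.

Definition line_orthogonal_at k x v L : Prop :=
  exists c : R -> pt, exists w : pt,
    [/\ maximal_geodesic k c, c 0 = x, is_derive (0 : R) (1 : R) c w,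
        form k w v = 0 & L = range c].

Definition closed_half_space k L H : Prop :=
  exists n : pt,
    L = [set p | points k p /\ \sum_(i < 3) n ord0 i * p ord0 i = 0] /\
    H = [set p | points k p /\ 0 <= \sum_(i < 3) n ord0 i * p ord0 i].

Definition G_curve k (a b : R) (g : R -> pt) : Prop :=
  ac_curve k a b g /\
  forall s0 v, s0 \in `[a, b] -> has_velocity a b g s0 v -> v != 0 ->
    forall L, line_orthogonal_at k (g s0) v L ->
      exists2 H, closed_half_space k L H &
        forall s, a <= s <= s0 -> H (g s).

Definition segment k x y A : Prop :=
  exists c : R -> pt,
    [/\ continuous_curve k 0 1 c, c 0 = x, c 1 = y, A = c @` `[0, 1] &
        forall c', continuous_curve k 0 1 c' -> c' 0 = x -> c' 1 = y ->
          (curve_length k 0 1 c <= curve_length k 0 1 c')%E].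

Definition convex k Q : Prop :=
  Q `<=` points k /\
  forall x y, Q x -> Q y ->
    (exists! A, segment k x y A) /\ (forall A, segment k x y A -> A `<=` Q).

Definition convex_hull k A : set pt :=
  \bigcap_(Q in [set Q | convex k Q /\ A `<=` Q]) Q.

(** Perimeter. *)

(* Relative to the surface, not to R^3. *)
Definition boundary k Q : set pt :=
  points k `&` closure Q `&` closure (points k `\` Q).

Definition orientation x y z : R :=
  \det (\matrix_(i < 3, j < 3) (nth 0 [:: x; y; z] i) ord0 j).

(* The vertices occur in counterclockwise order along the boundary of Q.
   No three of them are collinear: this loses nothing for the supremum, since
   an intermediate collinear vertex does not change the length, and it leaves
   only polygons with at most two vertices when Q is a segment, whence a
   perimeter equal to twice the length. *)
Definition inscribed_polygon k Q n (p : 'I_n -> pt) : Prop :=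
  (forall i, boundary k Q (p i)) /\
  forall i j l : 'I_n, (i < j)%N -> (j < l)%N ->
    0 < orientation (p i) (p j) (p l).

Definition closed_polygon_length k n (p : 'I_n -> pt) : R :=
  \sum_(i < n) dist k (p i) (p (ordS i)).

Definition perimeter k Q : \bar R :=
  ereal_sup [set l | exists n (p : 'I_n -> pt),
    inscribed_polygon k Q p /\ l = (closed_polygon_length k p)%:E].

End Defs.

(* Main.v *)
(* Let P_s be the supremum of the lengths of the strictly convex closed polygons with
   vertices on gamma([a, s]). The half-plane condition makes the distance from a
   fixed past point nondecreasing along gamma; hence the past is seen from the newest
   point gamma(t) under acute angles, and inserting gamma(t) into a polygon while
   dropping the vertices that it hides does not decrease the length. Where gamma has a
   velocity, the same construction at the vertex gamma(s) gains (1 - eps) d(gamma(s),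
   gamma(t)) for t close to s. Absolute continuity provides velocities almost
   everywhere and makes the exceptional null set harmless, so that the length of gamma
   is at most P_b. Finally, moving a vertex away from its predecessor until it reaches
   the boundary of the hull, and dropping the next vertex if it becomes aligned, only
   increases the length, whence P_b is at most the perimeter. The hull is bounded
   because balls (of radius less than pi/2 on the sphere) are convex. *)
Require Import Defs.
From HB Require Import structures.
From mathcomp Require Import all_boot all_order all_algebra.
From mathcomp Require Import all_classical all_reals all_analysis.
From mathcomp Require Import ring lra.
(* Again, because mathcomp's sesquilinear forms shadow [form]. *)
Require Import Defs.
Set Implicit Arguments.
Unset Strict Implicit.
Unset Printing Implicit Defensive.
Import Order.TTheory GRing.Theory Num.Theory.
Import numFieldNormedType.Exports.
Local Open Scope classical_set_scope.
Local Open Scope ring_scope.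
Arguments form : simpl never.

(** * Coordinates and metrics *)

(** Linear algebra in R^3 makes one geometry of the three: sides of lines are signs of [det3], and
    the monotonicity of distances along the curve is proved on [vers], half a squared chord, which
    is polynomial in the points. Dropping hidden vertices might lose length, and the triangle
    inequality points the wrong way. What is propagated is a lower bound for the new edge: the
    abscissa, along the line of the last dropped edge, of the foot of the perpendicular from the new
    point ([reach]). It grows by the length of each dropped edge, can only gain when the axis turns
    at the next vertex, and bounds the new edge from below, a leg being at most the hypotenuse. On
    the sphere the diameter bound keeps these abscissas within a quarter turn. At the vertex
    gamma(s) the gain is 1 - 3 eps times the distance: one eps is lost on each of the two new edges,
    one in comparing the sine of the distance with the distance. The two edges together suffice
    because they meet at a nonobtuse angle: a displacement in the angle of their prolongations has
    projections on them that add up to at least its length. *)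

Section Coordinates.
Variable R : realType.
Local Notation pt := 'rV[R]_3.
Implicit Types (k : surface) (x y z u v w : pt) (s t : R).

Lemma c0D x y : c0 (x + y) = c0 x + c0 y. Proof. by rewrite /c0 mxE. Qed.
Lemma c1D x y : c1 (x + y) = c1 x + c1 y. Proof. by rewrite /c1 mxE. Qed.
Lemma c2D x y : c2 (x + y) = c2 x + c2 y. Proof. by rewrite /c2 mxE. Qed.
Lemma c0N x : c0 (- x) = - c0 x. Proof. by rewrite /c0 mxE. Qed.
Lemma c1N x : c1 (- x) = - c1 x. Proof. by rewrite /c1 mxE. Qed.
Lemma c2N x : c2 (- x) = - c2 x. Proof. by rewrite /c2 mxE. Qed.
Lemma c0Z t x : c0 (t *: x) = t * c0 x. Proof. by rewrite /c0 mxE. Qed.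
Lemma c1Z t x : c1 (t *: x) = t * c1 x. Proof. by rewrite /c1 mxE. Qed.
Lemma c2Z t x : c2 (t *: x) = t * c2 x. Proof. by rewrite /c2 mxE. Qed.
Lemma c00 : c0 0 = 0 :> R. Proof. by rewrite /c0 mxE. Qed.
Lemma c10 : c1 0 = 0 :> R. Proof. by rewrite /c1 mxE. Qed.
Lemma c20 : c2 0 = 0 :> R. Proof. by rewrite /c2 mxE. Qed.

Definition coordE := (c0D, c1D, c2D, c0N, c1N, c2N, c0Z, c1Z, c2Z, c00, c10, c20).

Lemma ord3P (i : 'I_3) : [\/ i = inord 0, i = inord 1 | i = inord 2].
Proof.
case: i => [[|[|[|i]]] Hi] //; [apply: Or31|apply: Or32|apply: Or33];
  by apply: val_inj; rewrite /= inordK.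
Qed.

Lemma row3P x y : c0 x = c0 y -> c1 x = c1 y -> c2 x = c2 y -> x = y.
Proof.
move=> h0 h1 h2; apply/matrixP => i j; rewrite (ord1 i).
by case: (ord3P j) => ->.
Qed.

(** The expanded form of [orientation], open to [ring]. *)
Definition det3 x y z : R :=
  c0 x * (c1 y * c2 z - c2 y * c1 z) - c1 x * (c0 y * c2 z - c2 y * c0 z)
  + c2 x * (c0 y * c1 z - c1 y * c0 z).

Lemma inord3E : ((inord 0 : 'I_3) = ord0) * ((inord 1 : 'I_3) = lift ord0 ord0)
  * ((inord 2 : 'I_3) = lift ord0 (lift ord0 ord0)).
Proof. by split; [split|]; apply: val_inj; rewrite /= inordK. Qed.

Lemma orientationE x y z : orientation x y z = det3 x y z.
Proof.
rewrite /orientation (expand_det_row _ ord0) !big_ord_recl big_ord0.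
rewrite /cofactor !det_mx11 || rewrite /cofactor.
rewrite !(expand_det_row _ ord0) !big_ord_recl !big_ord0 /cofactor !det_mx11.
rewrite !mxE /= /det3 /c0 /c1 /c2 !inord3E.
rewrite /bump /= !(expr0, expr1, expr2, add0n, addn0).
have e1 : lift (lift ord0 ord0) (ord0 : 'I_1) = ord0 :> 'I_2 by apply: val_inj.
have l0 : lift (lift ord0 ord0 : 'I_3) (ord0 : 'I_2) = ord0 by apply: val_inj.
have l1 : lift (lift ord0 ord0 : 'I_3) (lift ord0 ord0 : 'I_2) = lift ord0 (lift ord0 ord0)
  by apply: val_inj.
have l2 : lift (lift ord0 (lift ord0 ord0) : 'I_3) (ord0 : 'I_2) = ord0 by apply: val_inj.
have l3 : lift (lift ord0 (lift ord0 ord0) : 'I_3) (lift ord0 ord0 : 'I_2) = lift ord0 ord0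
  by apply: val_inj.
rewrite ?e1 ?l0 ?l1 ?l2 ?l3.
rewrite ?(addr0, mulN1r, mul1r, mulrN, mulNr, opprK).
ring.
Qed.

Lemma det3_cycle x y z : det3 x y z = det3 y z x.
Proof. by rewrite /det3; ring. Qed.

Lemma det3_swap x y z : det3 x z y = - det3 x y z.
Proof. by rewrite /det3; ring. Qed.

Lemma det3_swap12 x y z : det3 y x z = - det3 x y z.
Proof. by rewrite /det3; ring. Qed.

Lemma det3xx x y : det3 x x y = 0. Proof. by rewrite /det3; ring. Qed.
Lemma det3xyx x y : det3 x y x = 0. Proof. by rewrite /det3; ring. Qed.
Lemma det3xyy x y : det3 x y y = 0. Proof. by rewrite /det3; ring. Qed.

Lemma det3_lin x u v s t y : det3 (s *: u + t *: v) x y = s * det3 u x y + t * det3 v x y.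
Proof. by rewrite /det3 !coordE; ring. Qed.

(** The three-term Plücker relation modulo [x]. The arguments on chains in convex position rest on
    it. *)
Lemma plucker x a b c d :
  det3 x a b * det3 x c d - det3 x a c * det3 x b d + det3 x a d * det3 x b c = 0.
Proof. by rewrite /det3; ring. Qed.

Lemma cramer3 x y z w :
  det3 y z w *: x - det3 x z w *: y + det3 x y w *: z - det3 x y z *: w = 0.
Proof. by apply: row3P; rewrite !coordE /det3; ring. Qed.

Lemma formC k x y : form k x y = form k y x.
Proof. by case: k; rewrite /form; ring. Qed.

Lemma formDl k x y z : form k (x + y) z = form k x z + form k y z.
Proof. by case: k; rewrite /form !coordE; ring. Qed.

Lemma formZl k t x y : form k (t *: x) y = t * form k x y.
Proof. by case: k; rewrite /form !coordE; ring. Qed.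

Lemma formNl k x y : form k (- x) y = - form k x y.
Proof. by case: k; rewrite /form !coordE; ring. Qed.

Lemma formDr k x y z : form k x (y + z) = form k x y + form k x z.
Proof. by rewrite formC formDl !(formC k x). Qed.

Lemma formZr k t x y : form k x (t *: y) = t * form k x y.
Proof. by rewrite formC formZl formC. Qed.

Lemma formNr k x y : form k x (- y) = - form k x y.
Proof. by rewrite formC formNl formC. Qed.

Lemma form0l k x : form k 0 x = 0.
Proof. by rewrite -(scale0r 0) formZl mul0r. Qed.

Lemma form0r k x : form k x 0 = 0.
Proof. by rewrite formC form0l. Qed.

Definition formE := (formDl, formDr, formZl, formZr, formNl, formNr, form0l, form0r).

(** [form Euclidean] ignores [c0], so that orthogonality to [x] cannot define the tangent plane in
    that case. *)
Definition tangent k x u : Prop :=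
  match k with Euclidean => c0 u = 0 | _ => form k x u = 0 end.

Lemma tangentD k x u v : tangent k x u -> tangent k x v -> tangent k x (u + v).
Proof. by case: k => /=; rewrite /tangent ?formE ?coordE => -> ->; rewrite addr0. Qed.

Lemma tangentZ k x t u : tangent k x u -> tangent k x (t *: u).
Proof. by case: k => /=; rewrite /tangent ?formE ?coordE => ->; rewrite mulr0. Qed.

Lemma tangentN k x u : tangent k x u -> tangent k x (- u).
Proof. by case: k => /=; rewrite /tangent ?formE ?coordE => ->; rewrite oppr0. Qed.

Lemma gramS (a b c x y z : pt) :
  det3 a b c * det3 x y z =
  form Sphere a x * (form Sphere b y * form Sphere c z - form Sphere b z * form Sphere c y)
  - form Sphere a y * (form Sphere b x * form Sphere c z - form Sphere b z * form Sphere c x)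
  + form Sphere a z * (form Sphere b x * form Sphere c y - form Sphere b y * form Sphere c x).
Proof. by rewrite /det3 /form; ring. Qed.

Lemma gramH (a b c x y z : pt) :
  - (det3 a b c * det3 x y z) =
  form Hyperbolic a x *
    (form Hyperbolic b y * form Hyperbolic c z - form Hyperbolic b z * form Hyperbolic c y)
  - form Hyperbolic a y *
    (form Hyperbolic b x * form Hyperbolic c z - form Hyperbolic b z * form Hyperbolic c x)
  + form Hyperbolic a z *
    (form Hyperbolic b x * form Hyperbolic c y - form Hyperbolic b y * form Hyperbolic c x).
Proof. by rewrite /det3 /form; ring. Qed.

(** Lagrange's identity in the tangent plane, with [det3 x] as area form. On the two quadrics it is
    a Gram determinant having [x] among its vectors; the opposite sign of [form x x] in the
    hyperbolic case cancels that of [gramH]. *)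
Lemma tangent_gram k x a b c : points k x ->
  tangent k x a -> tangent k x b -> tangent k x c ->
  form k a a * form k b c = form k a b * form k a c + det3 x a b * det3 x a c.
Proof.
case: k => /= [xx xa xb xc|x0 a0 b0 c0'|[xx _] xa xb xc].
- rewrite gramS !(formC Sphere _ x) xx xa xb xc (formC Sphere b a).
  ring.
- by rewrite /det3 /form x0 a0 b0 c0'; ring.
- have := gramH x a b x a c.
  rewrite !(formC Hyperbolic _ x) xx xa xb xc (formC Hyperbolic b a).
  by move=> /eqP; rewrite eqr_oppLR => /eqP ->; ring.
Qed.

(** On the two quadrics, the linear relation [cramer3] between [a], [b], [c] and [x] is paired with
    [a], which removes the term in [x]. *)
Lemma tangent_cross k x a b c : points k x ->
  tangent k x a -> tangent k x b -> tangent k x c ->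
  form k a a * det3 x b c = form k a b * det3 x a c - det3 x a b * form k a c.
Proof.
case: k => /= [_ xa xb xc|x0 a0 b0 c0'|_ xa xb xc].
- have := congr1 (form Sphere a) (cramer3 a b c x).
  rewrite !formE (formC Sphere _ x) xa (det3_cycle x b c) (det3_cycle x a c) (det3_cycle x a b).
  move=> h; lra.
- by rewrite /det3 /form x0 a0 b0 c0'; ring.
- have := congr1 (form Hyperbolic a) (cramer3 a b c x).
  rewrite !formE (formC Hyperbolic _ x) xa (det3_cycle x b c) (det3_cycle x a c) (det3_cycle x a b).
  move=> h; lra.
Qed.

(** In the hyperbolic case the tangent plane is spacelike: multiplied by [c0 x ^+ 2], the form
    becomes a sum of squares by the tangency and the equation of the hyperboloid. *)
Lemma tangent_ge0 k x u : points k x -> tangent k x u -> 0 <= form k u u.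
Proof.
case: k => /= [_ _|_ _|[xx x0] xu]; rewrite /form.
- by nra.
- by nra.
move: xx xu; rewrite /form.
set X0 := c0 x in x0 *; set X1 := c1 x; set X2 := c2 x.
set U0 := c0 u; set U1 := c1 u; set U2 := c2 u => xx xu.
have h : X0 ^+ 2 * (U1 * U1 + U2 * U2 - U0 * U0) =
  (X1 * U2 - X2 * U1) ^+ 2 + (U1 ^+ 2 + U2 ^+ 2).
  have e : X0 * U0 = X1 * U1 + X2 * U2 by lra.
  have e2 : X0 * X0 = X1 * X1 + X2 * X2 + 1 by lra.
  have -> : X0 ^+ 2 * (U1 * U1 + U2 * U2 - U0 * U0) =
     (X0 * X0) * (U1 * U1 + U2 * U2) - (X0 * U0) * (X0 * U0) by ring.
  by rewrite e e2; ring.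
rewrite -(pmulr_rge0 _ (exprn_gt0 2 x0)) h.
by rewrite !addr_ge0 // sqr_ge0.
Qed.

Lemma sum_sqr_eq0 (a b : R) : a ^+ 2 + b ^+ 2 = 0 -> a = 0 /\ b = 0.
Proof.
move/eqP; rewrite paddr_eq0 ?sqr_ge0 // !sqrf_eq0 => /andP[/eqP -> /eqP ->].
by [].
Qed.

Lemma tangent_eq0 k x u : points k x -> tangent k x u -> form k u u = 0 -> u = 0.
Proof.
case: k => /= [xx xu|x0 xu|[xx x0] xu]; rewrite /form -?expr2 => uu.
- have /sum_sqr_eq0[h u2] : Num.sqrt (c0 u ^+ 2 + c1 u ^+ 2) ^+ 2 + c2 u ^+ 2 = 0.
    by rewrite sqr_sqrtr // addr_ge0 // sqr_ge0.
  move: h => /eqP; rewrite sqrtr_eq0 => h.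
  have /sum_sqr_eq0[u0 u1] : c0 u ^+ 2 + c1 u ^+ 2 = 0.
    by apply/eqP; rewrite eq_le h addr_ge0 // sqr_ge0.
  by apply: row3P; rewrite !coordE.
- have [u1 u2] := sum_sqr_eq0 uu.
  by apply: row3P; rewrite !coordE.
move: xx xu; rewrite /form => xx xu.
have h : (c1 x * c2 u - c2 x * c1 u) ^+ 2 + (c1 u ^+ 2 + c2 u ^+ 2) = 0.
  have e : c0 x * c0 u = c1 x * c1 u + c2 x * c2 u by lra.
  have e2 : c0 x * c0 x = c1 x * c1 x + c2 x * c2 x + 1 by lra.
  have : (c0 x * c0 x) * (c1 u * c1 u + c2 u * c2 u) - (c0 x * c0 u) * (c0 x * c0 u) =
    (c0 x * c0 x) * (c1 u ^+ 2 + c2 u ^+ 2 - c0 u ^+ 2) by ring.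
  by rewrite uu mulr0 e e2 => <-; ring.
have h0 : c1 u ^+ 2 + c2 u ^+ 2 = 0.
  apply/eqP; rewrite eq_le addr_ge0 ?sqr_ge0 // andbT -h lerDr; exact: sqr_ge0.
have [u1 u2] := sum_sqr_eq0 h0.
have u0 : c0 u = 0.
  by move: uu; rewrite h0 sub0r => /eqP; rewrite oppr_eq0 sqrf_eq0 => /eqP.
by apply: row3P; rewrite !coordE.
Qed.

Lemma tangent_cs k x a b : points k x -> tangent k x a -> tangent k x b ->
  form k a b ^+ 2 <= form k a a * form k b b.
Proof.
move=> kx xa xb; rewrite (tangent_gram kx xa xb xb) -!expr2 lerDl.
exact: sqr_ge0.
Qed.

End Coordinates.

(** * Trigonometry *)

HB.lock Definition cosk (R : realType) (k : surface) (t : R) : R :=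
  match k with
  | Sphere => cos t | Euclidean => 1 | Hyperbolic => (expR t + expR (- t)) / 2
  end.

HB.lock Definition sink (R : realType) (k : surface) (t : R) : R :=
  match k with
  | Sphere => sin t | Euclidean => t | Hyperbolic => (expR t - expR (- t)) / 2
  end.

(* Unlike [cosk], this determines the distance in the Euclidean case as well. *)
HB.lock Definition versk (R : realType) (k : surface) (t : R) : R :=
  match k with
  | Sphere => 1 - cos t | Euclidean => t ^+ 2 / 2
  | Hyperbolic => (expR t + expR (- t)) / 2 - 1
  end.

(** A locked copy of [dist], opened only through [dsS], [dsE], [dsH] and where the definitions of
    the theorem are entered or left. *)
HB.lock Definition ds (R : realType) (k : surface) (x y : 'rV[R]_3) : R := dist k x y.

Section Trigonometry.
Variable R : realType.
Local Notation pt := 'rV[R]_3.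
Implicit Types (k : surface) (x y z u v w : pt) (s t : R).

Definition curv k : R :=
  match k with Sphere => 1 | Euclidean => 0 | Hyperbolic => -1 end.

Lemma coskS t : cosk Sphere t = cos t. Proof. by rewrite unlock. Qed.
Lemma coskE t : cosk Euclidean t = 1. Proof. by rewrite unlock. Qed.
Lemma coskH t : cosk Hyperbolic t = (expR t + expR (- t)) / 2. Proof. by rewrite unlock. Qed.
Lemma sinkS t : sink Sphere t = sin t. Proof. by rewrite unlock. Qed.
Lemma sinkE t : sink Euclidean t = t. Proof. by rewrite unlock. Qed.
Lemma sinkH t : sink Hyperbolic t = (expR t - expR (- t)) / 2. Proof. by rewrite unlock. Qed.
Lemma verskS t : versk Sphere t = 1 - cosk Sphere t. Proof. by rewrite !unlock. Qed.
Lemma verskE t : versk Euclidean t = t ^+ 2 / 2. Proof. by rewrite unlock. Qed.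
Lemma verskH t : versk Hyperbolic t = cosk Hyperbolic t - 1. Proof. by rewrite !unlock. Qed.

Definition trigE := (coskS, coskE, coskH, sinkS, sinkE, sinkH).

Lemma dsS x y : ds Sphere x y = acos (form Sphere x y).
Proof. by rewrite unlock. Qed.
Lemma dsE x y : ds Euclidean x y = Num.sqrt (form Euclidean (x - y) (x - y)).
Proof. by rewrite unlock. Qed.
Lemma dsH x y : ds Hyperbolic x y = arcosh (- form Hyperbolic x y).
Proof. by rewrite unlock. Qed.

Lemma sink0 k : sink k 0 = 0 :> R.
Proof. by case: k; rewrite trigE ?sin0 // oppr0 expR0 subrr mul0r. Qed.

Lemma cosk0 k : cosk k 0 = 1 :> R.
Proof. by case: k; rewrite trigE ?cos0 // oppr0 expR0; lra. Qed.

Lemma sinkN k t : sink k (- t) = - sink k t.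
Proof. by case: k; rewrite !trigE ?sinN // opprK; lra. Qed.

Lemma coskN k t : cosk k (- t) = cosk k t.
Proof. by case: k; rewrite !trigE ?cosN // opprK; lra. Qed.

Lemma verskN k t : versk k (- t) = versk k t.
Proof. by case: k; rewrite ?verskE ?sqrrN // ?verskS ?verskH coskN. Qed.

Lemma sinkD k s t : sink k (s + t) = sink k s * cosk k t + cosk k s * sink k t.
Proof.
by case: k; rewrite !trigE ?sinD ?mulr1 ?mul1r // opprD !expRD; field.
Qed.

Lemma coskD k s t :
  cosk k (s + t) = cosk k s * cosk k t - curv k * (sink k s * sink k t).
Proof.
case: k; rewrite /curv !trigE ?cosD ?mul1r ?mul0r ?subr0 //.
by rewrite opprD !expRD; field.
Qed.

Lemma cosk2 k t : cosk k t ^+ 2 + curv k * sink k t ^+ 2 = 1.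
Proof.
have := coskD k t (- t); rewrite subrr cosk0 coskN sinkN => ->; ring.
Qed.

Lemma versk0 k : versk k 0 = 0 :> R.
Proof. by case: k; rewrite ?verskE ?verskS ?verskH ?cosk0; lra. Qed.

Lemma expRN1 t : expR t * expR (- t) = 1.
Proof. by rewrite -expRD subrr expR0. Qed.

Lemma coskH_ge1 t : 1 <= cosk Hyperbolic t.
Proof.
have : 0 <= expR (- t) * (expR t - 1) ^+ 2 by rewrite mulr_ge0 ?expR_ge0 ?sqr_ge0.
have -> : expR (- t) * (expR t - 1) ^+ 2 =
  (expR t * expR (- t)) * expR t - 2 * (expR t * expR (- t)) + expR (- t) by ring.
rewrite expRN1 coskH; lra.
Qed.

Lemma sinkH_gt0 t : 0 < t -> 0 < sink Hyperbolic t.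
Proof.
move=> t0; rewrite sinkH; have : expR (- t) < expR t by rewrite ltr_expR; lra.
lra.
Qed.

(** On nonnegative numbers this is a domain where [versk] is increasing, so that distances can be
    compared through it. *)
Definition in_range k t : Prop := k = Sphere -> t <= pi.

Lemma sink_gt0 k t : 0 < t -> (k = Sphere -> t < pi) -> 0 < sink k t.
Proof.
case: k => t0 h; [|by rewrite sinkE|exact: sinkH_gt0].
by rewrite sinkS; apply: sin_gt0_pi; rewrite t0 h.
Qed.

Lemma sink_ge0 k t : 0 <= t -> in_range k t -> 0 <= sink k t.
Proof.
case: k => t0 h; rewrite trigE //.
  by apply: sin_ge0_pi; rewrite t0 h.
have : expR (- t) <= expR t by rewrite ler_expR; lra.
lra.
Qed.

Lemma versk_lt k s t : 0 <= s -> s < t -> in_range k t -> versk k s < versk k t.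
Proof.
case: k => s0 st h; rewrite ?verskS ?verskE ?verskH ?trigE.
- have tp : t <= pi by exact: h.
  by rewrite ltrD2l ltrN2 ltr_cos ?in_itv //=; lra.
- nra.
- have e : expR t + expR (- t) - (expR s + expR (- s)) =
    (expR t - expR s) * (1 - expR (- s) * expR (- t)).
    rewrite mulrBr mulr1 mulrBl.
    have -> : expR t * (expR (- s) * expR (- t)) = expR (- s) * (expR t * expR (- t)) by ring.
    rewrite expRN1 mulr1 mulrA expRN1 mul1r; ring.
  have h1 : expR s < expR t by rewrite ltr_expR.
  have h2 : expR (- s) * expR (- t) < 1.
    by rewrite -expRD expR_lt1; lra.
  have := mulr_gt0 (_ : 0 < expR t - expR s) (_ : 0 < 1 - expR (- s) * expR (- t)).
  rewrite -e !subr_gt0 h1 h2 => /(_ isT isT); lra.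
Qed.

Lemma versk_le k s t : 0 <= s -> s <= t -> in_range k t -> versk k s <= versk k t.
Proof.
move=> s0; rewrite le_eqVlt => /predU1P[-> //|st] h.
exact/ltW/versk_lt.
Qed.

Lemma le_versk k s t : in_range k s -> 0 <= t -> versk k s <= versk k t -> s <= t.
Proof.
move=> h t0; apply: contra_leT; rewrite -ltNge => ts; exact: versk_lt.
Qed.

Lemma versk_inj k s t : 0 <= s -> 0 <= t -> in_range k s -> in_range k t ->
  versk k s = versk k t -> s = t.
Proof.
move=> s0 t0 hs ht e; apply/eqP; rewrite eq_le.
by apply/andP; split; apply: (@le_versk k) => //; rewrite e.
Qed.

(** [cosd] and [vers] are [cosk] and [versk] of the distance ([cosk_dist], [versk_dist]), as
    polynomials in the coordinates. *)
Definition cosd k x y : R :=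
  match k with
  | Sphere => form Sphere x y | Euclidean => 1 | Hyperbolic => - form Hyperbolic x y
  end.

Definition vers k x y : R :=
  match k with
  | Sphere => 1 - form Sphere x y
  | Euclidean => form Euclidean (x - y) (x - y) / 2
  | Hyperbolic => - form Hyperbolic x y - 1
  end.

(* [sink k (ds k z y)] times the initial direction of the geodesic from [z] to [y]. *)
Definition tvec k z y : pt := y - cosd k z y *: z.

Lemma cosdC k x y : cosd k x y = cosd k y x.
Proof. by case: k => //=; rewrite formC. Qed.

Lemma form_subC k x y : form k (x - y) (x - y) = form k (y - x) (y - x).
Proof. by rewrite !formE; ring. Qed.

Lemma cosdxx k x : points k x -> cosd k x x = 1.
Proof. by case: k => /= [->|//|[-> _]] //; rewrite opprK. Qed.

Lemma tvec_tangent k z y : points k z -> points k y -> tangent k z (tvec k z y).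
Proof.
case: k => /= [zz yy|z0 y0|[zz _] _]; rewrite /tvec /tangent ?formE ?coordE /cosd.
- by rewrite zz mulr1 subrr.
- by rewrite z0 y0 mulr1 subrr.
- by rewrite zz; ring.
Qed.

Lemma tvecxx k x : points k x -> tvec k x x = 0.
Proof. by move=> kx; rewrite /tvec cosdxx // scale1r subrr. Qed.

Lemma det_tvec k z x y : det3 z (tvec k z x) (tvec k z y) = det3 z x y.
Proof. by rewrite /tvec /det3 !coordE; ring. Qed.

Lemma form_tvec2 k z y : points k z -> points k y ->
  cosd k z y ^+ 2 + curv k * form k (tvec k z y) (tvec k z y) = 1.
Proof.
case: k => /= [zz yy|z0 y0|[zz _] [yy _]]; rewrite /tvec /= ?formE.
- by rewrite zz yy (formC Sphere y z); ring.
- by ring.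
- by rewrite zz yy (formC Hyperbolic y z); ring.
Qed.

(** Pythagoras in the form [form_tvec2], [tvec] having a nonnegative square. *)
Lemma cosdS_bound x y : points Sphere x -> points Sphere y -> -1 <= cosd Sphere x y <= 1.
Proof.
move=> kx ky; have := form_tvec2 kx ky.
have := tangent_ge0 kx (tvec_tangent kx ky).
by rewrite /curv mul1r; move: (cosd _ _ _) (form _ _ _) => c f; nra.
Qed.

(** [form_tvec2] only bounds the square of [cosd]; the sign comes from Cauchy-Schwarz in the
    coordinates [c1], [c2], both points being on the upper sheet. *)
Lemma cosdH_ge1 x y : points Hyperbolic x -> points Hyperbolic y ->
  1 <= cosd Hyperbolic x y.
Proof.
move=> kx ky; have := form_tvec2 kx ky.
have := tangent_ge0 kx (tvec_tangent kx ky).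
rewrite /curv => f0 e.
have c1' : 1 <= cosd Hyperbolic x y ^+ 2 by lra.
have c0' : 0 < cosd Hyperbolic x y; last by nra.
move: kx ky => [xx x0] [yy y0]; move: xx yy; rewrite /cosd /form => xx yy.
set a := c1 x; set b := c2 x; set c := c1 y; set d := c2 y.
have : (a * c + b * d) ^+ 2 <= (a ^+ 2 + b ^+ 2) * (c ^+ 2 + d ^+ 2).
  rewrite -subr_ge0.
  have -> : (a ^+ 2 + b ^+ 2) * (c ^+ 2 + d ^+ 2) - (a * c + b * d) ^+ 2 =
    (a * d - b * c) ^+ 2 by ring.
  exact: sqr_ge0.
have -> : a ^+ 2 + b ^+ 2 = c0 x ^+ 2 - 1 by rewrite /a /b; lra.
have -> : c ^+ 2 + d ^+ 2 = c0 y ^+ 2 - 1 by rewrite /c /d; lra.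
move=> h.
have : (a * c + b * d) ^+ 2 < (c0 x * c0 y) ^+ 2.
  apply: (le_lt_trans h); rewrite exprMn.
  have : 1 <= c0 x ^+ 2 by have := sqr_ge0 a; have := sqr_ge0 b; rewrite /a /b; lra.
  have : 1 <= c0 y ^+ 2 by have := sqr_ge0 c; have := sqr_ge0 d; rewrite /c /d; lra.
  move: (c0 x ^+ 2) (c0 y ^+ 2) => p q p1 q1; lra.
rewrite -ltr_sqrt ?exprn_gt0 ?mulr_gt0 // !sqrtr_sqr (gtr0_norm (mulr_gt0 x0 y0)).
rewrite ltr_norml => /andP[_]; lra.
Qed.

Lemma dist_ge0 k x y : points k x -> points k y -> 0 <= ds k x y.
Proof.
case: k => kx ky; rewrite ?dsS ?dsE ?dsH.
- by apply: acos_ge0; exact: cosdS_bound.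
- exact: sqrtr_ge0.
- apply: ln_ge0; have := cosdH_ge1 kx ky; rewrite /cosd => h.
  by rewrite (le_trans h) // lerDl sqrtr_ge0.
Qed.

Lemma dist_range k x y : points k x -> points k y -> in_range k (ds k x y).
Proof. by case: k => kx ky // _; rewrite dsS; apply: acos_lepi; exact: cosdS_bound. Qed.

Lemma expR_arcosh (c : R) : 1 <= c ->
  expR (arcosh c) = c + Num.sqrt (c ^+ 2 - 1) /\ expR (- arcosh c) = c - Num.sqrt (c ^+ 2 - 1).
Proof.
move=> c1; have s0 := sqrtr_ge0 (c ^+ 2 - 1).
have e : expR (arcosh c) = c + Num.sqrt (c ^+ 2 - 1).
  by rewrite /arcosh lnK // posrE; lra.
split=> //; have := expRN1 (arcosh c); rewrite e.
have : Num.sqrt (c ^+ 2 - 1) ^+ 2 = c ^+ 2 - 1 by rewrite sqr_sqrtr //; nra.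
move: (Num.sqrt _) s0 => q s0 q2 h.
have : (c + q) * (c - q) = 1 by rewrite mulrC -subr_sqr q2; ring.
rewrite -h => /eqP; rewrite -subr_eq0 -mulrBr mulf_eq0 => /orP[/eqP|/eqP]; lra.
Qed.

Lemma cosk_dist k x y : points k x -> points k y -> cosk k (ds k x y) = cosd k x y.
Proof.
case: k => kx ky; rewrite trigE ?dsS ?dsE ?dsH //.
  by rewrite acosK // in_itv /=; exact: cosdS_bound.
have [-> ->] := expR_arcosh (cosdH_ge1 kx ky); rewrite /cosd; lra.
Qed.

Lemma versk_dist k x y : points k x -> points k y -> versk k (ds k x y) = vers k x y.
Proof.
case: k => kx ky.
- by rewrite verskS cosk_dist.
- rewrite verskE dsE sqr_sqrtr //.
  by apply: (tangent_ge0 kx); rewrite /= !coordE kx ky subrr.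
- by rewrite verskH cosk_dist.
Qed.

Lemma sink2_dist k x y : points k x -> points k y ->
  sink k (ds k x y) ^+ 2 = form k (tvec k x y) (tvec k x y).
Proof.
move=> kx ky; have := form_tvec2 kx ky; have := cosk2 k (ds k x y).
rewrite (cosk_dist kx ky).
case: k kx ky => kx ky; rewrite /curv; try by move=> *; lra.
move=> _ _; rewrite sinkE dsE sqr_sqrtr; last first.
  by apply: (tangent_ge0 kx); rewrite /= !coordE kx ky subrr.
by rewrite /tvec /= scale1r form_subC.
Qed.

Lemma dist_eq k x y t : points k x -> points k y -> 0 <= t -> in_range k t ->
  vers k x y = versk k t -> ds k x y = t.
Proof.
move=> kx ky t0 ht e; apply: (@versk_inj k) => //.
- exact: dist_ge0.
- exact: dist_range.
- by rewrite versk_dist.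
Qed.

Lemma distC k x y : ds k x y = ds k y x.
Proof. by case: k; rewrite ?dsS ?dsE ?dsH 1?form_subC 1?(formC _ x). Qed.

Lemma vers_xx k x : points k x -> vers k x x = 0.
Proof.
case: k => /= [->|_|[-> _]]; rewrite ?subrr ?form0l //; lra.
Qed.

Lemma distxx k x : points k x -> ds k x x = 0.
Proof.
move=> kx; apply: dist_eq => //; first by move=> _; exact: pi_ge0.
by rewrite vers_xx // versk0.
Qed.

Lemma dist0_eq k x y : points k x -> points k y -> ds k x y = 0 -> x = y.
Proof.
move=> kx ky d0; have := sink2_dist kx ky; rewrite d0 sink0 expr0n /= => /esym h.
have := tangent_eq0 kx (tvec_tangent kx ky) h; rewrite /tvec -(cosk_dist kx ky) d0 cosk0.
by rewrite scale1r => /eqP; rewrite subr_eq0 => /eqP.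
Qed.

Lemma dist_gt0 k x y : points k x -> points k y -> x <> y -> 0 < ds k x y.
Proof.
move=> kx ky xy; rewrite lt_neqAle dist_ge0 // andbT eq_sym.
by apply/eqP => /(dist0_eq kx ky).
Qed.

(** Written as a defect from the case of a flat angle at [z]. By Cauchy-Schwarz the bracket is
    nonnegative, so that the triangle inequality and its case of equality can be read off. *)
Lemma law_of_cosines k z x y : points k z -> points k x -> points k y ->
  vers k x y = versk k (ds k z x + ds k z y)
    - (sink k (ds k z x) * sink k (ds k z y) + form k (tvec k z x) (tvec k z y)).
Proof.
move=> kz kx ky.
case: k kz kx ky => kz kx ky.
- have := coskD Sphere (ds Sphere z x) (ds Sphere z y).
  rewrite (cosk_dist kz kx) (cosk_dist kz ky) verskS /curv => ->.
  rewrite /vers /tvec !formE {1 2}/cosd (formC Sphere x z) kz /cosd; ring.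
- have := sink2_dist kz kx; have := sink2_dist kz ky.
  rewrite verskE !sinkE /vers /tvec /cosd !scale1r => ey ex.
  rewrite sqrrD ex ey.
  have -> : x - y = (x - z) - (y - z) by rewrite opprB addrA subrK.
  move: (x - z) (y - z) => a b; rewrite !formE (formC Euclidean b a); lra.
- have := coskD Hyperbolic (ds Hyperbolic z x) (ds Hyperbolic z y).
  rewrite (cosk_dist kz kx) (cosk_dist kz ky) verskH /curv => ->.
  rewrite /vers /tvec !formE {1 2}/cosd (formC Hyperbolic x z) kz.1 /cosd; ring.
Qed.

Lemma dist_triangle k x y z : points k x -> points k y -> points k z ->
  ds k x z <= ds k x y + ds k y z.
Proof.
move=> kx ky kz; rewrite (distC k x y).
have yx0 := dist_ge0 ky kx; have yz0 := dist_ge0 ky kz.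
(* On the sphere, distances are at most pi, and a sum beyond pi leaves nothing to prove. *)
have [h|h] := pselect (in_range k (ds k y x + ds k y z)); last first.
  case: k h {kx ky kz yx0 yz0} (dist_range kx kz) => h r //=; try by exfalso; apply: h.
  rewrite (le_trans (r erefl)) // leNgt; apply/negP => h'; apply: h => _; exact: ltW.
apply: (@le_versk k); [exact: dist_range|exact: addr_ge0|].
rewrite versk_dist // (law_of_cosines ky kx kz) gerBl.
have := tangent_cs ky (tvec_tangent ky kx) (tvec_tangent ky kz).
rewrite -!sink2_dist // -exprMn.
have s0 : 0 <= sink k (ds k y x) * sink k (ds k y z).
  by rewrite mulr_ge0 // sink_ge0 //; exact: dist_range.
move: (sink _ _ * _) s0 (form _ _ _) => a a0 b; nra.
Qed.

Lemma cvg_expRN t : expR (- s) @[s --> t] --> (expR (- t) : R).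
Proof.
apply: (@cvg_comp _ _ _ -%R expR _ (nbhs (- t))); first exact: opp_continuous.
exact: continuous_expR.
Qed.

Lemma continuous_sink k : continuous (@sink R k).
Proof.
rewrite unlock; case: k => t; [exact: continuous_sin|exact: cvg_id|].
apply: cvgM; last exact: cvg_cst.
apply: cvgB; [exact: continuous_expR|exact: cvg_expRN].
Qed.

Lemma continuous_cosk k : continuous (@cosk R k).
Proof.
rewrite unlock; case: k => t; [exact: continuous_cos|exact: cvg_cst|].
apply: cvgM; last exact: cvg_cst.
apply: cvgD; [exact: continuous_expR|exact: cvg_expRN].
Qed.

End Trigonometry.

Arguments cosd : simpl never.
Arguments vers : simpl never.
Arguments curv {R} k.

(** * Geodesics *)

Section Geodesics.
Variable R : realType.
Local Notation pt := 'rV[R]_3.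
Implicit Types (k : surface) (x y z u v w p q r : pt) (s t : R).

Definition unit_tangent k x u : Prop := tangent k x u /\ form k u u = 1.

Definition geod k x u t : pt := cosk k t *: x + sink k t *: u.

Definition dir k x y : pt := (sink k (ds k x y))^-1 *: tvec k x y.

Lemma geod0 k x u : geod k x u 0 = x.
Proof. by rewrite /geod cosk0 sink0 scale1r scale0r addr0. Qed.

Lemma geod_points k x u t : points k x -> unit_tangent k x u -> points k (geod k x u t).
Proof.
move=> kx [xu uu]; have e := cosk2 k t.
case: k kx xu uu e => /= [xx xu uu e|x0 u0 _ _|[xx x0] xu uu e]; rewrite /geod.
- by rewrite !formE xx uu (formC _ u x) xu; move: e; rewrite /curv => e; lra.
- by rewrite !coordE x0 u0 coskE; lra.
split.
  by rewrite !formE xx uu (formC _ u x) xu; move: e; rewrite /curv => e; lra.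
rewrite !coordE.
move: xx uu xu; rewrite /form => xx uu xu.
have := coskH_ge1 t; move: e; rewrite /curv; move: (cosk _ t) (sink _ t) => c s e c1'.
(* Cauchy-Schwarz in the coordinates [c1], [c2] bounds the time component of [u], so that the
   geodesic does not leave the upper sheet. *)
have hx : c0 u ^+ 2 <= c0 x ^+ 2 - 1.
  have : 0 <= (c1 x * c2 u - c2 x * c1 u) ^+ 2 by exact: sqr_ge0.
  have -> : (c1 x * c2 u - c2 x * c1 u) ^+ 2 =
    (c1 x * c1 x + c2 x * c2 x) * (c1 u * c1 u + c2 u * c2 u)
     - (c1 x * c1 u + c2 x * c2 u) ^+ 2 by ring.
  have -> : c1 x * c1 u + c2 x * c2 u = c0 x * c0 u by lra.
  have -> : c1 x * c1 x + c2 x * c2 x = c0 x ^+ 2 - 1 by lra.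
  have -> : c1 u * c1 u + c2 u * c2 u = c0 u ^+ 2 + 1 by lra.
  lra.
have cx0 : 0 < c * c0 x by apply: mulr_gt0 => //; lra.
have : (s * c0 u) ^+ 2 < (c * c0 x) ^+ 2.
  rewrite !exprMn; have : s ^+ 2 = c ^+ 2 - 1 by lra.
  move=> ->; have := sqr_ge0 (c0 u); move: (c0 u ^+ 2) (c0 x ^+ 2) hx => U X hx U0.
  have c2' : 1 <= c ^+ 2 by rewrite expr_ge1 //; lra.
  move: (c ^+ 2) c2' => C C1; nra.
rewrite -ltr_sqrt ?exprn_gt0 // !sqrtr_sqr (gtr0_norm cx0) ltr_norml => /andP[h _].
lra.
Qed.

Lemma cosd_geod k x u t : points k x -> unit_tangent k x u -> cosd k x (geod k x u t) = cosk k t.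
Proof.
by case: k => /= [xx|x0|[xx x0]] [xu uu]; rewrite ?coskE // /cosd /geod !formE xx ?xu; ring.
Qed.

Lemma tvec_geod k x u t : points k x -> unit_tangent k x u ->
  tvec k x (geod k x u t) = sink k t *: u.
Proof.
by move=> kx ku; rewrite /tvec cosd_geod // /geod addrC addKr.
Qed.

Lemma vers_geod k x u s t : points k x -> unit_tangent k x u ->
  vers k (geod k x u s) (geod k x u t) = versk k (s - t).
Proof.
move=> kx [xu uu]; have := coskD k s (- t); rewrite coskN sinkN.
case: k kx xu uu => /= [xx xu uu e|x0 u0 uu _|[xx x0] xu uu e]; rewrite /geod /vers.
- rewrite verskS e.
  by rewrite !formE xx uu (formC _ u x) xu /curv; ring.
- rewrite !coskE !sinkE verskE.
  have -> : 1 *: x + s *: u - (1 *: x + t *: u) = (s - t) *: u.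
    by rewrite scalerBl opprD addrACA subrr add0r.
  by rewrite !formE uu; ring.
- rewrite verskH e.
  by rewrite !formE xx uu (formC _ u x) xu /curv; ring.
Qed.

Lemma dist_geod2 k x u s t : points k x -> unit_tangent k x u ->
  in_range k `|s - t| -> ds k (geod k x u s) (geod k x u t) = `|s - t|.
Proof.
move=> kx ku h; apply: dist_eq => //; try exact: geod_points.
rewrite vers_geod //; case: (ger0P (s - t)) => _ //.
by rewrite verskN.
Qed.

Lemma dist_geod k x u t : points k x -> unit_tangent k x u -> 0 <= t ->
  in_range k t -> ds k x (geod k x u t) = t.
Proof.
move=> kx ku t0 h; rewrite -{1}(geod0 k x u) dist_geod2 // sub0r normrN ger0_norm //.
Qed.

Definition nonantipodal k x y : Prop := k = Sphere -> ds k x y < pi.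

Lemma sink_dist_gt0 k x y : points k x -> points k y -> x <> y -> nonantipodal k x y ->
  0 < sink k (ds k x y).
Proof. by move=> kx ky xy h; apply: sink_gt0 => //; exact: dist_gt0. Qed.

Lemma dir_unit k x y : points k x -> points k y -> x <> y -> nonantipodal k x y ->
  unit_tangent k x (dir k x y).
Proof.
move=> kx ky xy h; have s0 := sink_dist_gt0 kx ky xy h; split.
  by apply: tangentZ; exact: tvec_tangent.
by rewrite /dir formZl formZr -sink2_dist //; field; rewrite gt_eqF.
Qed.

Lemma tvec_dir k x y : points k x -> points k y -> x <> y -> nonantipodal k x y ->
  tvec k x y = sink k (ds k x y) *: dir k x y.
Proof.
move=> kx ky xy h; have s0 := sink_dist_gt0 kx ky xy h.
by rewrite /dir scalerA divff ?gt_eqF // scale1r.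
Qed.

Lemma geod_dir k x y : points k x -> points k y -> x <> y -> nonantipodal k x y ->
  geod k x (dir k x y) (ds k x y) = y.
Proof.
by move=> kx ky xy h; rewrite /geod -tvec_dir // cosk_dist // /tvec addrC subrK.
Qed.

(** The velocity of [geod k p w] at time [t], since [cosk] has derivative
    [- (curv k * sink k t)]. *)
Definition outdir k p w t : pt := cosk k t *: w - (curv k * sink k t) *: p.

Lemma outdirE k p w t : p = cosk k t *: geod k p w t - sink k t *: outdir k p w t.
Proof.
rewrite /outdir /geod -{1}[p]scale1r -(cosk2 k t).
by apply: row3P; rewrite !coordE; ring.
Qed.

Lemma tvec_outdir k p w t : points k p -> unit_tangent k p w ->
  tvec k (geod k p w t) p = - (sink k t *: outdir k p w t).
Proof.
move=> kp kw; rewrite /tvec cosdC cosd_geod //.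
by rewrite {1}(outdirE k p w t) addrAC subrr add0r.
Qed.

Lemma outdir_unit k p w t : points k p -> unit_tangent k p w ->
  unit_tangent k (geod k p w t) (outdir k p w t).
Proof.
move=> kp [pw ww]; rewrite /outdir /geod.
have e := cosk2 k t.
case: k kp pw ww e => /= [pp pw ww e|p0 w0 ww e|[pp _] pw ww e]; rewrite /unit_tangent /tangent.
- rewrite !formE pp ww (formC _ w p) pw; move: e; rewrite /curv /= => e; split; lra.
- rewrite !formE !coordE p0 w0 ww /curv; split; lra.
- rewrite !formE pp ww (formC _ w p) pw; move: e; rewrite /curv => e; split; lra.
Qed.

(** Together with [form_shift]: moving the origin along the geodesic transforms [cosd] and the
    component along the geodesic by the coefficients [cosk] and [sink]. The addition formulas then
    make abscissas additive ([reach_shift]). *)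
Lemma cosd_shift k p w t z : points k p -> points k z -> unit_tangent k p w ->
  cosd k (geod k p w t) z =
  cosk k t * cosd k p z + curv k * sink k t * form k w (tvec k p z).
Proof.
move=> kp kz [pw ww].
case: k kp kz pw ww => /= [pp zz pw ww|p0 z0 w0 ww|[pp _] _ pw ww]; rewrite /geod /tvec.
- by rewrite /cosd /curv !formE (formC _ w p) pw; ring.
- by rewrite /cosd coskE /curv; ring.
- by rewrite /cosd /curv !formE (formC _ w p) pw; ring.
Qed.

Lemma form_shift k p w t z : points k p -> points k z -> unit_tangent k p w ->
  form k (outdir k p w t) (tvec k (geod k p w t) z) =
  cosk k t * form k w (tvec k p z) - sink k t * cosd k p z.
Proof.
move=> kp kz kw; have [_] := outdir_unit t kp kw.
have [kt _] := outdir_unit t kp kw; move: kt.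
have [pw ww] := kw.
case: k kp kz pw ww {kw} => /= [pp zz pw ww|p0 z0 w0 ww|[pp _] _ pw ww]; rewrite /tangent.
- move=> h _; rewrite /tvec formDr formNr formZr (formC _ _ (geod _ _ _ _)) h.
  by rewrite /outdir /cosd /curv !formE (formC _ w p) pw; ring.
- move=> h _; rewrite /tvec /cosd /outdir /geod /curv !coskE !sinkE !scale1r mul0r scale0r subr0.
  by rewrite !formE ww; ring.
- move=> h _; rewrite /tvec formDr formNr formZr (formC _ _ (geod _ _ _ _)) h.
  by rewrite /outdir /cosd /curv !formE (formC _ w p) pw; ring.
Qed.

(* [reach k t p w z] says that the foot of the perpendicular from [z] to the
   geodesic issuing from [p] in direction [w] has abscissa at least [t]. *)
Definition reach k t p w z : Prop :=
  sink k t * cosd k p z <= cosk k t * form k w (tvec k p z).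

Lemma reach_shift k p w s t z : points k p -> points k z -> unit_tangent k p w ->
  reach k s (geod k p w t) (outdir k p w t) z <-> reach k (s + t) p w z.
Proof.
move=> kp kz kw; rewrite /reach cosd_shift // form_shift // sinkD coskD.
set c := cosd _ _ _; set b := form _ _ _.
by split => h; lra.
Qed.

Definition short k t : Prop := k = Sphere -> t < pi / 2.
Definition halfturn k t : Prop := k = Sphere -> - (pi / 2) <= t <= pi / 2.

Lemma cosd_gt0 k x y : points k x -> points k y -> short k (ds k x y) -> 0 < cosd k x y.
Proof.
move=> kx ky h; rewrite -cosk_dist //; have d0 := dist_ge0 kx ky.
case: k kx ky h d0 => kx ky h d0.
- rewrite coskS; apply: cos_gt0_pihalf; rewrite h // andbT; have := pi_gt0 R; lra.
- by rewrite coskE.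
- have := coskH_ge1 (ds Hyperbolic x y); lra.
Qed.

Lemma cosk_ge0 k t : halfturn k t -> 0 <= cosk k t.
Proof.
case: k => h; first by rewrite coskS; apply: cos_ge0_pihalf; exact: h.
  by rewrite coskE.
have := coskH_ge1 t; lra.
Qed.

Lemma form_le_sink k p w z : points k p -> points k z -> unit_tangent k p w ->
  `|form k w (tvec k p z)| <= sink k (ds k p z).
Proof.
move=> kp kz [pw ww].
have := tangent_cs kp pw (tvec_tangent kp kz); rewrite ww mul1r -sink2_dist //.
have s0 := sink_ge0 (dist_ge0 kp kz) (dist_range kp kz).
by rewrite -ler_sqrt ?sqr_ge0 // !sqrtr_sqr (ger0_norm s0).
Qed.

(** The distance from [p] to [z] is the hypotenuse over a leg of length at least [t]. If [t]
    exceeded it, [sink] of the difference would be positive, against [form_le_sink]. *)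
Lemma reach_dist k t p w z : points k p -> points k z -> unit_tangent k p w ->
  halfturn k t -> short k (ds k p z) -> reach k t p w z -> t <= ds k p z.
Proof.
move=> kp kz kw ht hz; rewrite /reach => h; rewrite leNgt; apply/negP => lt.
have : 0 < sink k (t - ds k p z).
  apply: sink_gt0; first by rewrite subr_gt0.
  move=> kS; have /andP[_ ] := ht kS; have := dist_ge0 kp kz; have := pi_gt0 R; lra.
rewrite sinkD sinkN coskN (cosk_dist kp kz).
have := ler_normlP _ _ (form_le_sink kp kz kw) => -[_].
have := cosk_ge0 ht; move: h.
move: (sink k t) (cosk k t) (form _ _ _) (sink _ _) (cosd _ _ _) => a b c d e *.
nra.
Qed.

Lemma reach_halfturn k p w s t z : points k p -> points k z -> unit_tangent k p w ->
  halfturn k s -> 0 <= t -> short k t -> 0 < cosd k p z ->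
  0 < cosd k (geod k p w t) z ->
  reach k s (geod k p w t) (outdir k p w t) z -> halfturn k (s + t).
Proof.
move=> kp kz kw hs t0 ht pz vz h kS; move: (hs kS) => /andP[s1 s2].
have t1 := ht kS; apply/andP; split; first lra.
rewrite leNgt; apply/negP => big.
have X := h; move: X; rewrite (reach_shift _ _ kp kz kw) /reach => X.
have Y : cosk k (s + t) * cosd k p z + sink k (s + t) * form k w (tvec k p z) =
  cosk k s * cosd k (geod k p w t) z +
  sink k s * form k (outdir k p w t) (tvec k (geod k p w t) z).
  rewrite cosd_shift // form_shift // sinkD coskD kS /curv; ring.
have cs : 0 <= cosk k s by apply: cosk_ge0.
have sn : 0 <= sink k s by apply: sink_ge0 => [|_]; have := pi_gt0 R; lra.
have c1 : cosk k (s + t) < 0.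
  rewrite kS coskS; have -> : s + t = (s + t - pi / 2) + pi / 2 by ring.
  rewrite cosDpihalf oppr_lt0; apply: sin_gt0_pi; have := pi_gt0 R; lra.
have s1' : 0 < sink k (s + t).
  by apply: sink_gt0 => [|_]; have := pi_gt0 R; lra.
have := cosk2 k s; rewrite {2}kS /curv mul1r => e.
move: h X Y; rewrite /reach.
move: (form k w (tvec k p z)) (form k (outdir k p w t) (tvec k (geod k p w t) z)) (cosd k p z)
  (cosd k (geod k p w t) z) pz vz cs sn c1 s1' e.
move: (sink k (s + t)) (cosk k (s + t)) (sink k s) (cosk k s).
move=> S C a b B Bu c' c c'0 c_0 b0 a0 C0 S0 e h X Y.
have B0 : B < 0.
  have : 0 < S * c' by exact: mulr_gt0.
  move=> h1; have h2 : 0 < C * B by lra.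
  by rewrite -(nmulr_rgt0 _ C0).
have Y0 : C * c' + S * B < 0.
  have := mulr_gt0 S0 c'0; have : C * c' < 0 by rewrite nmulr_rlt0.
  have : S * B < 0 by rewrite pmulr_rlt0.
  lra.
have : b * (C * c' + S * B) <= 0 by rewrite mulr_ge0_le0 // ltW.
rewrite Y.
have -> : b * (b * c + a * Bu) = b ^+ 2 * c + a * (b * Bu) by ring.
have := ler_wpM2l a0 h.
have -> : a * (a * c) = (1 - b ^+ 2) * c by rewrite -e; ring.
lra.
Qed.

End Geodesics.

(** * Triangles: acute angles, turning axes and points on a segment *)

Section Triangles.
Variable R : realType.
Local Notation pt := 'rV[R]_3.
Implicit Types (k : surface) (x y z u v w p q r : pt) (s t : R).

Lemma det3Z x u v s t : det3 x (s *: u) (t *: v) = s * t * det3 x u v.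
Proof. by rewrite /det3 !coordE; ring. Qed.

Lemma det3Nr x u v : det3 x u (- v) = - det3 x u v.
Proof. by rewrite /det3 !coordE; ring. Qed.

Lemma dist_le_vers k x y z w : points k x -> points k y -> points k z -> points k w ->
  ds k x y <= ds k z w -> vers k x y <= vers k z w.
Proof.
move=> kx ky kz kw h; rewrite -!versk_dist //.
by apply: versk_le; [exact: dist_ge0|exact: h|exact: dist_range].
Qed.

Lemma vers_le_dist k x y z w : points k x -> points k y -> points k z -> points k w ->
  vers k x y <= vers k z w -> ds k x y <= ds k z w.
Proof.
move=> kx ky kz kw; rewrite -!versk_dist // => h.
by apply: (@le_versk _ k) => //; [exact: dist_range|exact: dist_ge0].
Qed.

(** An obtuse angle at [z] would make the opposite side longer than [z x]; the short sides keep this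
    true on the sphere. *)
Lemma angle_acute k z x y : points k z -> points k x -> points k y ->
  short k (ds k z x) -> short k (ds k z y) -> ds k x y <= ds k z x ->
  0 <= form k (tvec k z x) (tvec k z y).
Proof.
move=> kz kx ky hx hy h.
have := dist_le_vers kx ky kz kx h.
have := cosd_gt0 kz kx hx; have := cosd_gt0 kz ky hy.
case: k kz kx ky {hx hy h} => /= [zz xx yy|z0 x0 y0|[zz z0] kx ky].
- have := cosdS_bound zz xx; have := cosdS_bound zz yy.
  rewrite /vers /tvec /cosd !formE zz (formC _ x z) => /andP[_ Cy] /andP[_ Cx] cy cx h.
  move: (form _ x y) (form _ z x) (form _ z y) cx cy Cy Cx h => a b c; nra.
- rewrite /vers /tvec /cosd !scale1r => _ _.
  have -> : x - y = (x - z) - (y - z) by rewrite opprB addrA subrK.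
  rewrite (form_subC _ z x); have := @tangent_ge0 R Euclidean z (y - z) z0.
  rewrite /tangent !coordE y0 z0 subrr => /(_ erefl).
  move: (x - z) (y - z) => a b; rewrite !formE (formC _ b a); lra.
- have := cosdH_ge1 (conj zz z0) kx; have := cosdH_ge1 (conj zz z0) ky.
  rewrite /vers /tvec /cosd !formE zz (formC _ x z) => Cy Cx cy cx h.
  move: (form _ x y) (form _ z x) (form _ z y) cx cy Cy Cx h => a b c; nra.
Qed.

(** Up to the orientation [e], let [w] be at angle [f] from [u], and [z] at angle [- t]. The sign
    conditions say [0 <= t <= t + f <= pi], where the cosine decreases. *)
Lemma planar_turn k v u w z (e : R) : points k v -> unit_tangent k v u ->
  unit_tangent k v w -> tangent k v z -> `|e| = 1 ->
  0 < e * det3 v u w -> e * det3 v u z <= 0 -> e * det3 v w z <= 0 ->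
  form k w z <= form k u z.
Proof.
move=> kv [vu uu] [vw ww] vz e1.
have := tangent_gram kv vu vw vz; have := tangent_gram kv vu vw vw.
have := tangent_cross kv vu vw vz; rewrite uu ww !mul1r => -> C E.
have e2 : e * e = 1 by rewrite -expr2 -real_normK ?num_real // e1 expr1n.
rewrite E; move: C.
move: (form k u w) (form k u z) (det3 v u w) (det3 v u z) => c X s Y C.
move=> s0 Y0 h.
have c1 : c <= 1 by have := sqr_ge0 s; nra.
have {}C : 1 = c * c + (e * s) * (e * s).
  have -> : (e * s) * (e * s) = (e * e) * (s * s) by ring.
  by rewrite e2 mul1r.
rewrite -[s * Y]mul1r -e2.
have -> : e * e * (s * Y) = (e * s) * (e * Y) by ring.
have {}h : c * (e * Y) - (e * s) * X <= 0 by move: h;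
  have -> : c * (e * Y) - (e * s) * X = e * (c * Y - s * X) by ring.
move: (e * s) (e * Y) s0 Y0 h C => S y s0 Y0 h C.
rewrite -subr_ge0 -(pmulr_rge0 _ s0).
have -> : S * (X - (c * X + S * y)) = (1 - c) * (S * X) - (S * S) * y by ring.
have : 0 <= (1 - c) * (S * X - c * y) by rewrite mulr_ge0 //; lra.
have : 0 <= (1 - c) * (- y) by rewrite mulr_ge0 //; lra.
have -> : S * S = 1 - c * c by lra.
lra.
Qed.

Lemma outdir_dir k p v : points k p -> points k v -> p <> v -> nonantipodal k p v ->
  let u := outdir k p (dir k p v) (ds k p v) in
  unit_tangent k v u /\ tvec k v p = - (sink k (ds k p v) *: u).
Proof.
move=> kp kv pv h u; have kd := dir_unit kp kv pv h.
have := outdir_unit (ds k p v) kp kd; have := tvec_outdir (ds k p v) kp kd.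
by rewrite geod_dir.
Qed.

(* The sign [e] stands for either orientation. *)
Lemma reach_extend k p v r z s (e : R) :
  points k p -> points k v -> points k r -> points k z -> `|e| = 1 ->
  nonantipodal k p v -> nonantipodal k v r ->
  0 < e * det3 p v r -> e * det3 v r z <= 0 -> e * det3 p v z <= 0 ->
  0 <= cosk k s -> reach k s v (dir k v r) z ->
  reach k s v (outdir k p (dir k p v) (ds k p v)) z.
Proof.
move=> kp kv kr kz e1 hpv hvr h1 h2 h3 cs.
have pv : p <> v by move=> h; move: h1; rewrite h det3xx mulr0 ltxx.
have vr : v <> r by move=> h; move: h1; rewrite h det3xyy mulr0 ltxx.
have [ku Tp] := outdir_dir kp kv pv hpv.
have kd := dir_unit kv kr vr hvr.
have sp := sink_dist_gt0 kp kv pv hpv; have sr := sink_dist_gt0 kv kr vr hvr.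
move: (outdir _ _ _ _) ku Tp => u ku Tp.
have Tr := tvec_dir kv kr vr hvr.
rewrite /reach => h; apply: (le_trans h); apply: ler_wpM2l => //.
(* The axis turns at [v] from the edge towards [r] to the prolongation of the edge from [p], that
   is, towards [z]. *)
apply: (@planar_turn k v u _ _ e) => //; first exact: tvec_tangent.
- have E : e * det3 p v r =
      (sink k (ds k p v) * sink k (ds k v r)) * (e * det3 v u (dir k v r)).
    rewrite (det3_cycle p v r) -(det_tvec k v) Tp Tr det3Nr det3Z det3_swap; ring.
  by move: h1; rewrite E pmulr_rgt0 // mulr_gt0.
- have E : e * det3 p v z = sink k (ds k p v) * (e * det3 v u (tvec k v z)).
    rewrite (det3_cycle p v z) -(det_tvec k v) Tp det3Nr -[tvec k v z]scale1r det3Z.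
    rewrite scale1r det3_swap; ring.
  by move: h3; rewrite E pmulr_rle0.
- have E : e * det3 v r z = sink k (ds k v r) * (e * det3 v (dir k v r) (tvec k v z)).
    rewrite -(det_tvec k v) Tr; move: (dir k v r) (tvec k v z) => d T.
    rewrite /det3 !coordE; ring.
  by move: h2; rewrite E pmulr_rle0.
Qed.

(** The vectors [tvec] from [q] to [x] and to [y] are opposite, so that the law of cosines at [q] is
    that of a flat angle. *)
Lemma dist_between k x y q s t : points k x -> points k y -> points k q ->
  nonantipodal k q x -> nonantipodal k q y ->
  q = s *: x + t *: y -> 0 < s -> 0 < t ->
  ds k x q + ds k q y = ds k x y.
Proof.
move=> kx ky kq hx hy qE s0 t0.
have [xq|xq] := pselect (q = x); first by rewrite xq distxx // add0r.
have [yq|yq] := pselect (q = y); first by rewrite yq distxx // addr0.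
have E : s * cosd k q x + t * cosd k q y = 1.
  rewrite -(cosdxx kq); case: k kx ky kq {hx hy} => kx ky kq; rewrite /cosd.
  - by rewrite {4}qE !formE.
  - by have := congr1 (@c0 R) qE; rewrite !coordE kx ky kq; lra.
  - by rewrite {4}qE !formE; ring.
have T0 : s *: tvec k q x + t *: tvec k q y = 0.
  rewrite /tvec !scalerBr !scalerA addrACA -qE -opprD -scalerDl E scale1r subrr.
  by [].
have sx := sink_dist_gt0 kq kx xq hx; have sy := sink_dist_gt0 kq ky yq hy.
have Tx : tvec k q x = - ((t / s) *: tvec k q y).
  apply: (scalerI (lt0r_neq0 s0)); rewrite scalerN scalerA mulrCA divff ?lt0r_neq0 // mulr1.
  by apply/eqP; rewrite -addr_eq0 T0.
have e2 : sink k (ds k q x) ^+ 2 = ((t / s) * sink k (ds k q y)) ^+ 2.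
  rewrite !sink2_dist // Tx formNl formNr formZl formZr exprMn sink2_dist //; ring.
have ts0 : 0 < t / s by rewrite divr_gt0.
have {}e2 : sink k (ds k q x) = (t / s) * sink k (ds k q y).
  have h1 : 0 <= (t / s) * sink k (ds k q y) by rewrite mulr_ge0 // ltW.
  by apply/eqP; rewrite -(eqrXn2 (n := 2)) // ?e2 // ltW.
have V : vers k x y = versk k (ds k q x + ds k q y).
  rewrite (law_of_cosines kq kx ky) Tx formNl formZl -sink2_dist // e2; ring.
rewrite (distC k x q); symmetry; apply: dist_eq => //.
  by rewrite addr_ge0 // dist_ge0.
(* A sum of distances beyond pi has to be excluded on the sphere: its sine equals
   [sink k (ds k q y) / s], which is positive. *)
move=> kS; have rx := hx kS; have ry := hy kS.
rewrite leNgt; apply/negP => big.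
have : 0 < sin (ds k q x + ds k q y - pi).
  by apply: sin_gt0_pi; rewrite subr_gt0 big /=; lra.
have -> : sin (ds k q x + ds k q y - pi) = - sin (ds k q x + ds k q y).
  by have := sinDpi (ds k q x + ds k q y - pi); rewrite subrK => ->; rewrite opprK.
have : sink k (ds k q x + ds k q y) = sink k (ds k q y) / s.
  rewrite sinkD !cosk_dist // e2.
  have -> : cosd k q x = (1 - t * cosd k q y) / s by rewrite -E; field; rewrite lt0r_neq0.
  by field; rewrite lt0r_neq0.
rewrite {1}kS sinkS => ->.
have : 0 < sink k (ds k q y) / s by rewrite divr_gt0.
lra.
Qed.

(** By the law of cosines at [x], equality in the triangle inequality forces equality in
    Cauchy-Schwarz between the directions towards [z] and [y]. *)
Lemma segment_geod k x y z : points k x -> points k y -> points k z -> x <> y ->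
  nonantipodal k x y -> ds k x z + ds k z y = ds k x y ->
  z = geod k x (dir k x y) (ds k x z).
Proof.
move=> kx ky kz xy h E.
have kd := dir_unit kx ky xy h.
have hz : versk k (ds k z y) = versk k (ds k x z - ds k x y).
  have -> : ds k x z - ds k x y = - ds k z y by rewrite -E; ring.
  by rewrite verskN.
have sxy := sink_dist_gt0 kx ky xy h.
have F : form k (tvec k x z) (dir k x y) = sink k (ds k x z).
  have := law_of_cosines kx kz ky; rewrite -versk_dist // hz.
  rewrite (tvec_dir kx ky xy h) formZr.
  have G : versk k (ds k x z + ds k x y) - versk k (ds k x z - ds k x y) =
     2 * (sink k (ds k x z) * sink k (ds k x y)).
    case: k {kx ky kz h E kd hz sxy} => /=.
    - rewrite !verskS !coskD coskN sinkN /curv; ring.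
    - by rewrite !verskE !sinkE; lra.
    - rewrite !verskH !coskD coskN sinkN /curv; ring.
  move=> e; have : sink k (ds k x y) * (form k (tvec k x z) (dir k x y) - sink k (ds k x z)) = 0.
    by lra.
  move/eqP; rewrite mulf_eq0 gt_eqF //= subr_eq0 => /eqP.
  by [].
have : tvec k x z - sink k (ds k x z) *: dir k x y = 0.
  apply: (tangent_eq0 kx).
    apply: tangentD; first exact: tvec_tangent.
    by apply: tangentN; apply: tangentZ; exact: kd.1.
  move: F kd.2 (sink2_dist kx kz); move: (tvec k x z) (dir k x y) => T d F dd ss.
  rewrite !formE (formC _ d T) F dd -ss; ring.
move/eqP; rewrite subr_eq0 => /eqP e.
by rewrite /geod -e cosk_dist // /tvec addrC subrK.
Qed.

Lemma geod_dir_combination k x y t : points k x -> points k y -> x <> y ->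
  nonantipodal k x y ->
  geod k x (dir k x y) t =
  (sink k (ds k x y - t) / sink k (ds k x y)) *: x
  + (sink k t / sink k (ds k x y)) *: y.
Proof.
move=> kx ky xy h; have s0 := sink_dist_gt0 kx ky xy h.
rewrite /geod /dir /tvec -cosk_dist // sinkD sinkN coskN.
by apply: row3P; rewrite !coordE; field; rewrite gt_eqF.
Qed.

End Triangles.

(** * Adding a vertex to a convex polygon *)

Section Insertion.
Variables (R : realType) (k : surface).
Local Notation pt := 'rV[R]_3.
Implicit Types (x y z v w p q r : pt) (s t e : R) (X : set pt).

(* Holds with [X] the past of a self-expanding curve and [z] its endpoint. *)
Record newest X z : Prop := Newest {
  newest_point : points k z;
  newest_points : forall x, X x -> points k x;
  newest_short : forall x, X x -> short k (ds k z x);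
  newest_short2 : forall x y, X x -> X y -> short k (ds k x y);
  newest_dist : forall x y, X x -> X y -> ds k x y <= ds k z x \/ ds k x y <= ds k z y }.

Lemma short_nonantipodal x y : short k (ds k x y) -> nonantipodal k x y.
Proof. by move=> h kS; have := h kS; have := pi_gt0 R; lra. Qed.

Lemma newest_acute X z x y : newest X z -> X x -> X y ->
  0 <= form k (tvec k z x) (tvec k z y).
Proof.
move=> [kz kX sz sX d] Xx Xy.
case: (d _ _ Xx Xy) => h; first by apply: angle_acute => //; auto.
by rewrite formC; apply: angle_acute; auto; rewrite distC.
Qed.

Lemma tvec_gt0 z x : points k z -> points k x -> x <> z -> short k (ds k z x) ->
  0 < form k (tvec k z x) (tvec k z x).
Proof.
move=> kz kx xz h; rewrite -sink2_dist // exprn_gt0 //; apply: sink_dist_gt0 => //.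
  by move=> e; apply: xz.
exact: short_nonantipodal.
Qed.

Section Angular.
Variables (X : set pt) (z : pt).
Hypothesis XZ : newest X z.

Lemma angular_cross a b c : X a -> X b -> X c ->
  form k (tvec k z b) (tvec k z b) * det3 z a c =
  form k (tvec k z a) (tvec k z b) * det3 z b c
  + det3 z a b * form k (tvec k z b) (tvec k z c).
Proof.
move=> Xa Xb Xc; have [kz kX _ _ _] := XZ.
have := tangent_cross kz (tvec_tangent kz (kX _ Xb)) (tvec_tangent kz (kX _ Xa))
  (tvec_tangent kz (kX _ Xc)).
by rewrite !det_tvec => ->; rewrite (det3_swap z a b) (formC k (tvec k z b)); ring.
Qed.

(** Any two points of [X] subtend at most a right angle at [z]; within such an angle the
    counterclockwise order around [z] is transitive. *)
Lemma angular_trans_le a b c : X a -> X b -> X c -> b <> z ->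
  0 <= det3 z a b -> 0 <= det3 z b c -> 0 <= det3 z a c.
Proof.
move=> Xa Xb Xc bz ab bc; have [kz kX sz _ _] := XZ.
rewrite -(pmulr_rge0 _ (tvec_gt0 kz (kX _ Xb) bz (sz _ Xb))) angular_cross //.
by rewrite addr_ge0 // mulr_ge0 //; exact: newest_acute XZ _ _.
Qed.

(** If [det3 z a c] vanished, both nonnegative terms of [angular_cross] would vanish. The strict
    turn then makes [b] orthogonal to [a] and to [c] on different sides, so that [a] and [c] are in
    opposite directions, against [newest_acute]. *)
Lemma angular_trans a b c : X a -> X b -> X c -> a <> z -> b <> z -> c <> z ->
  0 <= det3 z a b -> 0 <= det3 z b c -> 0 < det3 z a b \/ 0 < det3 z b c ->
  0 < det3 z a c.
Proof.
move=> Xa Xb Xc az bz cz ab bc h; have [kz kX sz _ _] := XZ.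
rewrite lt_neqAle (angular_trans_le Xa Xb Xc) // andbT eq_sym; apply/eqP => ac.
have aa := tvec_gt0 kz (kX _ Xa) az (sz _ Xa).
have bb := tvec_gt0 kz (kX _ Xb) bz (sz _ Xb).
have cc := tvec_gt0 kz (kX _ Xc) cz (sz _ Xc).
have gab := tangent_gram kz (tvec_tangent kz (kX _ Xb)) (tvec_tangent kz (kX _ Xa))
  (tvec_tangent kz (kX _ Xc)).
have gaa := tangent_gram kz (tvec_tangent kz (kX _ Xb)) (tvec_tangent kz (kX _ Xa))
  (tvec_tangent kz (kX _ Xa)).
have gcc := tangent_gram kz (tvec_tangent kz (kX _ Xb)) (tvec_tangent kz (kX _ Xc))
  (tvec_tangent kz (kX _ Xc)).
move: gab gaa gcc; rewrite !det_tvec (det3_swap z a b).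
have := angular_cross Xa Xb Xc; rewrite ac mulr0.
have := newest_acute XZ Xa Xb; have := newest_acute XZ Xb Xc; have := newest_acute XZ Xa Xc.
rewrite (formC k (tvec k z b) (tvec k z a)).
move: (form k (tvec k z a) (tvec k z a)) (form k (tvec k z b) (tvec k z b)) aa bb.
move: (form k (tvec k z c) (tvec k z c)) cc (form k (tvec k z a) (tvec k z b)).
move: (form k (tvec k z b) (tvec k z c)) (form k (tvec k z a) (tvec k z c)).
move: (det3 z a b) (det3 z b c) ab bc h => S T S0 T0 h BC AC cc c0 AB aa bb a0 b0.
move=> AC0 BC0 AB0 e g1 g2 g3.
have z1 : AB * T = 0.
  by have := mulr_ge0 AB0 T0; have := mulr_ge0 S0 BC0; lra.
have z2 : S * BC = 0.
  by have := mulr_ge0 AB0 T0; have := mulr_ge0 S0 BC0; lra.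
have p1 : 0 < bb * aa by rewrite mulr_gt0.
have p2 : 0 < bb * cc by rewrite mulr_gt0.
case: h => h.
- have BC00 : BC = 0.
    by move/eqP: z2; rewrite mulf_eq0 gt_eqF //= => /eqP.
  have T1 : 0 < T.
    rewrite lt_neqAle T0 andbT eq_sym; apply/eqP => T00.
    by move: p2; rewrite g3 BC00 T00; lra.
  have AB00 : AB = 0.
    by move/eqP: z1; rewrite mulf_eq0 (gt_eqF T1) orbF => /eqP.
  have := mulr_gt0 h T1; have := mulr_ge0 (ltW b0) AC0; rewrite g1 AB00; lra.
- have AB00 : AB = 0.
    by move/eqP: z1; rewrite mulf_eq0 (gt_eqF h) orbF => /eqP.
  have S1 : 0 < S.
    rewrite lt_neqAle S0 andbT eq_sym; apply/eqP => S00.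
    by move: p1; rewrite g2 AB00 S00; lra.
  have := mulr_gt0 S1 h; have := mulr_ge0 (ltW b0) AC0; rewrite g1 AB00; lra.
Qed.

(* When [v] has to be dropped because [z], its predecessor [p] and [v] are not in
   counterclockwise order, the reach [s] beyond [v] passes on to [p], increased by
   the length of the lost edge. *)
Definition droppable e p v s : Prop :=
  e * det3 z p v <= 0 ->
  halfturn k (s + ds k p v) /\ reach k (s + ds k p v) p (dir k p v) z.

(** [reach_extend] turns the axis at [v] into the prolongation of the edge from [p], and
    [reach_shift] slides its origin back to [p]; [reach_halfturn] keeps the abscissa within a
    quarter turn. *)
Lemma droppable_step e p v r s : `|e| = 1 -> X p -> X v -> X r ->
  0 < e * det3 p v r -> e * det3 z v r <= 0 ->
  halfturn k s -> reach k s v (dir k v r) z -> droppable e p v s.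
Proof.
move=> e1 Xp Xv Xr pvr zvr hs rs zpv; have [kz kX sz sX _] := XZ.
have [kp kv kr] := And3 (kX _ Xp) (kX _ Xv) (kX _ Xr).
have hpv := short_nonantipodal (sX _ _ Xp Xv).
have pv : p <> v by move=> h; move: pvr; rewrite h det3xx mulr0 ltxx.
have kd := dir_unit kp kv pv hpv.
have := @reach_extend _ k p v r z s e kp kv kr kz e1 hpv (short_nonantipodal (sX _ _ Xv Xr)) pvr.
rewrite -!(det3_cycle z) => /(_ zvr zpv (cosk_ge0 hs) rs).
rewrite -[X in reach _ _ X _ _](geod_dir kp kv pv hpv) => h.
split; last by rewrite -reach_shift.
apply: (reach_halfturn kp kz kd hs) h => //.
- exact: dist_ge0.
- exact: sX.
- by rewrite cosdC; apply: cosd_gt0 => //; exact: sz.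
- by rewrite geod_dir // cosdC; apply: cosd_gt0 => //; exact: sz.
Qed.

Definition chain_length (q : nat -> pt) m n : R := \sum_(m <= i < n) ds k (q i) (q i.+1).

Definition strict_chain (q : nat -> pt) m n : Prop :=
  forall i j l, (m <= i)%N -> (i < j)%N -> (j < l)%N -> (l <= n)%N ->
    0 < det3 (q i) (q j) (q l).

(** Positivity spreads from the chord and the two end edges: each Plücker relation gives one more
    [det3 z] as a combination, with positive coefficients, of those already known. *)
Lemma visible_chain (q : nat -> pt) m n : strict_chain q m n -> (m < n)%N ->
  0 < det3 z (q m) (q n) -> 0 < det3 z (q m) (q m.+1) -> 0 < det3 z (q n.-1) (q n) ->
  forall i j, (m <= i)%N -> (i < j)%N -> (j <= n)%N -> 0 < det3 z (q i) (q j).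
Proof.
move=> sc mn zmn zm zn.
have zmi i : (m < i)%N -> (i <= n)%N -> 0 < det3 z (q m) (q i).
  move=> mi; rewrite leq_eqVlt => /predU1P[->//|ni].
  have [->//|mi'] := eqVneq i m.+1.
  have i2 : (m.+1 < i)%N by rewrite ltn_neqAle eq_sym mi'.
  have := plucker (q m) z (q m.+1) (q i) (q n).
  rewrite (det3_swap12 z (q m)) (det3_swap12 z (q m) (q i)) (det3_swap12 z (q m) (q n)).
  have m1n := ltn_trans i2 ni.
  have h1 := sc _ _ _ (leqnn m) mi ni (leqnn _).
  have h2 := sc _ _ _ (leqnn m) (ltnSn m) m1n (leqnn _).
  have h3 := sc _ _ _ (leqnn m) (ltnSn m) i2 (ltnW ni).
  rewrite -(pmulr_lgt0 _ h2).
  have := mulr_gt0 zm h1; have := mulr_gt0 zmn h3; lra.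
have zin i : (m <= i)%N -> (i < n)%N -> 0 < det3 z (q i) (q n).
  rewrite leq_eqVlt => /predU1P[<-//|mi] ni.
  have [->//|ni'] := eqVneq i n.-1.
  have i2 : (i < n.-1)%N by rewrite ltn_neqAle ni' -ltnS prednK // (leq_ltn_trans _ ni).
  have n1n : (n.-1 < n)%N by rewrite ltn_predL (leq_ltn_trans _ ni).
  have := plucker (q n) z (q m) (q i) (q n.-1).
  have -> : det3 (q n) (q i) (q n.-1) = det3 (q i) (q n.-1) (q n) by rewrite det3_cycle.
  have -> : det3 (q n) (q m) (q n.-1) = det3 (q m) (q n.-1) (q n) by rewrite det3_cycle.
  have -> : det3 (q n) (q m) (q i) = det3 (q m) (q i) (q n) by rewrite det3_cycle.
  rewrite !(det3_cycle (q n) z).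
  have h1 := sc _ _ _ (ltnW mi) i2 n1n (leqnn _).
  have h2 := sc _ _ _ (leqnn m) (ltn_trans mi i2) n1n (leqnn _).
  have h3 := sc _ _ _ (leqnn m) mi ni (leqnn _).
  move: h1 h2 h3 zmn zn; move: (det3 _ _ _) (det3 _ _ _) (det3 _ _ _) (det3 _ _ _) => a b c d *.
  nra.
move=> i j; rewrite leq_eqVlt => /predU1P[<-|mi] ij jn; first exact: zmi.
move: jn; rewrite leq_eqVlt => /predU1P[jn|jn].
  by rewrite jn; apply: zin; [exact: ltnW|rewrite -jn].
have := plucker (q i) z (q m) (q j) (q n).
have iN := ltn_trans ij jn.
rewrite (det3_swap12 z (q i) (q j)) (det3_swap12 z (q i) (q n)).
rewrite (det3_swap12 (q m) (q i) (q n)) (det3_swap12 (q m) (q i) (q j)).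
rewrite (det3_cycle (q i) z (q m)).
have h1 := sc _ _ _ (ltnW mi) ij jn (leqnn _).
have h2 := sc _ _ _ (leqnn m) mi iN (leqnn _).
have h3 := sc _ _ _ (leqnn m) mi ij (ltnW jn).
have h4 := zmi _ mi (ltnW iN); have h5 := zin _ (ltnW mi) iN.
rewrite -(pmulr_lgt0 _ h2).
have := mulr_gt0 h4 h1; have := mulr_gt0 h5 h3; lra.
Qed.

(* The ends of the chain are dropped until [z] sees all of it; [sr] and [sl], which
   bound the two new edges from below, absorb the dropped ones. *)
Lemma insert_chain (q : nat -> pt) n m sr sl :
  (forall i, (m <= i <= m + n)%N -> X (q i) /\ q i <> z) ->
  strict_chain q m (m + n) -> ((0 < n)%N -> 0 < det3 z (q m) (q (m + n)%N)) ->
  sr <= ds k (q (m + n)%N) z -> sl <= ds k z (q m) ->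
  ((0 < n)%N -> droppable 1 (q (m + n).-1) (q (m + n)%N) sr) ->
  ((0 < n)%N -> droppable (-1) (q m.+1) (q m) sl) ->
  exists m' n', [/\ (m <= m')%N, (m' + n' <= m + n)%N,
    forall i j, (m' <= i)%N -> (i < j)%N -> (j <= m' + n')%N -> 0 < det3 z (q i) (q j) &
    chain_length q m (m + n) + sr + sl <=
      ds k z (q m') + chain_length q m' (m' + n') + ds k (q (m' + n')%N) z].
Proof.
have [kz kX sz sX _] := XZ.
elim: n m sr sl => [|n IH] m sr sl Xq sc vis hr hl dr dl.
  exists m, 0%N; split => //.
  - by move=> i j mi ij; rewrite addn0 leqNgt (leq_ltn_trans mi ij).
  - by rewrite addn0 /chain_length big_geq // in hr *; lra.
have visn := vis isT.
have [n0|n0] := posnP n.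
  exists m, n.+1; split => //; last by lra.
  move=> i j mi ij; rewrite n0 addn1 => jm.
  have -> : i = m by apply/eqP; rewrite eqn_leq mi andbT -ltnS (leq_trans ij).
  have -> : j = m.+1 by apply/eqP; rewrite eqn_leq jm (leq_ltn_trans mi ij).
  by move: visn; rewrite n0 addn1.
have Xat i : (m <= i)%N -> (i <= m + n.+1)%N -> X (q i) /\ q i <> z.
  by move=> h1 h2; apply: Xq; rewrite h1.
have [Xm zm] := Xat m (leqnn _) (leq_addr _ _).
have [Xn zn] := Xat _ (leq_addr n.+1 m) (leqnn _).
have mn : (m + n <= m + n.+1)%N by rewrite leq_add2l.
have [Xn1 zn1] := Xat _ (leq_addr n m) mn.
have m1N : (m.+1 <= m + n.+1)%N by rewrite addnS ltnS leq_addr.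
have [Xm1 zm1] := Xat m.+1 (leqnSn _) m1N.
(* In the nonpositive case the last vertex is dropped, and the reach [sr] beyond it passes on to its
   predecessor, increased by the lost edge. *)
have [h|h] := leP (det3 z (q (m + n)%N) (q (m + n.+1)%N)) 0.
  have [ht rt] : halfturn k (sr + ds k (q (m + n)%N) (q (m + n.+1)%N)) /\
      reach k (sr + ds k (q (m + n)%N) (q (m + n.+1)%N)) (q (m + n)%N)
        (dir k (q (m + n)%N) (q (m + n.+1)%N)) z.
    by have := dr isT; rewrite addnS /= -addnS /droppable mul1r; exact.
  have pv : q (m + n)%N <> q (m + n.+1)%N.
    move=> e; have := sc m (m + n)%N (m + n.+1)%N (leqnn _); rewrite -addn1 leq_add2l n0.
    by rewrite ltn_add2l ltnS !leqnn => /(_ isT isT isT); rewrite e det3xyy ltxx.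
  have kd := dir_unit (kX _ Xn1) (kX _ Xn) pv (short_nonantipodal (sX _ _ Xn1 Xn)).
  have [] := IH m (sr + ds k (q (m + n)%N) (q (m + n.+1)%N)) sl.
  - by move=> i /andP[h1 h2]; apply: Xat => //; exact: leq_trans h2 _.
  - by move=> i j l h1 h2 h3 h4; apply: sc => //; exact: leq_trans h4 _.
  (* The chord of the shortened chain is still seen: around [z] the predecessor does not come before
     the dropped vertex. *)
  - move=> _; apply: (angular_trans Xm Xn Xn1) => //; first exact: ltW.
      by rewrite det3_swap oppr_ge0.
    by left.
  - apply: (reach_dist (kX _ Xn1) kz kd) => //.
    by rewrite distC; exact: sz.
  - exact: hl.
  - move=> _; have n1 : (m <= (m + n).-1)%N.
      by rewrite -ltnS prednK ?addn_gt0 ?n0 ?orbT // -addn1 leq_add2l.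
    have n2 : ((m + n).-1 < m + n)%N by rewrite ltn_predL addn_gt0 n0 orbT.
    have [Xn2 _] := Xat _ n1 (leq_trans (ltnW n2) mn).
    have det0 : 0 < det3 (q (m + n).-1) (q (m + n)%N) (q (m + n.+1)%N).
      by apply: sc => //; rewrite addnS.
    apply: (@droppable_step 1 _ _ (q (m + n.+1)%N) _ (normr1 _) Xn2 Xn1 Xn _ _ ht rt).
      by rewrite mul1r.
    by rewrite mul1r.
  - by move=> _; apply: dl.
  move=> m' [n' [mm' nn' vis' len]]; exists m', n'; split => //.
    exact: leq_trans nn' mn.
  apply: le_trans len; rewrite /chain_length addnS big_nat_recr ?leq_addr //=.
  lra.
(* The same at the other end of the chain, with reversed orientation. *)
have [h'|h'] := leP (det3 z (q m) (q m.+1)) 0.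
  have [ht rt] : halfturn k (sl + ds k (q m.+1) (q m)) /\
      reach k (sl + ds k (q m.+1) (q m)) (q m.+1) (dir k (q m.+1) (q m)) z.
    by have := dl isT; rewrite /droppable det3_swap mulN1r opprK; exact.
  have m1n : (m.+1 < m + n.+1)%N by rewrite addnS ltnS -addn1 leq_add2l.
  have pv : q m.+1 <> q m.
    move=> e; have := sc m m.+1 (m + n.+1)%N (leqnn _) (leqnn _) m1n (leqnn _).
    by rewrite e det3xx ltxx.
  have kd := dir_unit (kX _ Xm1) (kX _ Xm) pv (short_nonantipodal (sX _ _ Xm1 Xm)).
  have [] := IH m.+1 sr (sl + ds k (q m.+1) (q m)).
  - by move=> i /andP[h1 h2]; apply: Xat; [exact: ltnW|rewrite addnS -addSn].
  - move=> i j l h1 h2 h3 h4; apply: sc => //; first exact: ltnW.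
    by rewrite addnS -addSn.
  - move=> _; rewrite addSn -addnS; apply: (angular_trans Xm1 Xm Xn) => //; last by right.
      by rewrite det3_swap oppr_ge0.
    exact: ltW.
  - by rewrite addSn -addnS.
  - rewrite (distC k z); apply: (reach_dist (kX _ Xm1) kz kd) => //.
    by rewrite distC; exact: sz.
  - by move=> _; rewrite addSn -addnS; apply: dr.
  - move=> _; have m2 : (m.+2 <= m + n.+1)%N by [].
    have [Xm2 _] := Xat _ (leqW (leqnSn _)) m2.
    have det0 : 0 < det3 (q m) (q m.+1) (q m.+2) by apply: sc.
    apply: (@droppable_step (-1) _ _ (q m) _ (normrN1 _) Xm2 Xm1 Xm _ _ ht rt).
      by rewrite mulN1r -det3_swap det3_cycle.
    by rewrite mulN1r det3_swap opprK.
  move=> m' [n' [mm' nn' vis' len]]; exists m', n'; split => //.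
  - exact: ltnW.
  - by rewrite addnS -addSn.
  apply: le_trans len; rewrite /chain_length addSn -addnS.
  rewrite [X in X + _ + _ <= _]big_ltn ?addnS ?ltnS ?leq_addr // (distC k (q m.+1)).
  by lra.
exists m, n.+1; split => //; last by lra.
apply: (visible_chain sc m1N visn h').
by move: h; rewrite addnS.
Qed.

End Angular.
End Insertion.

(** * Closed polygons and the insertion of the newest point *)

Section Polygons.
Variables (R : realType) (k : surface).
Local Notation pt := 'rV[R]_3.
Implicit Types (x y z v w p r : pt) (q : nat -> pt) (s t e : R) (X Y : set pt).

(** The vertices are [q 0], ..., [q n.-1]; further values of [q] are arbitrary. The condition on all
    triples, not just consecutive ones, excludes polygons that wind several times and passes to
    subsequences. *)
Definition spoly X n q : Prop :=
  [/\ (0 < n)%N, forall i, (i < n)%N -> X (q i) &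
      forall i j l, (i < j)%N -> (j < l)%N -> (l < n)%N -> 0 < det3 (q i) (q j) (q l)].

Definition plen n q : R := chain_length k q 0 n.-1 + ds k (q n.-1) (q 0%N).

Lemma spoly_sub X Y n q : X `<=` Y -> spoly X n q -> spoly Y n q.
Proof. by move=> XY [n0 Xq sq]; split => // i /Xq/XY. Qed.

Lemma rotate1 X n q : spoly X n q ->
  exists2 q', spoly X n q' /\ plen n q' = plen n q &
    forall j, (j < n)%N -> q' j = q (j.+1 %% n)%N.
Proof.
case: n => [[]//|n] [_ Xq sq]; exists (fun j => q (j.+1 %% n.+1)%N) => //.
have sm j : (j < n)%N -> (j.+1 %% n.+1 = j.+1)%N by move=> jn; rewrite modn_small.
split; last first.
  rewrite /plen /= modnn /chain_length.
  rewrite (@eq_big_nat _ _ _ _ _ _ (fun i => ds k (q i.+1) (q (i.+2 %% n.+1)%N))); last first.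
    by move=> i /andP[_ h]; rewrite sm.
  case: n {Xq sq} sm => [|n] sm; first by rewrite !big_geq.
  rewrite big_nat_recr //= modnn [in RHS]big_nat_recl //=.
  rewrite (@eq_big_nat _ _ _ _ _ _ (fun i => ds k (q i.+1) (q i.+2))); last first.
    by move=> i /andP[_ h]; rewrite sm.
  by rewrite modn_small //; lra.
split=> //; first by move=> i _; apply: Xq; rewrite ltn_mod.
move=> i j l ij jl; rewrite ltnS leq_eqVlt => /predU1P[ln|ln].
  rewrite ln modnn !sm ?(ltn_trans ij) // -?ln //.
  by rewrite -det3_cycle; apply: sq => //; rewrite ltnS -ln.
have jn := ltn_trans jl ln; have in' := ltn_trans ij jn.
by rewrite !sm //; apply: sq.
Qed.

Lemma rotate X n q i : spoly X n q ->
  exists2 q', spoly X n q' /\ plen n q' = plen n q &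
    forall j, (j < n)%N -> q' j = q ((i + j) %% n)%N.
Proof.
move=> sq; elim: i => [|i [q' [sq' <-] q'E]].
  by exists q => // j jn; rewrite add0n modn_small.
have [q2 [sq2 <-] q2E] := rotate1 sq'; exists q2 => // j jn.
have n0 : (0 < n)%N by case: sq.
by rewrite q2E // q'E ?ltn_mod // modnDmr addnS addSn.
Qed.

Definition cone_polygon z q m : nat -> pt := fun i => if i is i'.+1 then q (m + i')%N else z.

Lemma cone_polygonP Y z q m n : Y z -> (forall i, (m <= i <= m + n)%N -> Y (q i)) ->
  strict_chain q m (m + n) ->
  (forall i j, (m <= i)%N -> (i < j)%N -> (j <= m + n)%N -> 0 < det3 z (q i) (q j)) ->
  spoly Y n.+2 (cone_polygon z q m) /\
  plen n.+2 (cone_polygon z q m) =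
    ds k z (q m) + chain_length k q m (m + n) + ds k (q (m + n)%N) z.
Proof.
move=> Yz Yq sq vis; split; first split => //.
- by case=> [|i] //= h; apply: Yq; rewrite leq_addr leq_add2l.
- move=> [|i] [|j] [|l] //=; rewrite !ltnS.
  + by move=> _ jl ln; apply: vis; rewrite ?leq_addr ?ltn_add2l ?leq_add2l.
  + by move=> ij jl ln; apply: sq; rewrite ?leq_addr ?ltn_add2l ?leq_add2l.
rewrite /plen /chain_length /= big_nat_recl //= addn0; congr (_ + _ + _).
rewrite -[RHS]/(\sum_(0 + m <= i < m + n) ds k (q i) (q i.+1)) big_addn addKn;
  apply: eq_big_nat => i _.
by rewrite addnC addnS addnC.
Qed.

Lemma plen1 q X : (forall x, X x -> points k x) -> spoly X 1 q -> plen 1 q = 0.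
Proof.
move=> kX [_ Xq _]; rewrite /plen /chain_length big_geq //= distxx ?addr0 //.
by apply: kX; apply: Xq.
Qed.

Lemma plen2 q : plen 2 q = 2 * ds k (q 0%N) (q 1%N).
Proof. by rewrite /plen /chain_length big_nat1 /= (distC k (q 1%N)); ring. Qed.

Lemma spoly2 Y x y : Y x -> Y y ->
  exists2 q, spoly Y 2 q & q 0%N = x /\ q 1%N = y.
Proof.
move=> Yx Yy; exists (fun i => if i is 0%N then x else y) => //; split => //.
- by case=> [|[|]].
- by move=> [|[|i]] [|[|j]] [|[|l]].
Qed.

Lemma spoly1 Y x : Y x -> exists2 q, spoly Y 1 q & q 0%N = x.
Proof.
move=> Yx; exists (fun=> x) => //; split => //.
by move=> i j [|l] //= _; rewrite ltn0.
Qed.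

(* The foot of the perpendicular from [z] to the geodesic through [x] and [y]. *)
Lemma reach_split x y z : points k x -> points k y -> points k z -> x <> y ->
  short k (ds k x y) -> short k (ds k x z) -> short k (ds k y z) ->
  exists s t, [/\ s + t = ds k x y, halfturn k s, halfturn k t,
    reach k s x (dir k x y) z & reach k t y (dir k y x) z].
Proof.
move=> kx ky kz xy hxy hxz hyz.
have kd := dir_unit kx ky xy (short_nonantipodal hxy).
set b := form k (dir k x y) (tvec k x z); set c := cosd k x z.
(* [f] vanishes at the abscissa of the foot. It has opposite signs at plus and minus the distance
   from [x] to [z], by [form_le_sink]. *)
pose f (t : R) := sink k t * c - cosk k t * b.
have d0 := dist_ge0 kx kz.
have [t] : exists2 t, t \in `[- ds k x z, ds k x z] & f t = 0.
  have cf : {within `[- ds k x z, ds k x z], continuous f}.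
    apply: continuous_subspaceT => t.
    by apply: cvgB; apply: cvgM;
      [exact: continuous_sink|exact: cvg_cst|exact: continuous_cosk|exact: cvg_cst].
  have lb := form_le_sink kx kz kd; rewrite -/b in lb.
  have c0' : 0 < c by apply: cosd_gt0.
  have f1 : 0 <= f (ds k x z).
    rewrite /f cosk_dist // -/c mulrC -mulrBr; apply: mulr_ge0; first exact: ltW.
    rewrite subr_ge0; exact: le_trans (ler_norm _) lb.
  have f2 : f (- ds k x z) <= 0.
    rewrite /f sinkN coskN cosk_dist // -/c mulNr (mulrC (sink _ _)) -opprD -mulrDr.
    rewrite oppr_le0; apply: mulr_ge0; first exact: ltW.
    by move: lb; rewrite ler_norml => /andP[h _]; lra.
  have le : - ds k x z <= ds k x z by lra.
  by apply: (@IVT _ f _ _ 0 le cf); rewrite ge_min le_max f1 f2 orbT.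
rewrite in_itv /= => /andP[t1 t2] ft; have {}ft : sink k t * c = cosk k t * b by apply/eqP;
  rewrite -subr_eq0 -/(f t) ft.
have ht : halfturn k t.
  by move=> kS; have := hxz kS; have := pi_gt0 R; lra.
have ht' : halfturn k (- t).
  by move=> kS; have := hxz kS; have := pi_gt0 R; lra.
have yx : y <> x by move=> e; apply: xy.
have hyx : short k (ds k y x) by rewrite distC.
have kd' := dir_unit ky kx yx (short_nonantipodal hyx).
have [ko To] := outdir_dir ky kx yx (short_nonantipodal hyx).
have sp := sink_dist_gt0 ky kx yx (short_nonantipodal hyx).
(* The geodesic from [y] arrives at [x] with the direction opposite to that of [y]. The foot, of
   abscissa [- t] on this prolongation, thus has abscissa [- t + ds k y x] from [y]. *)
have oE : outdir k y (dir k y x) (ds k y x) = - dir k x y.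
  apply: (scalerI (lt0r_neq0 sp)); apply: oppr_inj.
  by rewrite -To (tvec_dir kx ky xy (short_nonantipodal hxy)) (distC k y x) scalerN opprK.
have rt : reach k (- t) (geod k y (dir k y x) (ds k y x))
    (outdir k y (dir k y x) (ds k y x)) z.
  rewrite geod_dir //; last exact: short_nonantipodal.
  by rewrite oE /reach sinkN coskN formNl !mulNr mulrN lerN2 -/c -/b ft.
exists t, (- t + ds k y x); split => //.
- by rewrite (distC k y x); ring.
- apply: (reach_halfturn ky kz kd' ht') rt => //; first exact: dist_ge0.
    by apply: cosd_gt0.
  by rewrite geod_dir //; [apply: cosd_gt0|exact: short_nonantipodal].
- by rewrite /reach -/c -/b ft.
- exact/(reach_shift _ _ ky kz kd').
Qed.

End Polygons.

Section Growth.
Variables (R : realType) (k : surface).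
Local Notation pt := 'rV[R]_3.
Implicit Types (x y z v w p r : pt) (q : nat -> pt) (s t e : R) (X Y : set pt).

Lemma point_neq0 x : points k x -> x <> 0.
Proof.
move=> kx x0; move: kx; rewrite x0; case: k => /=; rewrite ?form0l ?c00.
- by move/eqP; rewrite eq_sym oner_eq0.
- by move/eqP; rewrite eq_sym oner_eq0.
- by move=> [_]; rewrite ltxx.
Qed.

(** If no edge turned clockwise around [z], transitivity around the polygon would make every
    [det3 z (q i) (q j)] nonnegative, hence zero by antisymmetry; [cramer3] would then give
    [z = 0]. *)
Lemma visible_edge X n q z : newest k X z -> spoly X n q -> (2 < n)%N ->
  (forall i, (i < n)%N -> q i <> z) ->
  exists2 i, (i < n)%N & det3 z (q i) (q (i.+1 %% n)%N) < 0.
Proof.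
move=> XZ [n0 Xq sq] n2 qz; apply: contrapT => H.
have E i : (i < n)%N -> 0 <= det3 z (q i) (q (i.+1 %% n)%N).
  by move=> h; rewrite leNgt; apply/negP => ?; apply: H; exists i.
have T i j l : (i < n)%N -> (j < n)%N -> (l < n)%N -> 0 <= det3 z (q i) (q j) ->
    0 <= det3 z (q j) (q l) -> 0 <= det3 z (q i) (q l).
  by move=> h1 h2 h3; apply: (angular_trans_le XZ); [exact: Xq..|exact: qz].
have up i d : (i + d < n)%N -> 0 <= det3 z (q i) (q (i + d)%N).
  elim: d => [|d IH]; first by rewrite addn0 det3xyy.
  rewrite addnS => h; apply: (T i (i + d)%N) => //.
  - by rewrite (leq_ltn_trans _ h) // -addnS leq_addr.
  - exact: ltnW.
  - by apply: IH; exact: ltnW.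
  - by have := E _ (ltnW h); rewrite modn_small.
have to0 i : (i < n)%N -> 0 <= det3 z (q i) (q 0%N).
  move=> h; have h' : (n.-1 < n)%N by rewrite ltn_predL.
  apply: (T i n.-1) => //.
    have le : (i <= n.-1)%N by rewrite -ltnS prednK.
    by have := up i (n.-1 - i)%N; rewrite subnKC //; apply.
  by have := E _ h'; rewrite prednK // modnn.
have all i j : (i < n)%N -> (j < n)%N -> det3 z (q i) (q j) = 0.
  have P i' j' : (i' < n)%N -> (j' < n)%N -> 0 <= det3 z (q i') (q j').
    move=> h1 h2; apply: (T i' 0%N) => //; first exact: to0.
    by have := up 0%N j'; rewrite add0n; apply.
  move=> h1 h2; apply/eqP; rewrite eq_le P // andbT.
  by rewrite det3_swap oppr_le0 P.
have n1 := ltnW n2; have := cramer3 z (q 0%N) (q 1%N) (q 2%N).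
rewrite !all // !scale0r subr0 addr0 subr0 => /eqP; rewrite scaler_eq0 => /orP[/eqP h|/eqP h].
  by have := sq 0%N 1%N 2%N isT isT n2; rewrite h ltxx.
exact: (point_neq0 (newest_point XZ)).
Qed.

(** The foot of the perpendicular from [z] to an edge that faces [z] splits the length of this edge
    into two abscissas [s] and [t]. They are the initial bounds for the two new edges in
    [insert_chain], so that the removed edge is paid for exactly. *)
Lemma insert_newest X Y n q z : newest k X z -> X `<=` Y -> Y z -> spoly X n q ->
  exists n' q', [/\ spoly Y n' q', q' 0%N = z & plen k n q <= plen k n' q'].
Proof.
move=> XZ XY Yz sq; have [kz kX sz sX hd] := XZ.
have [[i iq iz]|qz] := pselect (exists2 i, (i < n)%N & q i = z).
  have [q' [sq' le] q'E] := rotate k i sq; exists n, q'; split.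
  - exact: spoly_sub sq'.
  - by have [n0 _ _] := sq; rewrite q'E // addn0 modn_small.
  - by rewrite le.
have {}qz i : (i < n)%N -> q i <> z by move=> h e; apply: qz; exists i.
have [n0 Xq _] := sq.
have [n2|] := ltnP 2 n; last first.
  rewrite leq_eqVlt => /predU1P[n2|n1].
    rewrite n2 in Xq *.
    have [X0 X1] : X (q 0%N) /\ X (q 1%N) by split; apply: Xq.
    (* For a two-gon, [newest_dist] tells which vertex can be replaced by [z] without loss. *)
    case: (hd _ _ X0 X1) => h.
    - have [q' sq' [q0 q1]] := spoly2 Yz (XY _ X0); exists 2%N, q'; split => //.
      by rewrite !plen2 q0 q1 ler_pM2l.
    - have [q' sq' [q0 q1]] := spoly2 Yz (XY _ X1); exists 2%N, q'; split => //.
      by rewrite !plen2 q0 q1 ler_pM2l.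
  have {}n1 : n = 1%N by apply/eqP; rewrite eqn_leq n0 -ltnS n1.
  rewrite n1 in sq *.
  have [q' sq' q0] := spoly1 Yz; exists 1%N, q'; split => //.
  rewrite (plen1 kX sq) /plen /chain_length big_geq //= q0 distxx //; lra.
have [i iq vis] := visible_edge XZ sq n2 qz.
(* The edge that faces [z] becomes the closing edge, which is not part of the chain given to
   [insert_chain]. *)
have [q' [sq' le] q'E] := rotate k i.+1 sq.
have [_ Xq' dq'] := sq'.
have q'z j : (j < n)%N -> q' j <> z.
  by move=> h; rewrite q'E //; apply: qz; rewrite ltn_mod.
case: n n0 n2 iq vis le sq' q'E Xq' dq' q'z {sq qz Xq} => // n _ n2 iq vis le sq' q'E Xq' dq' q'z.
have q0 : q' 0%N = q (i.+1 %% n.+1)%N by rewrite q'E // addn0.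
have qn : q' n = q i.
  by rewrite q'E // addSnnS -modnDmr modnn addn0 modn_small.
rewrite -qn -q0 in vis.
have X0 := Xq' 0%N isT; have Xn := Xq' n (ltnSn _).
have n1 : (1 < n)%N by [].
have nn : (n.-1 < n)%N by rewrite ltn_predL ltnW.
have xy : q' n <> q' 0%N.
  by move=> e; move: vis; rewrite e det3xyy ltxx.
have hn0 := sX _ _ Xn X0; have h0n := sX _ _ X0 Xn.
have hzn : short k (ds k (q' n) z) by rewrite distC; exact: sz.
have hz0 : short k (ds k (q' 0%N) z) by rewrite distC; exact: sz.
have [s [t [st hs ht rs rt]]] := reach_split (kX _ Xn) (kX _ X0) kz xy hn0 hzn hz0.
have kdn := dir_unit (kX _ Xn) (kX _ X0) xy (short_nonantipodal hn0).
have yx : q' 0%N <> q' n by move=> e; apply: xy.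
have kd0 := dir_unit (kX _ X0) (kX _ Xn) yx (short_nonantipodal h0n).
have Xn1 := Xq' n.-1 (leqW nn).
have X1 := Xq' 1%N (ltnW n2).
have d1 : 0 < 1 * det3 (q' n.-1) (q' n) (q' 0%N).
  rewrite mul1r -det3_cycle; apply: dq' => //.
  by rewrite -ltnS prednK // ltnW.
have d2 : 0 < -1 * det3 (q' 1%N) (q' 0%N) (q' n).
  by rewrite mulN1r -det3_swap12; apply: dq'.
have v1 : 1 * det3 z (q' n) (q' 0%N) <= 0 by rewrite mul1r ltW.
have v2 : -1 * det3 z (q' 0%N) (q' n) <= 0 by rewrite mulN1r -det3_swap ltW.
have [] := @insert_chain _ k X z XZ q' n 0 s t.
- move=> j /andP[_ jn]; split; [exact: Xq'|exact: q'z].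
- by move=> a b c _ ab bc cn; apply: dq'.
- by move=> _; rewrite add0n det3_swap oppr_gt0.
- exact: (reach_dist (kX _ Xn) kz kdn hs hzn rs).
- rewrite (distC k z); exact: (reach_dist (kX _ X0) kz kd0 ht hz0 rt).
- move=> _; apply: (droppable_step XZ (normr1 _) Xn1 Xn X0 d1 v1 hs rs).
- move=> _; apply: (droppable_step XZ (normrN1 _) X1 X0 Xn d2 v2 ht rt).
move=> m' [n' [_ mn vis' len]].
have [] := @cone_polygonP _ k Y z q' m' n' Yz.
- by move=> j /andP[_ h]; apply: XY; apply: Xq'; rewrite ltnS (leq_trans h).
- move=> a b c _ ab bc cn; apply: dq' => //; rewrite ltnS; exact: leq_trans cn mn.
- exact: vis'.
move=> sp pl; exists n'.+2, (cone_polygon z q' m'); split => //.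
rewrite -le pl; apply: le_trans len.
rewrite /plen /= add0n -st; lra.
Qed.

(** Cramer's rule for [w] in terms of [a] and [b] in the tangent plane, paired with [v]. *)
Lemma tangent_cramer x v w a b : points k x -> tangent k x v -> tangent k x w ->
  tangent k x a -> tangent k x b ->
  form k v w * det3 x a b = form k v a * det3 x w b + form k v b * det3 x a w.
Proof.
move=> kx xv xw xa xb.
have vx : form k v x * det3 a b w = 0.
  case: k kx xv xw xa xb => /= [_ xv _ _ _|_ _ w0 a0 b0|_ xv _ _ _].
  - by rewrite formC xv mul0r.
  - by rewrite /det3 w0 a0 b0; ring.
  - by rewrite formC xv mul0r.
have := congr1 (form k v) (cramer3 x a b w).
rewrite !formE (mulrC (det3 a b w)) vx (det3_swap x w b); lra.
Qed.

(** The vector [a] lies in the angle of [u] and [w], which is at most right. Its angles [t] and [f]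
    with them satisfy [cos f >= sin t], and [cos t + sin t >= 1]. *)
Lemma acute_sum_ge x u w a : points k x -> unit_tangent k x u -> unit_tangent k x w ->
  tangent k x a -> 0 <= form k u w -> 0 < det3 x u w -> 0 <= det3 x u a ->
  det3 x w a <= 0 ->
  0 <= form k u a + form k w a /\ form k a a <= (form k u a + form k w a) ^+ 2.
Proof.
move=> kx [xu uu] [xw ww] xa.
have := tangent_gram kx xu xw xa; have := tangent_gram kx xu xw xw.
have := tangent_gram kx xu xa xa.
have := tangent_cross kx xu xw xa; rewrite uu ww !mul1r => -> -> C ->; move: C.
move: (form k u w) (form k u a) (det3 x u w) (det3 x u a) => c X s Y C c0 s0 Y0 h.
have cX : c * Y <= s * X by lra.
have X0 : 0 <= X.
  by rewrite -(pmulr_rge0 _ s0); apply: le_trans cX; exact: mulr_ge0.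
have s1 : s <= 1 by have := sqr_ge0 c; nra.
have p1 : 0 <= c * X by exact: mulr_ge0.
have p2 : 0 <= s * Y by rewrite mulr_ge0 // ltW.
have p3 : 0 <= c * Y by exact: mulr_ge0.
have p4 : s * X <= X by rewrite -[leRHS]mul1r ler_wpM2r.
split; first by rewrite addr_ge0 // addr_ge0.
have -> : X * X + Y * Y = X * X + (c * X + s * Y) ^+ 2 + (s * X - c * Y) ^+ 2 - (c * c + s * s) *
  (X * X).
  have : (c * c + s * s) * (X * X + Y * Y) = (c * X + s * Y) ^+ 2 + (s * X - c * Y) ^+ 2 by ring.
  by rewrite -C !mul1r; lra.
rewrite -C mul1r.
have p5 : (s * X - c * Y) ^+ 2 <= X ^+ 2.
  by apply: lerXn2r; rewrite ?nnegrE //; lra.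
have p6 : 0 <= X * (c * X + s * Y) by rewrite mulr_ge0 // addr_ge0.
have p7 : X * X <= (X + X) * X + 0 by have := mulr_ge0 X0 X0; lra.
move: p5 p6; rewrite expr2.
have -> : (X + (c * X + s * Y)) ^+ 2 = X * X + 2 * (X * (c * X + s * Y)) + (c * X + s * Y) ^+ 2
  by ring.
move: (c * X + s * Y) (s * X - c * Y) => W V; lra.
Qed.

End Growth.

(** * Growth rate of a polygon at a vertex where the curve has a velocity *)

Section GrowthRate.
Variables (R : realType) (k : surface).
Local Notation pt := 'rV[R]_3.
Implicit Types (a b p r : pt) (q : nat -> pt).
Variables (X Y : set pt) (x z v : pt) (eps : R).
Local Notation h := (ds k x z).
Local Notation xi := (tvec k x z).

Hypotheses (Xx : newest k X x) (Xz : newest k X z) (x_in_X : X x).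
Hypotheses (XY : X `<=` Y) (Yz : Y z) (xz : x <> z).
Hypothesis expanding : forall a, X a -> ds k a x <= ds k a z.
Hypotheses (xv : tangent k x v) (eps_ge0 : 0 <= eps).
Hypothesis past : forall a, X a -> form k v (tvec k x a) <= 0.
Hypothesis forward : 0 < form k v xi.
(** To first order [xi] is a positive multiple of [v]; its projection on a direction that makes no
    obtuse angle with [v] can be negative only by the error, small against [h]. *)
Hypothesis almost_v : forall a, unit_tangent k x a -> 0 <= form k a v ->
  - (eps * h) <= form k a xi.
(** Here [b] stands for the projection of [xi] on a unit direction at [x]. The inequality is [reach]
    at abscissa [b - eps * h]: for small [h] the foot of the perpendicular from [z] is close to
    abscissa [b]. *)
Hypothesis first_order : forall b : R, `|b| <= sink k h -> halfturn k (b - eps * h) /\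
  sink k (b - eps * h) * cosk k h <= cosk k (b - eps * h) * b.
Hypothesis sink_h : (1 - eps) * h <= sink k h.

Let kx : points k x := newest_point Xx.
Let kz : points k z := newest_point Xz.
Let kX a (Xa : X a) : points k a := newest_points Xx Xa.
Let xxi : tangent k x xi := tvec_tangent kx kz.

Let h_ge0 : 0 <= h. Proof. exact: dist_ge0. Qed.

Let short_h : short k h. Proof. by rewrite distC; apply: newest_short Xz _ _. Qed.

Let notz a : X a -> a <> z.
Proof.
move=> Xa az; have := expanding Xa; rewrite az (distxx kz) => h0.
by apply: xz; apply: (dist0_eq kx kz); apply/eqP; rewrite distC eq_le h0 dist_ge0.
Qed.

(* [b - eps * h] is how much further from [a] than [x] the vertex [z] is. *)
Let gain a : X a -> a <> x -> exists u, exists b : R,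
  [/\ unit_tangent k x u, tvec k x a = - (sink k (ds k a x) *: u),
      b = form k u xi, 0 <= form k u v /\ - (eps * h) <= b &
      halfturn k (ds k a x + (b - eps * h)) /\
      reach k (ds k a x + (b - eps * h)) a (dir k a x) z].
Proof.
move=> Xa ax; have ka := kX Xa.
have sax : short k (ds k a x) by rewrite distC; exact: newest_short Xx _ _.
have kd := dir_unit ka kx ax (short_nonantipodal sax).
have [ku Tu] := outdir_dir ka kx ax (short_nonantipodal sax).
set u := outdir _ _ _ _ in ku Tu.
have s0 := sink_dist_gt0 ka kx ax (short_nonantipodal sax).
have uv : 0 <= form k u v.
  by have := past Xa; rewrite Tu formNr formZr oppr_le0 formC pmulr_rge0.
exists u, (form k u xi); split => //; first by split => //; exact: almost_v.
have bs := form_le_sink kx kz ku.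
have [ht rt] := first_order bs.
have saz : short k (ds k a z) by rewrite distC; exact: newest_short Xz _ _.
have G := geod_dir ka kx ax (short_nonantipodal sax).
have rt' : reach k (form k u xi - eps * h) (geod k a (dir k a x) (ds k a x))
    (outdir k a (dir k a x) (ds k a x)) z.
  by rewrite G /reach -(cosk_dist kx kz).
rewrite addrC; split; last exact/(reach_shift _ _ ka kz kd).
apply: (reach_halfturn ka kz kd ht _ sax _ _ rt').
- exact: dist_ge0.
- exact: cosd_gt0.
- by rewrite G; apply: cosd_gt0.
Qed.

Let conclude q m n (s : R) : (forall i, (m <= i <= m + n)%N -> X (q i)) ->
  strict_chain q m (m + n) ->
  (exists m' n', [/\ (m <= m')%N, (m' + n' <= m + n)%N,
    forall i j, (m' <= i)%N -> (i < j)%N -> (j <= m' + n')%N -> 0 < det3 z (q i) (q j) &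
    s <= ds k z (q m') + chain_length k q m' (m' + n') + ds k (q (m' + n')%N) z]) ->
  exists n' q', spoly Y n' q' /\ s <= plen k n' q'.
Proof.
move=> Xq sq [m' [n' [mm nn vis len]]].
have [] := @cone_polygonP _ k Y z q m' n' Yz.
- move=> i /andP[h1 h2]; apply: XY; apply: Xq.
  by rewrite (leq_trans mm h1) (leq_trans h2 nn).
- move=> a b c h1 h2 h3 h4; apply: sq => //; first exact: leq_trans mm h1.
  exact: leq_trans h4 nn.
- exact: vis.
by move=> sp pl; exists n'.+2, (cone_polygon z q m'); rewrite pl.
Qed.

(** Let [b1] and [bm] be the projections of [xi] on the prolongations of the two edges at [x]. If
    both edges are dropped, the gain is at least [b1 + bm - 2 * eps * h], where
    [b1 + bm >= sink k h >= (1 - eps) * h]. If only one is dropped, the edge between [x] and [z]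
    brings [h], and the replaced edge costs at most [2 * eps * h]. *)
Lemma polygon_growth n q : spoly X n q -> q 0%N = x ->
  exists n' q', spoly Y n' q' /\ plen k n q + (1 - 3 * eps) * h <= plen k n' q'.
Proof.
move=> sq q0; have [n0 Xq dq] := sq.
case: n n0 sq Xq dq => // m _ sq Xq dq.
have h0 := h_ge0; have eh : 0 <= eps * h by exact: mulr_ge0.
(* A polygon of length zero is replaced by the two-gon of [x] and [z], of length [2 * h]. *)
have [e|nz] := pselect (plen k m.+1 q = 0).
  have [q' sq' [e0 e1]] := spoly2 (XY x_in_X) Yz; exists 2%N, q'; split => //.
  by rewrite e plen2 e0 e1; lra.
have m0 : (0 < m)%N.
  rewrite lt0n; apply/eqP => m0; apply: nz; rewrite m0 in sq *.
  exact: plen1 (newest_points Xx) sq.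
have Xm := Xq m (ltnSn m); have X1 := Xq 1%N m0.
have qx i : (0 < i)%N -> (i <= m)%N -> q i <> x.
  move=> i0 im e; have [m1|m1] := ltnP 1 m.
    have [i1|i1] := ltnP 1 i.
      by have := dq 0%N 1%N i isT i1 im; rewrite q0 e det3xyx ltxx.
    have {}i1 : i = 1%N by apply/eqP; rewrite eqn_leq i1.
    by have := dq 0%N 1%N 2%N isT isT m1; rewrite q0 -e i1 det3xx ltxx.
  have {}m1 : m = 1%N by apply/eqP; rewrite eqn_leq m1.
  have i1 : i = 1%N by apply/eqP; rewrite eqn_leq i0 -{1}m1 im.
  by apply: nz; rewrite m1 plen2 q0 -{1}e i1 distxx ?mulr0 //; exact: kX X1.
have [um [bm [kum Tm bmE [umv bm_ge] [hm rm]]]] := gain Xm (qx _ m0 (leqnn _)).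
have [u1 [b1 [ku1 T1 b1E [u1v b1_ge] [h1 r1]]]] := gain X1 (qx 1%N isT m0).
have sm0 : 0 < sink k (ds k (q m) x).
  apply: sink_dist_gt0 => //; [exact: kX|exact: qx|].
  by apply: short_nonantipodal; rewrite distC; exact: newest_short Xx _ Xm.
have s10 : 0 < sink k (ds k (q 1%N) x).
  apply: sink_dist_gt0 => //; [exact: kX|exact: qx|].
  by apply: short_nonantipodal; rewrite distC; exact: newest_short Xx _ X1.
have kdm : unit_tangent k (q m) (dir k (q m) x).
  apply: dir_unit => //; [exact: kX|exact: qx|].
  by apply: short_nonantipodal; rewrite distC; exact: newest_short Xx _ Xm.
have kd1 : unit_tangent k (q 1%N) (dir k (q 1%N) x).
  apply: dir_unit => //; [exact: kX|exact: qx|].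
  by apply: short_nonantipodal; rewrite distC; exact: newest_short Xx _ X1.
have szm : short k (ds k (q m) z) by rewrite distC; exact: newest_short Xz _ Xm.
have sz1 : short k (ds k (q 1%N) z) by rewrite distC; exact: newest_short Xz _ X1.
have dm := reach_dist (kX Xm) kz kdm hm szm rm.
have d1 := reach_dist (kX X1) kz kd1 h1 sz1 r1.
have E : plen k m.+1 q = chain_length k q 0 m + ds k (q m) x by rewrite /plen /= q0.
have E1 : chain_length k q 0 m = ds k x (q 1%N) + chain_length k q 1 m.
  by rewrite /chain_length (big_ltn m0) q0.
(* The signs of [a] and [b] tell whether [z] sees the edges at [x]. *)
set a := det3 (q m) x z; set b := det3 x (q 1%N) z.
have aE : a = det3 x xi (tvec k x (q m)) by rewrite det_tvec /a det3_cycle.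
have bE : b = det3 x (tvec k x (q 1%N)) xi by rewrite det_tvec.
have zqm : det3 z (q m) x = a by rewrite /a det3_cycle.
have zxq : det3 z x (q 1%N) = b by rewrite /b det3_cycle.
have dq0 i j : (0 < i)%N -> (i < j)%N -> (j <= m)%N -> 0 < det3 (q i) (q j) x.
  by move=> i0 ij jm; rewrite -q0 -det3_cycle; apply: dq.
have dropm : a <= 0 -> (1 < m)%N -> droppable k z 1 (q m.-1) (q m) (ds k (q m) x + (bm - eps * h)).
  move=> a0 m1; have mm : (m.-1 < m)%N by rewrite ltn_predL.
  have Xm1 := Xq _ (leqW mm).
  apply: (droppable_step Xz (normr1 _) Xm1 Xm x_in_X _ _ hm rm); rewrite mul1r ?zqm //.
  by apply: dq0 => //; rewrite -ltnS prednK.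
have drop1 : b <= 0 -> (1 < m)%N -> droppable k z (-1) (q 2%N) (q 1%N) (ds k (q 1%N) x + (b1 -
  eps * h)).
  move=> b0 m1; have X2 := Xq 2%N m1.
  apply: (droppable_step Xz (normrN1 _) X2 X1 x_in_X _ _ h1 r1); rewrite mulN1r.
    by rewrite -det3_swap12; apply: dq0.
  by rewrite det3_swap zxq opprK.
have sc1 : strict_chain q 1 (1 + m.-1).
  by move=> i j l i0 ij jl; rewrite add1n prednK // => lm; apply: dq.
have Xq1 i : (1 <= i <= 1 + m.-1)%N -> X (q i) /\ q i <> z.
  rewrite add1n prednK // => /andP[_ im]; have Xi : X (q i) by apply: Xq.
  by split; [|exact: notz].
have am1 : m = 1%N -> a = - b by move=> m1; rewrite /a /b m1 det3_swap12.
have xT p : X p -> tangent k x (tvec k x p) by move=> /kX kp; exact: tvec_tangent.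
(* For [m > 1] the vector [xi] would lie in the angle of the polygon at [x], where [form k v] is
   nonpositive by [past]; this contradicts [forward]. *)
have noc : 0 <= a -> 0 <= b -> m = 1%N.
  move=> a0 b0; apply/eqP; rewrite eqn_leq m0 andbT leqNgt; apply/negP => m1.
  have D : 0 < det3 x (tvec k x (q 1%N)) (tvec k x (q m)).
    by rewrite det_tvec -q0; apply: dq.
  have := tangent_cramer kx xv xxi (xT _ X1) (xT _ Xm).
  rewrite -aE -bE; have := mulr_gt0 forward D.
  have : form k v (tvec k x (q 1%N)) * a <= 0 by rewrite mulr_le0_ge0 // past.
  have : form k v (tvec k x (q m)) * b <= 0 by rewrite mulr_le0_ge0 // past.
  lra.
have u1b : b = - (sink k (ds k (q 1%N) x) * det3 x u1 xi).
  by rewrite bE T1 -scaleNr -[xi]scale1r det3Z scale1r; ring.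
have uma : a = sink k (ds k (q m) x) * det3 x um xi.
  by rewrite aE Tm det3Nr -[xi]scale1r det3Z det3_swap scale1r; ring.
have [a0|a0] := leP a 0; have [b0|b0] := leP b 0.
- have sum : sink k h <= b1 + bm.
    have sh : 0 <= sink k h by apply: sink_ge0 => //; exact: dist_range.
    have d10 : 0 <= det3 x u1 xi by rewrite -(pmulr_rge0 _ s10) -oppr_le0 -u1b.
    have dm0 : det3 x um xi <= 0 by rewrite -(pmulr_rle0 _ sm0) -uma.
    have [m1|m1] := ltnP 1 m.
      have D : det3 x (tvec k x (q 1%N)) (tvec k x (q m)) =
          (sink k (ds k (q 1%N) x) * sink k (ds k (q m) x)) * det3 x u1 um.
        by rewrite T1 Tm -!scaleNr det3Z; ring.
      have D0 : 0 < det3 x u1 um.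
        rewrite -(pmulr_rgt0 _ (mulr_gt0 s10 sm0)) -D det_tvec -q0.
        exact: dq.
      have F0 : 0 <= form k u1 um.
        have := newest_acute Xx X1 Xm; rewrite T1 Tm formNl formNr opprK formZl formZr.
        by rewrite mulrA pmulr_rge0 // mulr_gt0.
      have [S0 S1] := acute_sum_ge kx ku1 kum xxi F0 D0 d10 dm0.
      rewrite b1E bmE -(ger0_norm sh) -(ger0_norm S0) -!sqrtr_sqr ler_sqrt ?sqr_ge0 //.
      by rewrite sink2_dist.
    (* For a two-gon both edges at [x] coincide, and [xi] points along their prolongation. *)
    have {}m1 : m = 1%N by apply/eqP; rewrite eqn_leq m1.
    have e : um = u1.
      apply: (scalerI (lt0r_neq0 s10)); apply: oppr_inj.
      have qm1 : q m = q 1%N by rewrite m1.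
      by rewrite -T1 -qm1 -Tm.
    have dd : det3 x u1 xi = 0 by apply/eqP; rewrite eq_le d10 -e dm0.
    have := tangent_gram kx ku1.1 xv xxi; have := tangent_gram kx ku1.1 xxi xxi.
    rewrite dd !mulr0 !addr0 ku1.2 !mul1r -sink2_dist // -b1E => g1 g2.
    have b10 : 0 < b1.
      by move: forward; rewrite g2 pmulr_rgt0 // lt_neqAle u1v andbT eq_sym;
        apply/eqP => z0; move: forward; rewrite g2 z0 mul0r ltxx.
    rewrite bmE e -b1E.
    have -> : sink k h = b1 by apply/eqP; rewrite -(eqrXn2 (n := 2)) ?expr2 // -?expr2 ?g1 // ltW.
    lra.
  apply: (@conclude q 1 m.-1) => //; first by move=> i /Xq1[].
  have m1E : (1 + m.-1)%N = m by rewrite add1n prednK.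
  have m1P : (0 < m.-1)%N = (1 < m)%N by rewrite -ltnS prednK.
  have [] := @insert_chain _ k X z Xz q m.-1 1 (ds k (q m) x + (bm - eps * h))
      (ds k (q 1%N) x + (b1 - eps * h)) Xq1 sc1.
  + rewrite m1E m1P => m1.
    apply: (angular_trans Xz X1 x_in_X Xm); try exact: notz.
    * by rewrite det3_swap zxq oppr_ge0.
    * by rewrite det3_swap zqm oppr_ge0.
    * rewrite det3_swap zxq (det3_swap z (q m) x) zqm !oppr_gt0.
      have [|b1'] := ltP b 0; first by left.
      right; rewrite lt_neqAle a0 andbT; apply/eqP => a1.
      by have := noc; rewrite a1 => /(_ (lexx _) b1') m1'; rewrite m1' in m1.
  + by rewrite m1E.
  + by rewrite (distC k z).
  + by rewrite m1P m1E; exact: dropm.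
  + by rewrite m1P; exact: drop1.
  move=> m' [n' [mm nn vis len]]; exists m', n'; split => //; apply: le_trans len.
  rewrite m1E E E1 (distC k x (q 1%N)); have := sink_h; lra.
(* Only the edge from [q m] to [x] is dropped: the chain starts at [x], and [z] is inserted before
   it. *)
- apply: (@conclude q 0 m); rewrite ?add0n.
  + by move=> i /andP[_ im]; apply: Xq.
  + by move=> i j l _ ij jl lm; apply: dq.
  have [] := @insert_chain _ k X z Xz q m 0 (ds k (q m) x + (bm - eps * h)) h.
  + by move=> i /andP[_ im]; split; [|apply: notz]; apply: Xq.
  + by move=> i j l _ ij jl lm; apply: dq.
  + move=> _; rewrite add0n q0 det3_swap oppr_gt0 zqm lt_neqAle a0 andbT.
    apply/eqP => a1; have := noc; rewrite a1 => /(_ (lexx _) (ltW b0)) /am1.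
    by rewrite a1 => /eqP; rewrite eq_sym oppr_eq0 gt_eqF.
  + by rewrite add0n.
  + by rewrite q0 distC.
  + move=> _; rewrite add0n; have [m1|] := ltnP 1 m; first exact: dropm.
    rewrite leq_eqVlt ltnNge m0 orbF => /eqP ->.
    by rewrite /droppable /= q0 zxq mul1r leNgt b0.
  + move=> _; rewrite /droppable q0 det3_swap zxq mulrN mulN1r opprK leNgt b0.
    by [].
  move=> m' [n' [mm nn vis len]]; exists m', n'; split => //; apply: le_trans len.
  rewrite add0n E; lra.
- have {}b0 : b < 0.
    rewrite lt_neqAle b0 andbT; apply/eqP => b1'; have := noc (ltW a0).
    by rewrite b1' => /(_ (lexx _)) /am1 ab; move: a0; rewrite ab b1' oppr0 ltxx.
  (* Only the edge from [x] to [q 1] is dropped: the chain has to end at [x], which is therefore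
     renumbered [m.+1]. *)
  pose qq i := if i == m.+1 then x else q i.
  have qqE i : (i <= m)%N -> qq i = q i.
    by move=> im; rewrite /qq ltn_eqF.
  have qqm : qq m.+1 = x by rewrite /qq eqxx.
  have sqq : strict_chain qq 1 (1 + m).
    move=> i j l i0 ij jl; rewrite add1n leq_eqVlt => /predU1P[lm|lm].
      have jm : (j <= m)%N by rewrite -ltnS -lm.
      by rewrite lm qqm !qqE ?(leq_trans (ltnW ij)) //; apply: dq0.
    have jm := ltn_trans jl lm; have im := ltn_trans ij jm.
    by rewrite !qqE //; apply: dq.
  have Xqq i : (1 <= i <= 1 + m)%N -> X (qq i).
    rewrite /qq; case: eqP => // im /andP[_ h']; apply: Xq.
    by rewrite ltn_neqAle -add1n h' andbT; apply/eqP.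
  apply: (@conclude qq 1 m) => //.
  have [] := @insert_chain _ k X z Xz qq m 1 h (ds k (q 1%N) x + (b1 - eps * h)).
  + by move=> i /Xqq ?; split => //; exact: notz.
  + exact: sqq.
  + by move=> _; rewrite add1n qqm (qqE _ m0) det3_swap zxq oppr_gt0.
  + by rewrite add1n qqm.
  + by rewrite (qqE _ m0) (distC k z).
  + move=> _; rewrite add1n /= qqm qqE // /droppable zqm mul1r leNgt a0.
    by [].
  + move=> _; rewrite (qqE _ m0); have [m1|m1] := ltnP 1 m.
      by rewrite qqE //; exact: (drop1 (ltW b0)).
    have {}m1 : m = 1%N by apply/eqP; rewrite eqn_leq m1.
    have -> : qq 2%N = x by rewrite /qq m1.
    rewrite /droppable zxq mulN1r oppr_le0 leNgt b0.
    by [].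
  move=> m' [n' [mm nn vis len]]; exists m', n'; split => //; apply: le_trans len.
  have -> : chain_length k qq 1 (1 + m) = chain_length k q 1 m + ds k (q m) x.
    rewrite /chain_length add1n big_nat_recr //= qqm (qqE m) //; congr (_ + _).
    by apply: eq_big_nat => i /andP[_ im]; rewrite !qqE // ltnW.
  rewrite E E1 (distC k x (q 1%N)); lra.
- by have /am1 ab := noc (ltW a0) (ltW b0); move: a0; rewrite ab oppr_gt0 ltNge (ltW b0).
Qed.

End GrowthRate.

(** * Absolutely continuous curves *)

Section Families.
Variable R : realType.
Implicit Types (a b c d s t : R) (p q : R * R) (l m : seq (R * R)) (U : set R).

Definition itv_in a b p : bool := [&& a <= p.1, p.1 <= p.2 & p.2 <= b].
Definition nonoverlapping p q : bool := (p.2 <= q.1) || (q.2 <= p.1).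
(** The order of the list is free, and degenerate intervals are allowed; this makes clipping at a
    point a plain [map]. *)
Definition family a b l : bool := all (itv_in a b) l && pairwise nonoverlapping l.
Definition inside U l : Prop := forall p, p \in l -> forall x, p.1 <= x <= p.2 -> U x.
Definition total l : R := \sum_(p <- l) (p.2 - p.1).

Lemma family_cons a b p l : family a b (p :: l) =
  [&& itv_in a b p, all (nonoverlapping p) l & family a b l].
Proof. by rewrite /family /=; case: itv_in => //=; case: (all (nonoverlapping p) l);
  rewrite ?andbF. Qed.

Lemma family_sub a b c d l : c <= a -> b <= d -> family a b l -> family c d l.
Proof.
move=> ca bd /andP[al pl]; rewrite /family pl andbT; apply: sub_all al => p.
by move=> /and3P[h1 h2 h3]; rewrite /itv_in (le_trans ca h1) h2 (le_trans h3 bd).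
Qed.

Lemma total_le_measure a b l U : measurable U -> family a b l ->
  (forall p, p \in l -> `]p.1, p.2[ `<=` U)%classic ->
  ((total l)%:E <= lebesgue_measure U)%E.
Proof.
elim: l U => [|p l IH] U mU; first by rewrite /total big_nil.
rewrite family_cons => /and3P[/and3P[_ p12 _] pl fl] Ul.
have pU : (`]p.1, p.2[ `<=` U)%classic by apply: Ul; rewrite mem_head.
have m1 : ((p.2 - p.1)%:E <= lebesgue_measure (`]p.1, p.2[%classic : set R))%E.
  rewrite lebesgue_measure_itv /= lte_fin; case: ltP => // h.
  by rewrite lee_fin; lra.
have m2 : ((total l)%:E <= lebesgue_measure (U `\` `]p.1, p.2[%classic))%E.
  apply: IH => //; first exact: measurableD.
  move=> q ql x xq; split; first by apply: (Ul q) => //; rewrite inE ql orbT.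
  move: xq => /=; rewrite !in_itv /= => /andP[x1 x2] /andP[x3 x4].
  by have /allP /(_ _ ql) /orP[h|h] := pl; lra.
rewrite /total big_cons EFinD -(setDUK pU) measureU //.
- exact: leeD.
- exact: measurableD.
- by rewrite setDIK.
Qed.

Lemma total_le a b l : a <= b -> family a b l -> total l <= b - a.
Proof.
move=> ab fl; have := @total_le_measure a b l (`]a, b]%classic) _ fl.
rewrite lebesgue_measure_itv /= lte_fin; case: ltP => h H.
  rewrite -lee_fin EFinB; apply: H => // p pl x /=; rewrite !in_itv /= => /andP[x1 x2].
  have /andP[/allP /(_ _ pl) /and3P[h1 h2 h3] _] := fl; lra.
have e : b = a by lra.
rewrite e subrr -lee_fin; apply: H => // p pl x /=; rewrite !in_itv /= => /andP[x1 x2].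
have /andP[/allP /(_ _ pl) /and3P[h1 h2 h3] _] := fl; lra.
Qed.

Definition clip_left s p : R * R := (Num.min p.1 s, Num.min p.2 s).
Definition clip_right s p : R * R := (Num.max p.1 s, Num.max p.2 s).

Lemma min_le2 s : {homo (fun x => Num.min x s) : x y / x <= y}.
Proof. by move=> x y xy; rewrite le_min !ge_min xy lexx orbT. Qed.

Lemma max_le2 s : {homo (fun x => Num.max x s) : x y / x <= y}.
Proof. by move=> x y xy; rewrite ge_max !le_max xy lexx orbT. Qed.

Lemma family_map (f : R -> R) a b c d l : {homo f : x y / x <= y} ->
  (forall x, a <= x <= b -> c <= f x <= d) ->
  family a b l -> family c d [seq (f p.1, f p.2) | p <- l].
Proof.
move=> fm fr /andP[al pl]; apply/andP; split.
  apply/allP => _ /mapP[p pl' ->]; have /and3P[h1 h2 h3] := allP al _ pl'.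
  rewrite /itv_in /= (fm _ _ h2); have /andP[-> _] := fr p.1 (introT andP (conj h1 (le_trans h2
    h3))).
  by have /andP[_ ->] := fr p.2 (introT andP (conj (le_trans h1 h2) h3)).
rewrite pairwise_map; apply: sub_pairwise pl => p q /orP[h|h]; apply/orP; [left|right]; exact: fm.
Qed.

Lemma family_clip_left a b s l : a <= s <= b -> family a b l ->
  family a s (map (clip_left s) l).
Proof.
move=> /andP[h1 h2].
apply: (@family_map (fun x => Num.min x s) a b a s l); first exact: min_le2.
by move=> x /andP[x1 x2]; rewrite le_min x1 h1 ge_min lexx orbT.
Qed.

Lemma family_clip_right a b s l : a <= s <= b -> family a b l ->
  family s b (map (clip_right s) l).
Proof.
move=> /andP[h1 h2].
apply: (@family_map (fun x => Num.max x s) a b s b l); first exact: max_le2.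
by move=> x /andP[x1 x2]; rewrite ge_max x2 h2 le_max lexx orbT.
Qed.

End Families.

(** * Variation of an abstract absolutely continuous distance function *)

Section Variation.
Variables (R : realType) (a b : R) (D : R -> R -> R).
Implicit Types (c d s t e : R) (p q : R * R) (l m : seq (R * R)) (U : set R).
Hypothesis ab : a <= b.
Hypothesis D_refl : forall s, a <= s -> s <= b -> D s s = 0.
Hypothesis D_triangle : forall s u t, a <= s -> s <= u -> u <= t -> t <= b ->
  D s t <= D s u + D u t.

Definition var l : R := \sum_(p <- l) D p.1 p.2.

Hypothesis D_ac : forall e, 0 < e -> exists2 d, 0 < d &
  forall l, family a b l -> total l < d -> var l < e.

Lemma var_cat l m : var (l ++ m) = var l + var m.
Proof. by rewrite /var big_cat. Qed.

Lemma var_clip s l : a <= s <= b -> family a b l ->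
  var l <= var (map (clip_left s) l) + var (map (clip_right s) l).
Proof.
move=> /andP[s1 s2] /andP[al _]; rewrite /var !big_map -big_split /=.
rewrite big_seq [leRHS]big_seq; apply: ler_sum => p pl.
have /and3P[h1 h2 h3] := allP al _ pl.
rewrite /clip_left /clip_right /=.
have [c1|c1] := leP p.2 s.
  by rewrite min_l ?(le_trans h2) // max_r ?(le_trans h2) // D_refl // addr0.
have [c2|c2] := leP s p.1; first by rewrite D_refl // add0r.
by apply: D_triangle => //; exact: ltW.
Qed.

(** Absolute continuity with tolerance 1 bounds the variation by 1 on intervals shorter than [d];
    finitely many steps of length [d / 2] exhaust the whole interval. *)
Lemma var_bounded : exists B, forall l, family a b l -> var l <= B.
Proof.
have [d d0 dP] := D_ac ltr01.
have step n : exists B, forall s, a <= s <= b -> s <= a + n%:R * (d / 2) ->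
    forall l, family a s l -> var l <= B.
  elim: n => [|n [B HB]].
    exists 1 => s /andP[s1 s2]; rewrite mul0r addr0 => s3 l fl.
    apply/ltW/dP; first exact: family_sub fl.
    by apply: le_lt_trans (total_le s1 fl) _; lra.
  exists (B + 1) => s /andP[s1 s2] s3 l fl.
  have [h|h] := leP s (a + n%:R * (d / 2)).
    by have := HB s; rewrite s1 s2 => /(_ isT h l fl); lra.
  pose u := a + n%:R * (d / 2).
  have u1 : a <= u by rewrite lerDl mulr_ge0 // divr_ge0 // ltW.
  have us : u <= s by exact: ltW.
  have ub : a <= u <= b by rewrite u1 (le_trans us).
  apply: le_trans (var_clip ub (family_sub (lexx _) s2 fl)) _.
  have usb : a <= u <= s by rewrite u1.
  apply: lerD; first by apply: (HB u) => //; exact: family_clip_left fl.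
  have fr := family_clip_right usb fl.
  apply/ltW/dP; first exact: family_sub fr.
  apply: le_lt_trans (total_le us fr) _.
  by move: s3; rewrite -natr1 mulrDl mul1r /u; lra.
have [n nP] : exists n : nat, b <= a + n%:R * (d / 2).
  exists (Num.bound ((b - a) / (d / 2))).
  have : (b - a) / (d / 2) < (Num.bound ((b - a) / (d / 2)))%:R.
    by apply: archi_boundP; rewrite divr_ge0 ?subr_ge0 // divr_ge0 // ltW.
  by rewrite ltr_pdivrMr ?divr_gt0 // => h; lra.
have [B HB] := step n; exists B; apply: HB => //.
by rewrite ab lexx.
Qed.

(** For [U] the whole line this is the total variation up to [s]; for a small open set [U] it is the
    part carried by intervals inside [U]. *)
Definition restricted_var U s : R :=
  sup [set v | exists2 l, family a s l /\ inside U l & v = var l].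

Lemma restricted_has_sup U s : s <= b ->
  has_sup [set v | exists2 l, family a s l /\ inside U l & v = var l].
Proof.
move=> sb; split; first by exists (var [::]), [::] => //; split => // p; rewrite in_nil.
have [B HB] := var_bounded; exists B => _ [l [fl _] ->]; apply: HB.
exact: family_sub fl.
Qed.

Lemma restricted_ub U s l : s <= b -> family a s l -> inside U l ->
  var l <= restricted_var U s.
Proof.
move=> sb fl il; apply: sup_upper_bound; first exact: restricted_has_sup.
by exists l.
Qed.

Lemma restricted_le U s B : s <= b -> (forall l, family a s l -> inside U l -> var l <= B) ->
  restricted_var U s <= B.
Proof.
move=> sb H; apply: ge_sup; first exact: (restricted_has_sup U sb).1.
by move=> _ [l [fl il] ->]; exact: H.
Qed.

Lemma restricted_ge0 U s : s <= b -> 0 <= restricted_var U s.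
Proof.
move=> sb; have := @restricted_ub U s [::] sb isT; rewrite /var big_nil; apply.
by move=> p; rewrite in_nil.
Qed.

Lemma restricted_mono U s t : s <= t -> t <= b -> restricted_var U s <= restricted_var U t.
Proof.
move=> st tb; apply: restricted_le; first exact: le_trans tb.
by move=> l fl il; apply: restricted_ub => //; exact: family_sub fl.
Qed.

Lemma restricted_step U s t : a <= s -> s <= t -> t <= b ->
  (forall x, s <= x <= t -> U x) -> restricted_var U s + D s t <= restricted_var U t.
Proof.
move=> sa st tb Ust; rewrite -lerBrDr; apply: restricted_le; first exact: le_trans tb.
move=> l fl il; rewrite lerBrDr.
have -> : var l + D s t = var ((s, t) :: l) by rewrite /var big_cons addrC.
apply: restricted_ub => //.
  rewrite family_cons /itv_in /= sa st lexx /= (family_sub (lexx _) st fl) andbT.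
  apply/allP => p pl; have /andP[/allP /(_ _ pl) /and3P[_ _ h] _] := fl.
  by rewrite /nonoverlapping /= h orbT.
by move=> p; rewrite inE => /predU1P[->|pl] //; exact: il.
Qed.

(* [f] is the [D]-variation carried by an open neighbourhood of [N] of small measure. *)
Lemma null_negligible (N : set R) e : lebesgue_measure.-negligible N -> 0 < e ->
  exists f : R -> R, [/\ forall s, s <= b -> 0 <= f s <= e,
    forall s t, s <= t -> t <= b -> f s <= f t &
    forall s, N s -> a <= s < b -> exists2 d, 0 < d &
      forall t, s < t < s + d -> t <= b -> D s t <= f t - f s].
Proof.
move=> [M [mM M0 NM]] e0; have [d d0 dP] := D_ac e0.
have {}M0 : lebesgue_measure M = 0%E by exact: M0.
have Moo : (lebesgue_measure M < +oo)%E by rewrite M0 ltry.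
have [U [oU MU Ud]] := lebesgue_regularity_outer mM Moo d0.
have mU : measurable U by exact: measurable_realfun.open_measurable.
have {}Ud : (lebesgue_measure U < d%:E)%E.
  have h := @measureU2 _ _ _ (@lebesgue_measure R) M (U `\` M) mM (measurableD mU mM).
  rewrite setDUK // in h; apply: le_lt_trans h _.
  have -> : (lebesgue_measure M + lebesgue_measure (U `\` M) =
    lebesgue_measure (U `\` M))%E by rewrite M0 add0e.
  exact: Ud.
exists (restricted_var U); split.
- move=> s sb; rewrite restricted_ge0 //=; apply: restricted_le => // l fl il.
  apply/ltW/dP; first exact: family_sub fl.
  rewrite -lte_fin; apply: le_lt_trans Ud; apply: total_le_measure mU fl _.
  move=> p pl x /=; rewrite in_itv /= => /andP[x1 x2]; apply: (il p pl).
  by rewrite (ltW x1) ltW.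
- by move=> s t; exact: restricted_mono.
move=> s Ns /andP[sa sb].
have /nbhs_ballP[r /= r0 rU] : nbhs s U by apply: open_nbhs_nbhs; split => //; exact/MU/NM.
exists r => // t /andP[st tr] tb; rewrite lerBrDl.
apply: restricted_step => //; first exact: ltW.
move=> x /andP[x1 x2]; apply: rU; rewrite /ball /= ltr_norml; lra.
Qed.

Definition variation s : R := restricted_var setT s.

Lemma variation_ge s t : a <= s -> s <= t -> t <= b -> D s t <= variation t - variation s.
Proof. by move=> sa st tb; rewrite lerBrDl; exact: restricted_step. Qed.

(** Each interval of the family is replaced by a family inside it that nearly attains its variation.
    All of these together form a family of no larger total length, to which the absolute continuity
    of [D] applies. *)
Lemma variation_ac e : 0 < e -> exists2 d, 0 < d & forall l, family a b l -> total l < d ->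
  \sum_(p <- l) (variation p.2 - variation p.1) <= e.
Proof.
move=> e0; have e20 : 0 < e / 2 by rewrite divr_gt0.
have [d d0 dP] := D_ac e20; exists d => // l fl ld.
have refine x : 0 < x -> exists m, [/\ family a b m,
    forall q, q \in m -> exists2 p, p \in l & p.1 <= q.1 /\ q.2 <= p.2,
    total m <= total l & \sum_(p <- l) (variation p.2 - variation p.1) <= var m + x *+ size l].
  move=> x0; elim: l fl {ld} => [|p l IH].
    by move=> _; exists [::]; split => //; rewrite /total /var !big_nil // addr0.
  rewrite family_cons => /and3P[/and3P[p1 p12 p2] pl fl].
  have [m [fm ml tm vm]] := IH fl.
  have [_ [u [fu _] ->] hu] := sup_adherent x0 (restricted_has_sup setT p2).
  have pb : a <= p.1 <= b by rewrite p1 (le_trans p12).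
  have pa : a <= p.1 <= p.2 by rewrite p1.
  have fr := family_clip_right pa fu.
  exists (map (clip_right p.1) u ++ m); split.
  - have fr' := family_sub p1 p2 fr.
    move/andP: fr' => [h1 h2]; move/andP: fm => [h3 h4].
    rewrite /family all_cat h1 h3 /= pairwise_cat h2 h4 !andbT.
    apply/allrelP => q q' qr q'm; have [p' p'l [c1 c2]] := ml _ q'm.
    move/andP: fr => [/allP /(_ _ qr) /and3P[d1 d2 d3] _].
    have /orP[h|h] := allP pl _ p'l; apply/orP; [left|right].
      exact: le_trans (le_trans d3 h) c1.
    exact: le_trans (le_trans c2 h) d1.
  - move=> q; rewrite mem_cat => /orP[qr|/ml[p' p'l h]].
      exists p; first exact: mem_head.
      by move/andP: fr => [/allP /(_ _ qr) /and3P[d1 d2 d3] _].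
    by exists p' => //; rewrite inE p'l orbT.
  - rewrite /total big_cat big_cons; apply: lerD => //; exact: total_le fr.
  - rewrite big_cons var_cat mulrS.
    have h1 := var_clip pb (family_sub (lexx _) p2 fu).
    have h2 : var (map (clip_left p.1) u) <= variation p.1.
      apply: restricted_ub; [exact: le_trans p2|exact: family_clip_left fu|by []].
    have h3 : variation p.2 - x < var u by [].
    lra.
apply/ler_addgt0Pl => x x0.
have y0 : 0 < x / (size l).+1%:R by rewrite divr_gt0.
have [m [fm _ tm vm]] := refine _ y0.
have := dP m fm (le_lt_trans tm ld).
have : (x / (size l).+1%:R) *+ size l <= x.
  rewrite -mulr_natr mulrAC ler_pdivrMr // ler_pM2l // ler_nat.
  exact: leqnSn.
move: vm; move: (_ *+ _) (var m) => y z; lra.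
Qed.

End Variation.

(** * Almost everywhere differentiability of absolutely continuous functions *)

Section MonotoneDerivable.
Variable R : realType.
Implicit Types (F : R -> R) (c d e : R).
Local Notation leb := (@lebesgue_measure R).

(** Finitely many components of an open set are turned into a family, so that absolute continuity
    can be applied to them. A component is bounded because [U] has finite measure, and it is
    contained in []inf, sup]]. The family is chosen before [F] and [nu]. *)
Lemma open_itv_family (J : nat -> set R) (U : set R) (n : nat) :
  (forall k, open (J k) /\ is_interval (J k)) -> trivIset setT J ->
  (forall k, J k `<=` U) -> measurable U -> (leb U < +oo)%E ->
  exists l A B, [/\ family A B l, (forall p, p \in l -> `]p.1, p.2[ `<=` U)%classic &
    forall (F : R -> R) (nu : set R -> \bar R), (forall u v, u <= v ->
      nu `]u, v]%classic = (F v - F u)%:E) ->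
      nu set0 = 0%E -> (forall k u v, J k `<=` `]u, v]%classic ->
        nu (J k) <= nu `]u, v]%classic)%E ->
      (\sum_(0 <= k < n) nu (J k) <= (\sum_(p <- l) (F p.2 - F p.1))%:E)%E].
Proof.
move=> oJ tJ JU mU Ufin.
have bd k x y : J k x -> J k y -> x <= y -> y - x <= fine (leb U).
  move=> Ix Iy xy; rewrite -lee_fin fineK; last by rewrite ge0_fin_numE.
  have -> : (y - x)%:E = leb (`]x, y[%classic : set R).
    rewrite lebesgue_measure_itv /= lte_fin; case: ltP => // h.
    by congr EFin; lra.
  apply: le_measure; rewrite ?inE // => z /=; rewrite in_itv /= => /andP[z1 z2].
  by apply: (JU k); apply: (oJ k).2 Ix Iy _ _; rewrite (ltW z1) ltW.
have hi k x : J k x -> has_ubound (J k).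
  move=> Ix; exists (x + fine (leb U)) => y Iy; have [h|h] := leP x y.
    by have := bd k x y Ix Iy h; lra.
  by apply: (le_trans (ltW h)); rewrite lerDl fine_ge0.
have lo k x : J k x -> has_lbound (J k).
  move=> Ix; exists (x - fine (leb U)) => y Iy; have [h|h] := leP y x.
    by have := bd k y x Iy Ix h; lra.
  by apply: le_trans _ (ltW h); rewrite gerBl fine_ge0.
have sub1 k x : J k x -> (`]inf (J k), sup (J k)[ `<=` J k)%classic.
  move=> Ix y /=; rewrite in_itv /= => /andP[y1 y2].
  have [u Iu uy] := inf_lt (ex_intro _ x Ix) y1.
  have [v Iv yv] := sup_gt (ex_intro _ x Ix) y2.
  by apply: (oJ k).2 Iu Iv _ _; rewrite !ltW.
have sub2 k x : J k x -> (J k `<=` `]inf (J k), sup (J k)])%classic.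
  move=> Ix y Iy /=; rewrite in_itv /= ub_le_sup ?andbT //; last exact: hi Ix.
  have /nbhs_ballP[r /= r0 rI] : nbhs y (J k) by apply: open_nbhs_nbhs; split => //;
    exact: (oJ k).1.
  apply: (@le_lt_trans _ _ (y - r / 2)); last by lra.
  apply: ge_inf; first exact: lo Ix.
  by apply: rI; rewrite /ball /= opprB addrC subrK gtr0_norm; lra.
have infsup k x : J k x -> inf (J k) <= sup (J k).
  move=> Ix; have := sub2 k x Ix x Ix; rewrite /= in_itv /= => /andP[h1 h2]; lra.
have sep j k x y : j != k -> J j x -> J k y -> x < y -> sup (J j) <= inf (J k).
  move=> jk Ijx Iky xy.
  have dis z : J j z -> J k z -> False.
    move=> h1 h2; have : (J j `&` J k) !=set0 by exists z.
    by move=> /(tJ j k I I) e; rewrite e eqxx in jk.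
  have lt1 x' : J j x' -> x' < y.
    move=> h; rewrite ltNge; apply/negP => h'; apply: (dis y) => //.
    by apply: (oJ j).2 Ijx h _ _; rewrite (ltW xy).
  apply: ge_sup; first by exists x.
  move=> x' Ix'; apply: lb_le_inf; first by exists y.
  move=> y' Iy'; rewrite leNgt; apply/negP => h; apply: (dis x') => //.
  by apply: (oJ k).2 Iy' Iky _ _; rewrite (ltW h) ltW // lt1.
suff [l [A [B [fl lJ H]]]] : exists l A B, [/\ family A B l,
    (forall p, p \in l -> exists k x, [/\ (k < n)%N, J k x & p = (inf (J k), sup (J k))]) &
    forall (F : R -> R) (nu : set R -> \bar R), (forall u v, u <= v ->
      nu `]u, v]%classic = (F v - F u)%:E) ->
      nu set0 = 0%E -> (forall k u v, J k `<=` `]u, v]%classic ->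
        nu (J k) <= nu `]u, v]%classic)%E ->
      (\sum_(0 <= k < n) nu (J k) <= (\sum_(p <- l) (F p.2 - F p.1))%:E)%E].
  exists l, A, B; split => //.
  by move=> p /lJ[k [x [_ Jx ->]]] y /(sub1 k x Jx); exact: JU.
elim: n => [|n [l [A [B [fl lJ H]]]]].
  exists [::], 0, 0; split => // F nu _ _ _.
  by rewrite !big_nil.
have lJ' p : p \in l -> exists k x, [/\ (k < n.+1)%N, J k x & p = (inf (J k), sup (J k))].
  by move=> /lJ[k [x [kn Jx e]]]; exists k, x; split => //; exact: ltnW.
have [J0|/set0P[x Jx]] := eqVneq (J n) set0.
  exists l, A, B; split => // F nu h1 h2 h3.
  by rewrite big_nat_recr //= J0 h2 adde0; exact: (H F nu h1 h2 h3).
exists ((inf (J n), sup (J n)) :: l), (Num.min A (inf (J n))), (Num.max B (sup (J n))).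
split.
- rewrite family_cons /itv_in /= ge_min lexx orbT (infsup n x) //= le_max lexx orbT /=.
  apply/andP; split; last by apply: family_sub fl; rewrite ?ge_min ?le_max lexx.
  apply/allP => p /lJ[k [y [kn Jy ->]]]; rewrite /nonoverlapping /=.
  have nk : n != k by rewrite gt_eqF.
  have [xy|yx|xy] := ltgtP x y.
  + by rewrite (sep n k x y).
  + by rewrite (sep k n y x) ?orbT // eq_sym.
  + exfalso; move/eqP: nk; apply; apply: (tJ n k I I); exists x; split => //.
    by rewrite xy.
- move=> p; rewrite inE => /predU1P[->|/lJ' //]; exists n, x; split => //.
- move=> F nu h1 h2 h3; rewrite big_nat_recr //= big_cons (addrC (F _ - F _)) EFinD.
  apply: leeD; first exact: (H F nu h1 h2 h3).
  rewrite -(h1 _ _ (infsup n x Jx)); apply: h3; exact: sub2 Jx.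
Qed.

(* The Lebesgue-Stieltjes measure of [F] is absolutely continuous, so that [F] is an
   integral of its Radon-Nikodym density. *)
Lemma nondecreasing_ac_derivable F c :
  {homo F : x y / x <= y} -> (forall x, x <= c -> F x = F c) ->
  has_ubound (range F) ->
  (forall e, 0 < e -> exists2 d, 0 < d & forall l A B, family A B l -> total l < d ->
    \sum_(p <- l) (F p.2 - F p.1) <= e) ->
  exists2 N, leb.-negligible N & forall x, c < x -> ~ N x -> derivable F x 1.
Proof.
move=> nd Fc [M FM] ac.
have cF : continuous F.
  move=> x; apply/cvgrPdist_le => e e0; have [d d0 H] := ac e e0.
  apply/nbhs_ballP; exists d => //= y; rewrite /ball /=.
  have [xy|yx] := leP x y.
    rewrite !ler0_norm ?subr_le0 ?nd // !opprB.
    have := H [:: (x, y)] x y; rewrite /family /itv_in /total !big_seq1 /= !lexx xy.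
    by apply.
  rewrite !ger0_norm ?subr_ge0 ?nd ?(ltW yx) //.
  have := H [:: (y, x)] y x; rewrite /family /itv_in /total !big_seq1 /= !lexx (ltW yx).
  by apply.
pose G : cumulative R R := HB.pack F (isCumulative.Build R _ R F nd (right_continuousW cF)).
pose mu : {measure set (measurableTypeR R) -> \bar R} := lebesgue_stieltjes_measure G.
have muE u v : u <= v -> mu `]u, v]%classic = (F v - F u)%:E.
  move=> uv; rewrite -[LHS]/(lebesgue_stieltjes_measure G `]u, v]%classic).
  rewrite /lebesgue_stieltjes_measure /measure_extension measurable_mu_extE //=.
    by rewrite wlength_itv_bnd.
  by exists (u, v).
have le_mu V W : measurable V -> measurable W -> V `<=` W -> (mu V <= mu W)%E.
  by move=> mV mW VW; apply: le_measure; rewrite ?inE.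
have Fbd u v : F v - F u <= M - F c.
  have h1 : F v <= M by apply: FM; exists v.
  have h2 : F c <= F u.
    have [uc|uc] := leP u c; first by rewrite (Fc _ uc).
    exact/nd/ltW.
  by lra.
have muT : (mu setT < +oo)%E.
  have : mu (`](- n%:R), n%:R]%classic) @[n --> \oo] --> mu setT.
    rewrite -(bigcup_itvT false false).
    apply: (@nondecreasing_cvg_mu _ _ _ mu (fun n => `](- n%:R), n%:R]%classic)) => //.
      exact: bigcup_measurable.
    move=> m n mn; apply/subsetPset => x /=; rewrite !in_itv /= => /andP[h1 h2].
    have mn' : m%:R <= n%:R :> R by rewrite ler_nat.
    by rewrite (le_lt_trans _ h1) ?lerN2 // (le_trans h2).
  move=> cv; apply: (@le_lt_trans _ _ (M - F c)%:E); last exact: ltry.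
  rewrite -(cvg_lim _ cv) //; apply: lime_le; first by apply/cvg_ex; exists (mu setT).
  by near=> n; rewrite muE ?lee_fin // -subr_ge0 opprK addr_ge0.
have fin_mu : fin_num_fun mu.
  move=> A mA; rewrite ge0_fin_numE //; apply: le_lt_trans muT; exact: le_mu.
pose nu : {finite_measure set (measurableTypeR R) -> \bar R} :=
  HB.pack (Measure.sort mu) (Measure_isFinite.Build _ _ _ (Measure.sort mu) fin_mu).
(* A Lebesgue null set lies in an open set of measure below the [d] of absolute continuity; finite
   sums over its components are bounded by [open_itv_family]. *)
have dom : nu `<< leb.
  apply/null_content_dominatesP => A mA A0; apply/eqP; rewrite eq_le measure_ge0 andbT.
  apply/lee_addgt0Pr => e e0; rewrite add0e; have [d d0 H] := ac e e0.
  have Aoo : (leb A < +oo)%E by rewrite [leb A]A0 ltry.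
  have [U [oU AU Ud]] := lebesgue_regularity_outer mA Aoo d0.
  have mU : measurable U by exact: measurable_realfun.open_measurable.
  have {}Ud : (leb U < d%:E)%E.
    have h := @measureU2 _ _ _ leb A (U `\` A) mA (measurableD mU mA).
    rewrite setDUK // in h; apply: le_lt_trans h _.
    have -> : (leb A + leb (U `\` A) = leb (U `\` A))%E by rewrite [leb A]A0 add0e.
    exact: Ud.
  pose J := open_disjoint_itv oU.
  have oJ k : open (J k) /\ is_interval (J k).
    by split; [exact: open_disjoint_itv_open|exact: open_disjoint_itv_is_interval].
  have tJ : trivIset setT J by exact: open_disjoint_itv_trivIset.
  have UJ : U = \bigcup_k J k by exact: open_disjoint_itv_bigcup.
  have JU k : J k `<=` U by rewrite UJ; exact: bigcup_sup.
  have mJ k : measurable (J k).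
    by apply: measurable_realfun.open_measurable; exact: (oJ k).1.
  apply: (@le_trans _ _ (mu U)); first exact: le_mu.
  rewrite UJ measure_bigcup //; last by move=> k _; exact: mJ.
  apply: lime_le; first exact: is_cvg_nneseries.
  near=> n; rewrite (eq_bigl xpredT); last by move=> k; rewrite in_setT.
  have Uoo : (leb U < +oo)%E by apply: lt_trans Ud _; rewrite ltry.
  have [l [A' [B' [fl lU Hl]]]] := open_itv_family n oJ tJ JU mU Uoo.
  apply: le_trans (Hl F mu muE (measure0 _) _) _.
    by move=> k u v h; apply: le_mu => //; exact: mJ.
  rewrite lee_fin; apply: (H _ _ _ fl); rewrite -lte_fin; apply: le_lt_trans Ud.
  exact: (total_le_measure mU fl lU).
have [f [f0 ffin fint nuE]] := radon_nikodym_sigma_finite dom.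
pose g x := fine (f x).
have fE : f = EFin \o g by apply/funext => x; rewrite /= fineK.
have gint (A : set R) : measurable A -> leb.-integrable A (EFin \o g).
  by move=> mA; rewrite -fE; apply: integrableS fint.
have gloc : locally_integrable setT g.
  by apply: open_integrable_locally; [exact: openT|exact: gint].
have [N [mN N0 NH]] := @FTC1 R g (BRight c) (fun y => gint _ (measurable_itv _)) gloc.
exists N; first by exists N; split.
move=> x cx Nx.
(* The identity holds on the whole line because [F] is constant up to [c], where the interval of
   integration is empty. *)
have FE : F = (fun y => (\int[leb]_(t in [set` Interval (BRight c) (BRight y)]) g t)%R + F c).
  apply/funext => y; have [yc|cy] := leP y c.
    have -> : [set` Interval (BRight c) (BRight y)] = set0.
      apply/seteqP; split => // z /=; rewrite in_itv /= => /andP[z1 z2].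
      by have := lt_le_trans z1 (le_trans z2 yc); rewrite ltxx.
    by rewrite Rintegral_set0 add0r Fc.
  rewrite /Rintegral.
  have -> : (\int[leb]_(t in [set` Interval (BRight c) (BRight y)]) (g t)%:E)%E = (F y - F c)%:E.
    rewrite -muE ?(ltW cy) // -[RHS]/(nu _) nuE //.
    by apply: eq_integral => t _; rewrite fE.
  by rewrite /= subrK.
rewrite FE; apply: derivableD => //.
by apply: contrapT => h; apply: Nx; apply: NH => /= H; apply: h; exact: (H _).1.
Unshelve. all: by end_near. Qed.

End MonotoneDerivable.

(** * From local to global inequalities on an interval *)

Section Creeping.
Variable R : realType.
Implicit Types (s t d e : R).

(** Real induction on the set where [F s0 <= F s]: the left condition puts its supremum into the
    set, and the right condition allows passing it as long as it is not [s1]. *)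
Lemma creeping (F : R -> R) (s0 s1 : R) : s0 <= s1 ->
  (forall s, s0 <= s < s1 -> exists2 d, 0 < d &
     forall t, s < t < s + d -> t <= s1 -> F s <= F t) ->
  (forall s e, s0 < s <= s1 -> 0 < e -> exists2 d, 0 < d &
     forall t, s - d < t < s -> s0 <= t -> F t <= F s + e) ->
  F s0 <= F s1.
Proof.
move=> s01 right left.
pose S := [set s | s0 <= s <= s1 /\ F s0 <= F s].
have S0 : S s0 by split; rewrite ?lexx.
have hS : has_sup S by split; [exists s0|exists s1 => s [/andP[]]].
have c0 : s0 <= sup S by apply: ub_le_sup => //; exact: hS.2.
have c1 : sup S <= s1 by apply: ge_sup; [exists s0|move=> s [/andP[]]].
have Sc : F s0 <= F (sup S).
  have [e|ne] := eqVneq s0 (sup S); first by rewrite -e.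
  have c0' : s0 < sup S by rewrite lt_neqAle ne.
  apply/ler_addgt0Pr => e e0.
  have [|d d0 H] := left (sup S) e _ e0; first by rewrite c0'.
  have [t [/andP[t0 t1] Ft] dt] := sup_adherent d0 hS.
  have : t <= sup S by apply: ub_le_sup => //; [exact: hS.2|split => //; rewrite t0].
  rewrite le_eqVlt => /predU1P[<-|tc]; first by apply: (le_trans Ft); rewrite lerDl ltW.
  by apply: (le_trans Ft); apply: H => //; rewrite dt.
have [e|ne] := eqVneq (sup S) s1; first by rewrite -e.
have c1' : sup S < s1 by rewrite lt_neqAle ne.
have [|d d0 H] := right (sup S); first by rewrite c0.
pose t := Num.min (sup S + d / 2) s1.
have ct : sup S < t by rewrite lt_min c1' andbT; lra.
have ts : t <= s1 by rewrite ge_min lexx orbT.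
have td : t < sup S + d by rewrite gt_min; apply/orP; left; lra.
have St : S t.
  split; first by rewrite ts (le_trans c0 (ltW ct)).
  by apply: (le_trans Sc); apply: H => //; rewrite ct.
have : t <= sup S by apply: ub_le_sup => //; exact: hS.2.
by rewrite leNgt ct.
Qed.

End Creeping.

Section AbsolutelyContinuous.
Variables (R : realType) (a b : R) (D : R -> R -> R).
Implicit Types (s t e K : R).
Hypothesis ab : a <= b.
Hypothesis D_ge0 : forall s t, a <= s -> s <= t -> t <= b -> 0 <= D s t.
Hypothesis D_refl : forall s, a <= s -> s <= b -> D s s = 0.
Hypothesis D_triangle : forall s u t, a <= s -> s <= u -> u <= t -> t <= b ->
  D s t <= D s u + D u t.
Hypothesis D_ac : forall e, 0 < e -> exists2 d, 0 < d &
  forall l, family a b l -> total l < d -> var D l < e.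

(** Composition with it extends a function constantly beyond [a, b], as the differentiation result
    is stated on the whole line. *)
Definition clamp (x : R) : R := Num.max a (Num.min x b).

Lemma clamp_in x : a <= clamp x <= b.
Proof. by rewrite /clamp le_max lexx /= ge_max ab ge_min lexx orbT. Qed.

Lemma clamp_id x : a <= x <= b -> clamp x = x.
Proof. by move=> /andP[h1 h2]; rewrite /clamp min_l // max_r. Qed.

Lemma clamp_le : {homo clamp : x y / x <= y}.
Proof.
move=> x y xy; rewrite /clamp ge_max le_max lexx /= le_max; apply/orP; right.
by rewrite le_min !ge_min xy lexx orbT.
Qed.

Lemma clamp_lip x y : x <= y -> clamp y - clamp x <= y - x.
Proof.
have := ab; rewrite /clamp => ab' xy.
have [h1|h1] := leP y b; have [h2|h2] := leP x b; have [h3|h3] := leP a y;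
  have [h4|h4] := leP a x; rewrite ?(max_r ab'); lra.
Qed.

Local Notation V := (variation a D).

Let F_derivable (F : R -> R) K : 0 <= K ->
  (forall s t, a <= s -> s <= t -> t <= b -> 0 <= F t - F s <= K * (V t - V s)) ->
  exists2 N, (@lebesgue_measure R).-negligible N &
    forall x, a < x -> ~ N x -> derivable (F \o clamp) x 1.
Proof.
move=> K0 HF; apply: nondecreasing_ac_derivable.
- move=> x y xy /=; have /andP[x1 x2] := clamp_in x; have /andP[y1 y2] := clamp_in y.
  by have /andP[] := HF _ _ x1 (clamp_le xy) y2; rewrite subr_ge0.
- move=> x xa /=; congr F; rewrite /clamp (@min_l _ _ a) // maxxx.
  by rewrite max_l // ge_min xa.
- exists (F b) => _ [x _ <-] /=; have /andP[x1 x2] := clamp_in x.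
  by have /andP[] := HF _ _ x1 x2 (lexx b); rewrite subr_ge0.
- move=> e e0; have K1 : 0 < K + 1 by lra.
  have [d d0 H] := variation_ac ab D_refl D_triangle D_ac (divr_gt0 e0 K1).
  exists d => // l A B fl ld.
  pose m := [seq (clamp p.1, clamp p.2) | p <- l].
  have fm : family a b m.
    by apply: family_map fl; [exact: clamp_le|move=> x _; exact: clamp_in].
  have tm : total m <= total l.
    rewrite /total big_map big_seq [leRHS]big_seq; apply: ler_sum => p pl /=.
    by apply: clamp_lip; move/andP: fl => [/allP /(_ _ pl) /and3P[]].
  have := H m fm (le_lt_trans tm ld); rewrite big_map /= => Hm.
  apply: (@le_trans _ _ (K * \sum_(p <- l) (V (clamp p.1, clamp p.2).2 - V (clamp p.1,
    clamp p.2).1))).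
    rewrite mulr_sumr big_seq [leRHS]big_seq; apply: ler_sum => p pl /=.
    have /and3P[_ p12 _] : itv_in A B p by move/andP: fl => [/allP /(_ _ pl)].
    have /andP[x1 _] := clamp_in p.1; have /andP[_ x2] := clamp_in p.2.
    by have /andP[] := HF _ _ x1 (clamp_le p12) x2.
  apply: le_trans (ler_wpM2l K0 Hm) _.
  by rewrite mulrCA ger_pMr // ler_pdivrMr // mul1r; lra.
Qed.

(** A Jordan decomposition: [f] is the difference of [K * V + f] and [K * V], both nondecreasing,
    with increments bounded by those of [2 * K * V] and [K * V]. *)
Lemma ac_derivable (f : R -> R) K : 0 <= K ->
  (forall s t, a <= s -> s <= t -> t <= b -> `|f t - f s| <= K * D s t) ->
  exists2 N, (@lebesgue_measure R).-negligible N &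
    forall x, a < x -> ~ N x -> derivable (f \o clamp) x 1.
Proof.
move=> K0 Hf.
have VD s t : a <= s -> s <= t -> t <= b -> K * D s t <= K * (V t - V s).
  by move=> h1 h2 h3; rewrite ler_wpM2l // (variation_ge ab D_refl D_triangle D_ac).
have KD s t : a <= s -> s <= t -> t <= b -> 0 <= K * D s t.
  by move=> h1 h2 h3; rewrite mulr_ge0 // D_ge0.
have [N1 n1 H1] : exists2 N, (@lebesgue_measure R).-negligible N &
    forall x, a < x -> ~ N x -> derivable ((fun x => K * V x + f x) \o clamp) x 1.
  apply: (@F_derivable _ (2 * K)); first by rewrite mulr_ge0.
  move=> s t h1 h2 h3; have := Hf _ _ h1 h2 h3; rewrite ler_norml.
  have := VD _ _ h1 h2 h3; have := KD _ _ h1 h2 h3.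
  by move: (K * D s t) => z ? ? /andP[? ?]; apply/andP; split; lra.
have [N2 n2 H2] : exists2 N, (@lebesgue_measure R).-negligible N &
    forall x, a < x -> ~ N x -> derivable ((fun x => K * V x) \o clamp) x 1.
  apply: (@F_derivable _ K) => // s t h1 h2 h3.
  have := VD _ _ h1 h2 h3; have := KD _ _ h1 h2 h3.
  by move: (K * D s t) => z ? ?; apply/andP; split; lra.
exists (N1 `|` N2); first exact: negligibleU.
move=> x ax /not_orP[h1 h2].
have -> : f \o clamp = ((fun x => K * V x + f x) \o clamp) - ((fun x => K * V x) \o clamp).
  by apply/funext => y /=; rewrite !fctE /= addrAC subrr add0r.
by apply: derivableB; [exact: H1|exact: H2].
Qed.

End AbsolutelyContinuous.

(** * Velocities and first-order estimates *)

Section Velocity.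
Variable R : realType.
Local Notation pt := 'rV[R]_3.
Implicit Types (a b s : R) (g : R -> pt).

Definition vec (r0 r1 r2 : R) : pt :=
  r0 *: delta_mx 0 (inord 0) + (r1 *: delta_mx 0 (inord 1) + r2 *: delta_mx 0 (inord 2)).

Lemma c0vec (r0 r1 r2 : R) : c0 (vec r0 r1 r2) = r0.
Proof. by rewrite /c0 !mxE !inord3E /= !(mulr1, mulr0) !addr0. Qed.
Lemma c1vec (r0 r1 r2 : R) : c1 (vec r0 r1 r2) = r1.
Proof. by rewrite /c1 !mxE !inord3E /= !(mulr1, mulr0) !addr0 add0r. Qed.
Lemma c2vec (r0 r1 r2 : R) : c2 (vec r0 r1 r2) = r2.
Proof. by rewrite /c2 !mxE !inord3E /= !(mulr1, mulr0) !add0r. Qed.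

Lemma cvg_vec (T : Type) (F : set_system T) (FF : Filter F) (f0 f1 f2 : T -> R) r0 r1 r2 :
  f0 @ F --> r0 -> f1 @ F --> r1 -> f2 @ F --> r2 ->
  (fun x => vec (f0 x) (f1 x) (f2 x)) @ F --> vec r0 r1 r2.
Proof.
move=> h0 h1 h2; apply: cvgD; first exact: cvgZr_tmp h0.
by apply: cvgD; apply: cvgZr_tmp.
Qed.

Lemma derivable_velocity a b g s : a < s < b ->
  derivable ((@c0 R \o g) \o clamp a b) s 1 -> derivable ((@c1 R \o g) \o clamp a b) s 1 ->
  derivable ((@c2 R \o g) \o clamp a b) s 1 -> exists v, has_velocity a b g s v.
Proof.
move=> /andP[as_ sb] d0 d1 d2.
have cid x : x \in `[a, b] -> clamp a b x = x by rewrite in_itv; exact: clamp_id.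
have sin : s \in `[a, b] by rewrite in_itv /= !ltW.
have dq (f : R -> R) : derivable (f \o clamp a b) s 1 ->
    exists l : R, (t - s)^-1 * (f t - f s) @[t --> within `[a, b] s^'] --> (l : R).
  move=> /cvg_ex[l /= hl]; exists l; apply/cvgrPdist_le => e e0.
  have /cvgrPdist_le /(_ e e0) /nbhs_ballP[d /= d0' H] := hl.
  apply/nbhs_ballP; exists d => // t; rewrite /ball /= => st ts tin.
  have := H (t - s); rewrite /ball /= sub0r normrN distrC subr_eq0 => /(_ st ts).
  rewrite [(_ - _)%R *: 1]mulr1 subrK cid // cid //.
have [v0 V0] := dq _ d0; have [v1 V1] := dq _ d1; have [v2 V2] := dq _ d2.
exists (vec v0 v1 v2); rewrite /has_velocity.
have -> : (fun t => (t - s)^-1 *: (g t - g s)) = (fun t => vec ((t - s)^-1 * (c0 (g t) - c0 (g s)))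
    ((t - s)^-1 * (c1 (g t) - c1 (g s))) ((t - s)^-1 * (c2 (g t) - c2 (g s)))).
  apply/funext => t; apply: row3P; rewrite ?c0vec ?c1vec ?c2vec !coordE; ring.
exact: cvg_vec.
Qed.

End Velocity.

Section FirstOrder.
Variables (R : realType) (k : surface).
Local Notation pt := 'rV[R]_3.
Implicit Types (x y z u v w : pt) (s t e : R).

Lemma near0_derive (f : R -> R) e : is_derive (0 : R) 1 f 1 -> 0 < e ->
  exists2 d, 0 < d & forall t : R, `|t| < d -> `|f t - f 0 - t| <= e * `|t|.
Proof.
move=> [/cvg_ex[l hl] dE] e0; have l1 : l = 1 by rewrite -dE; apply/esym/cvg_lim.
have /cvgrPdist_le /(_ e e0) /nbhs_ballP[d /= d0 H] := hl.
exists d => // t td; have [->|t0] := eqVneq t 0.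
  by rewrite subrr subr0 normr0 mulr0.
have := H t; rewrite /ball /= sub0r normrN => /(_ td t0).
rewrite addr0 [_ *: 1]mulr1 l1 => h.
have -> : f t - f 0 - t = t * (t^-1 *: (f t - f 0) - 1).
  by rewrite mulrBr mulr1 /GRing.scale /= mulrA divff // mul1r.
rewrite normrM mulrC ler_wpM2r // distrC.
exact: h.
Qed.

Lemma near0_sink e : 0 < e -> exists2 d, 0 < d & forall t : R, `|t| < d ->
  `|sink k t - t| <= e * `|t|.
Proof.
move=> e0; case: k.
- have [|d d0 H] := @near0_derive sin e _ e0; first by have := is_derive_sin (0 : R); rewrite cos0.
  by exists d => // t /H; rewrite sin0 subr0 sinkS.
- by exists 1 => // t _; rewrite sinkE subrr normr0 mulr_ge0 // ltW.
- have [|d d0 H] := @near0_derive expR e _ e0; first by have := is_derive_expR (0 : R);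
  rewrite expR0.
  exists d => // t td; have := H t td; have := H (- t); rewrite normrN => /(_ td).
  rewrite expR0 sinkH !ler_norml => /andP[h1 h2] /andP[h3 h4].
  apply/andP; split; lra.
Qed.

Lemma near0_cosk e : 0 < e -> exists2 d, 0 < d & forall t : R, `|t| < d ->
  `|cosk k t - 1| <= e.
Proof.
move=> e0; have := @continuous_cosk R k 0.
move=> /cvgrPdist_le /(_ e e0) /nbhs_ballP[d /= d0 H]; exists d => // t td.
by have := H t; rewrite /ball /= sub0r normrN cosk0 distrC; apply.
Qed.

(** With [y = b - e * h], of size at most [3 * h], the errors in the difference of the two sides are
    at most 3/8, 1/16 and 51/256 of the main term [e * h]. The bound 1/4 on [h] keeps [y] below 1,
    hence within a quarter turn. *)
Lemma first_order_reach e : 0 < e <= 1 -> exists2 d, 0 < d & forall h : R, 0 < h < d ->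
  [/\ (1 - e) * h <= sink k h, h <= 2 * sink k h &
   forall b, `|b| <= sink k h -> halfturn k (b - e * h) /\
     sink k (b - e * h) * cosk k h <= cosk k (b - e * h) * b].
Proof.
move=> /andP[e0 e1]; have f0 : 0 < e / 16 by lra.
have [d1 d10 H1] := near0_sink f0; have [d2 d20 H2] := near0_cosk f0.
exists (Num.min (d1 / 4) (Num.min (d2 / 4) (4^-1))).
  by rewrite !lt_min; apply/and3P; split; lra.
move=> h; rewrite !lt_min => /and4P[h0 h1 h2 h3].
have nh : `|h| = h by rewrite gtr0_norm.
have hd1 : `|h| < d1 by rewrite nh; lra.
have sh := H1 h hd1; rewrite nh in sh.
have eh : 0 <= (1 - e) * h by rewrite mulr_ge0; lra.
have eh' : 0 < e * h by rewrite mulr_gt0.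
have sh1 : `|sink k h - h| <= e * h / 16 by lra.
move: sh1; rewrite ler_norml => /andP[sh1 sh2].
split; [lra|lra|].
move=> b; rewrite ler_norml => /andP[b1 b2].
set y := b - e * h.
have y3 : `|y| <= 3 * h by rewrite ler_norml; apply/andP; split; rewrite /y; lra.
split.
  move=> _; move: y3; rewrite ler_norml => /andP[y1 y2]; have := pihalf_ge1 R.
  move=> p1; apply/andP; split; lra.
have yd1 : `|y| < d1 by lra.
have yd2 : `|y| < d2 by lra.
have A1 := H1 y yd1; have A2 := H2 y yd2.
have A3 : `|cosk k h - 1| <= e / 16 by apply: H2; rewrite nh; lra.
have -> : b = y + e * h by rewrite /y subrK.
rewrite -subr_ge0.
have -> : cosk k y * (y + e * h) - sink k y * cosk k h =
  y * ((cosk k y - 1) - (cosk k h - 1)) + cosk k y * (e * h)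
    - (sink k y - y) * cosk k h by ring.
have B1 : `|y * ((cosk k y - 1) - (cosk k h - 1))| <= 3 * h * (e / 8).
  rewrite normrM; apply: ler_pM => //.
  by apply: (le_trans (ler_normB _ _)); lra.
have B2 : `|(sink k y - y) * cosk k h| <= 3 * h * (e / 16) * (17 / 16).
  rewrite normrM; apply: ler_pM => //.
    apply: (le_trans A1); rewrite mulrC ler_wpM2r //; lra.
  move: A3; rewrite !ler_norml => /andP[? ?]; apply/andP; split; lra.
have B3 : (1 - e / 16) * (e * h) <= cosk k y * (e * h).
  rewrite ler_wpM2r ?(ltW eh') //; move: A2; rewrite ler_norml => /andP[? ?]; lra.
move: B1 B2; rewrite !ler_norml => /andP[B11 _] /andP[_ B22].
have ee : e * (e * h) <= e * h by rewrite ler_piMl // ltW.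
lra.
Qed.

End FirstOrder.

Section CoordinateBounds.
Variable R : realType.
Local Notation pt := 'rV[R]_3.
Implicit Types (k : surface) (x y z u v w : pt) (s t e : R).

(** On the hyperboloid, unit tangent vectors are not uniformly bounded in R^3; the bound has to
    depend on the height of the base point. *)
Lemma unit_tangent_bound k x u : points k x -> unit_tangent k x u ->
  forall c, c \in [:: @c0 R; @c1 R; @c2 R] -> `|c u| <= 1 + `|c0 x|.
Proof.
move=> kx [xu uu] c cc.
suff : c u ^+ 2 <= 1 + c0 x ^+ 2.
  move=> h; rewrite -[leLHS]ger0_norm // -[leRHS]ger0_norm ?addr_ge0 //.
  rewrite -ler_sqr ?nnegrE ?normr_ge0 // !real_normK ?num_real //.
  apply: (le_trans h); have -> : (1 + `|c0 x|) ^+ 2 = 1 + 2 * `|c0 x| + `|c0 x| ^+ 2 by ring.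
  by rewrite real_normK ?num_real //; have := normr_ge0 (c0 x); lra.
have q0 := sqr_ge0 (c0 u); have q1 := sqr_ge0 (c1 u); have q2 := sqr_ge0 (c2 u).
have qx := sqr_ge0 (c0 x).
case: k kx xu uu => /= [_ _|x0 u0|[xx x0] xu] uu; move: uu; rewrite /form -?expr2 => uu.
- by move: cc; rewrite !inE => /or3P[] /eqP ->; lra.
- by rewrite u0 in q0 *; move: cc; rewrite !inE => /or3P[] /eqP ->; rewrite ?u0 ?expr0n /=; lra.
move: xx xu; rewrite /form => xx xu.
have hx : c0 u ^+ 2 <= c0 x ^+ 2 - 1.
  have : 0 <= (c1 x * c2 u - c2 x * c1 u) ^+ 2 by exact: sqr_ge0.
  have -> : (c1 x * c2 u - c2 x * c1 u) ^+ 2 =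
    (c1 x * c1 x + c2 x * c2 x) * (c1 u ^+ 2 + c2 u ^+ 2)
     - (c1 x * c1 u + c2 x * c2 u) ^+ 2 by ring.
  have -> : c1 x * c1 u + c2 x * c2 u = c0 x * c0 u by lra.
  have -> : c1 x * c1 x + c2 x * c2 x = c0 x ^+ 2 - 1 by lra.
  have -> : c1 u ^+ 2 + c2 u ^+ 2 = c0 u ^+ 2 + 1 by lra.
  lra.
by move: cc; rewrite !inE => /or3P[] /eqP ->; lra.
Qed.

Lemma sin_le t : 0 <= t -> sin t <= t.
Proof.
rewrite le_eqVlt => /predU1P[<-|t0]; first by rewrite sin0.
have [c _ ] := @MVT R sin cos 0 t t0 (fun r _ => is_derive_sin r)
  (continuous_subspaceT (@continuous_sin R)).
rewrite sin0 !subr0 => ->.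
by rewrite ger_pMl // cos_le1.
Qed.

Lemma expR_sub1_le t : expR t - 1 <= t * expR t.
Proof.
have := expR_ge1Dx (- t); have := expRN1 t; have := expR_gt0 t.
move: (expR t) (expR (- t)) => a b a0 ab h.
have : a * (1 - t) <= a * b by apply: ler_wpM2l; [exact: ltW|exact: h].
rewrite ab; lra.
Qed.

(** Transfers absolute continuity from the distance to the ambient coordinates, in which velocities
    are taken. On the sphere the chord is twice the sine of half the distance [d]; in the hyperbolic
    case [y] is written as a point of a geodesic from [x], and [cosk - 1 + sink] is [expR d - 1]. *)
Lemma coord_lipschitz k x y B c : c \in [:: @c0 R; @c1 R; @c2 R] ->
  points k x -> points k y -> ds k x y <= B ->
  `|c y - c x| <= (2 + (1 + `|c0 x|) * expR B) * ds k x y.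
Proof.
move=> cc kx ky hB; have d0 := dist_ge0 kx ky.
have M0 : 0 <= `|c0 x| by exact: normr_ge0.
have E0 := expR_gt0 B.
have K2 : ds k x y <= (2 + (1 + `|c0 x|) * expR B) * ds k x y.
  by rewrite ler_peMl //; have := mulr_ge0 M0 (ltW E0); lra.
have cl (u v : pt) (r s : R) : c (r *: u + s *: v) = r * c u + s * c v.
  by move: cc; rewrite !inE => /or3P[] /eqP ->; rewrite !coordE.
have cB (u v : pt) : c (u - v) = c u - c v.
  by move: cc; rewrite !inE => /or3P[] /eqP ->; rewrite !coordE.
case: k kx ky hB d0 K2 => kx ky hB d0 K2.
- have : (c y - c x) ^+ 2 <= (2 * ds Sphere x y) ^+ 2.
    have h1 : (c y - c x) ^+ 2 <= form Sphere (y - x) (y - x).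
      rewrite -cB /form -!expr2; have := sqr_ge0 (c0 (y - x)).
      have := sqr_ge0 (c1 (y - x)); have := sqr_ge0 (c2 (y - x)).
      by move: cc; rewrite !inE => /or3P[] /eqP ->; lra.
    apply: (le_trans h1).
    have -> : form Sphere (y - x) (y - x) = 4 * sin (ds Sphere x y / 2) ^+ 2.
      have -> : form Sphere (y - x) (y - x) = 2 - 2 * cosk Sphere (ds Sphere x y).
        rewrite cosk_dist // /cosd !formE kx ky (formC _ y x); ring.
      have -> : cosk Sphere (ds Sphere x y) = cos (ds Sphere x y / 2) ^+ 2 *+ 2 - 1.
        by rewrite coskS -cos_mulr2n; congr cos; rewrite -mulr_natr; lra.
      rewrite sin2cos2 -mulr_natr; ring.
    have h2 : 0 <= ds Sphere x y / 2 by lra.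
    have hp := dist_range kx ky (erefl Sphere).
    have s0 : 0 <= sin (ds Sphere x y / 2) by apply: sin_ge0_pi; have := pi_ge0 R; lra.
    have := sin_le h2; rewrite -(ler_pXn2r (n := 2)) ?nnegrE //.
    by have := sqr_ge0 (ds Sphere x y); lra.
  rewrite -ler_sqrt ?sqr_ge0 // !sqrtr_sqr => h; apply: (le_trans h).
  rewrite ger0_norm ?mulr_ge0 // ler_wpM2r //.
  by have := mulr_ge0 M0 (ltW E0); lra.
- apply: le_trans K2; rewrite dsE form_subC -sqrtr_sqr; apply: ler_wsqrtr.
  rewrite -cB /form -!expr2; have := sqr_ge0 (c1 (y - x)); have := sqr_ge0 (c2 (y - x)).
  have z0 : c0 (y - x) = 0 by rewrite !coordE kx ky subrr.
  by move: cc; rewrite !inE => /or3P[] /eqP ->; rewrite ?z0 ?expr0n /=; lra.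
- have [xy|xy] := pselect (x = y).
    by apply: le_trans K2; rewrite -{1}xy subrr normr0.
  have na : nonantipodal Hyperbolic x y by [].
  have kd := dir_unit kx ky xy na.
  have := unit_tangent_bound kx kd cc; set u := dir _ _ _ => ub.
  have xb : `|c x| <= 1 + `|c0 x|.
    have [xx x0] := kx; move: xx; rewrite /form -!expr2 => xx.
    apply: (@le_trans _ _ `|c0 x|); last by rewrite lerDr.
    rewrite -(@ler_pXn2r _ 2) ?nnegrE // !real_normK ?num_real //.
    have q1 := sqr_ge0 (c1 x); have q2 := sqr_ge0 (c2 x).
    by move: cc; rewrite !inE => /or3P[] /eqP ->; lra.
  rewrite -{1}(geod_dir kx ky xy na) /geod cl -/u.
  set d := ds _ _ _ in hB d0 K2 *.
  have -> : cosk Hyperbolic d * c x + sink Hyperbolic d * c u - c x =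
    (cosk Hyperbolic d - 1) * c x + sink Hyperbolic d * c u by ring.
  have C1 := coskH_ge1 d.
  have S1 : 0 <= sink Hyperbolic d by apply: sink_ge0.
  apply: (le_trans (ler_normD _ _)); rewrite !normrM (ger0_norm S1) ger0_norm ?subr_ge0 //.
  have C0 : 0 <= cosk Hyperbolic d - 1 by rewrite subr_ge0.
  have P1 := ler_wpM2l C0 xb; have P2 := ler_wpM2l S1 ub.
  apply: (le_trans (lerD P1 P2)); rewrite -mulrDl.
  have -> : cosk Hyperbolic d - 1 + sink Hyperbolic d = expR d - 1 by rewrite coskH sinkH; lra.
  apply: (@le_trans _ _ (d * expR B * (1 + `|c0 x|))).
    rewrite ler_wpM2r ?addr_ge0 // (le_trans (expR_sub1_le d)) //.
    by rewrite ler_wpM2l // ler_expR.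
  have : 0 <= 2 * d by rewrite mulr_ge0.
  move: (expR B) `|c0 x| => p q; lra.
Qed.

End CoordinateBounds.

(** * Bounds and velocities for an absolutely continuous curve on the surface *)

Section Curve.
Variables (R : realType) (k : surface) (a b : R) (g : R -> 'rV[R]_3).
Local Notation pt := 'rV[R]_3.
Implicit Types (x y z u v w : pt) (s t r e : R).
Hypothesis ab : a <= b.
Hypothesis g_ac : ac_curve k a b g.

Local Notation D := (fun s t : R => ds k (g s) (g t)).
Local Notation coords := [:: @c0 R; @c1 R; @c2 R].

Lemma curve_points s : a <= s <= b -> points k (g s).
Proof. by move=> h; apply: g_ac.1; rewrite in_itv. Qed.

Lemma curve_dist_ge0 s t : a <= s -> s <= t -> t <= b -> 0 <= D s t.
Proof.
move=> h1 h2 h3; apply: dist_ge0; apply: curve_points.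
  by rewrite h1 (le_trans h2).
by rewrite h3 (le_trans h1).
Qed.

Lemma curve_dist_refl s : a <= s -> s <= b -> D s s = 0.
Proof. by move=> h1 h2; apply: distxx; apply: curve_points; rewrite h1. Qed.

Lemma curve_triangle s r t : a <= s -> s <= r -> r <= t -> t <= b ->
  D s t <= D s r + D r t.
Proof.
move=> h1 h2 h3 h4; apply: dist_triangle; apply: curve_points.
- by rewrite h1 (le_trans h2) // (le_trans h3).
- by rewrite (le_trans h1 h2) (le_trans h3).
- by rewrite h4 (le_trans h1) // (le_trans h2).
Qed.

Lemma curve_family_ac e : 0 < e -> exists2 d, 0 < d &
  forall l, family a b l -> total l < d -> var D l < e.
Proof.
move=> e0; have [d d0 H] := g_ac.2 e e0; exists d => // l /andP[al pl] ld.
have := H (size l) (fun i => (nth (0, 0) l i).1) (fun i => (nth (0, 0) l i).2).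
have -> : \sum_(i < size l) dist k (g (nth (0, 0) l i).1) (g (nth (0, 0) l i).2) = var D l.
  by rewrite /var (big_nth (0, 0)) big_mkord; apply: eq_bigr => i _; rewrite ds.unlock.
have -> : \sum_(i < size l) ((nth (0, 0) l i).2 - (nth (0, 0) l i).1) = total l.
  by rewrite /total (big_nth (0, 0)) big_mkord.
apply => //.
  by move=> i; have /and3P[] := allP al _ (mem_nth (0, 0) (ltn_ord i)).
move=> i j ij; have /(pairwiseP (0, 0)) P := pl.
have [lt|lt|e'] := ltngtP i j.
- by have /orP := P i j (ltn_ord i) (ltn_ord j) lt.
- by have /orP[h|h] := P j i (ltn_ord j) (ltn_ord i) lt; [right|left].
- by move: ij; rewrite (ord_inj e') eqxx.
Qed.

Lemma curve_continuous e : 0 < e -> exists2 d, 0 < d &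
  forall s t, a <= s -> s <= t -> t <= b -> t - s < d -> D s t < e.
Proof.
move=> e0; have [d d0 H] := curve_family_ac e0; exists d => // s t h1 h2 h3 h4.
have := H [:: (s, t)]; rewrite /family /itv_in /total /var !big_seq1 /= h1 h2 h3.
by apply.
Qed.

Lemma curve_bounded : exists B, forall s, a <= s <= b -> D a s <= B.
Proof.
have [B HB] := var_bounded ab curve_dist_refl curve_triangle curve_family_ac.
exists B => s /andP[h1 h2]; have := HB [:: (a, s)].
by rewrite /family /itv_in /var big_seq1 /= lexx h1 h2; apply.
Qed.

Lemma curve_lipschitz : exists2 K, 0 <= K & forall c, c \in coords ->
  forall s t, a <= s -> s <= t -> t <= b -> `|c (g t) - c (g s)| <= K * D s t.
Proof.
have [B HB] := curve_bounded.
have ka : points k (g a) by apply: curve_points; rewrite lexx.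
pose K1 := (2 + (1 + `|c0 (g a)|) * expR B).
have M s : a <= s <= b -> `|c0 (g s)| <= `|c0 (g a)| + K1 * B.
  move=> h; have ks := curve_points h; have := coord_lipschitz (mem_head _ _) ka ks (HB _ h).
  have B0 := HB _ h; have d0 := dist_ge0 ka ks.
  have K10 : 0 <= K1.
    by rewrite /K1 addr_ge0 // mulr_ge0 ?expR_ge0 // addr_ge0.
  rewrite -/K1 => h1; have := ler_wpM2l K10 B0.
  have := ler_normD (c0 (g s) - c0 (g a)) (c0 (g a)); rewrite subrK; lra.
pose M1 := `|c0 (g a)| + K1 * B.
exists (2 + (1 + M1) * expR (2 * B)).
  have := M a; rewrite lexx ab => /(_ isT) h.
  by rewrite addr_ge0 // mulr_ge0 ?expR_ge0 // addr_ge0 // (le_trans _ h).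
move=> c cc s t h1 h2 h3.
have hs : a <= s <= b by rewrite h1 (le_trans h2).
have ht : a <= t <= b by rewrite h3 (le_trans h1).
have ks := curve_points hs; have kt := curve_points ht.
have dB : D s t <= 2 * B.
  have := dist_triangle ks ka kt; rewrite (distC k (g s) (g a)).
  by have := HB _ hs; have := HB _ ht; lra.
apply: le_trans (coord_lipschitz cc ks kt dB) _.
have d0 := dist_ge0 ks kt.
by rewrite ler_wpM2r // lerD2l ler_wpM2r ?expR_ge0 // lerD2l; exact: M.
Qed.

Lemma velocity_ae : exists2 N, (@lebesgue_measure R).-negligible N &
  forall s, a < s < b -> ~ N s -> exists v, has_velocity a b g s v.
Proof.
have [K K0 HK] := curve_lipschitz.
have der c : c \in coords -> exists2 N, (@lebesgue_measure R).-negligible N &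
    forall x : R, a < x -> ~ N x -> derivable ((c \o g) \o clamp a b) x 1.
  move=> cc; apply: (ac_derivable ab curve_dist_ge0 curve_dist_refl curve_triangle
    curve_family_ac K0).
  by move=> s t h1 h2 h3; exact: HK.
have [N0 n0 H0] := der (@c0 R) (mem_head _ _).
have [|N1 n1 H1] := der (@c1 R); first by rewrite !inE eqxx orbT.
have [|N2 n2 H2] := der (@c2 R); first by rewrite !inE eqxx !orbT.
exists (N0 `|` (N1 `|` N2)); first by apply: negligibleU => //; exact: negligibleU.
move=> s /andP[as_ sb] /not_orP[h0 /not_orP[h1 h2]].
apply: derivable_velocity; rewrite ?as_ //; [exact: H0|exact: H1|exact: H2].
Qed.

Lemma coord_norm c x : c \in coords -> `|c x| <= `|x|.
Proof.
move=> cc; have h (i : 'I_3) : `|x ord0 i| <= `|x|.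
  rewrite [leRHS]/Num.norm /= mx_normrE.
  by apply: le_trans (le_bigmax _ _ (ord0, i)).
by move: cc; rewrite !inE => /or3P[] /eqP ->; exact: h.
Qed.

Lemma velocity_eps s v e : has_velocity a b g s v -> 0 < e -> exists2 d, 0 < d &
  forall t, a <= t <= b -> `|t - s| < d -> forall c, c \in coords ->
    `|c (g t - g s - (t - s) *: v)| <= e * `|t - s|.
Proof.
move=> /cvgrPdist_le H e0; have /nbhs_ballP[d /= d0 {}H] := H e e0.
exists d => // t tab td c cc.
have [->|ts] := eqVneq t s.
  rewrite !subrr scale0r subr0 normr0 mulr0; have := coord_norm (0 : pt) cc.
  by rewrite normr0.
have := H t; rewrite /ball /= distrC => /(_ td ts); rewrite in_itv => /(_ tab) {}H.
have -> : g t - g s - (t - s) *: v = - (t - s) *: (v - (t - s)^-1 *: (g t - g s)).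
  rewrite scaleNr scalerBr scalerA divff ?subr_eq0 // scale1r opprB; exact: erefl.
have cZ r x : c (r *: x) = r * c x.
  by move: cc; rewrite !inE => /or3P[] /eqP ->; rewrite !coordE.
rewrite cZ normrM normrN mulrC ler_wpM2r //.
exact: le_trans (coord_norm _ cc) H.
Qed.

Lemma form_bound x y A e : (forall c, c \in coords -> `|c x| <= A) ->
  (forall c, c \in coords -> `|c y| <= e) -> `|form k x y| <= 3 * (A * e).
Proof.
move=> hx hy.
have h c : c \in coords -> `|c x * c y| <= A * e.
  by move=> cc; rewrite normrM; apply: ler_pM => //; [exact: hx|exact: hy].
have h0 := h (@c0 R) (mem_head _ _).
have h1 : `|c1 x * c1 y| <= A * e by apply: h; rewrite !inE eqxx orbT.
have h2 : `|c2 x * c2 y| <= A * e by apply: h; rewrite !inE eqxx !orbT.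
have Ae : 0 <= A * e by exact: le_trans h0.
move: h0 h1 h2; rewrite !ler_norml => /andP[? ?] /andP[? ?] /andP[? ?].
by case: k; rewrite /form; apply/andP; split; lra.
Qed.

End Curve.

(** * Half-planes and velocities *)

Section OrthogonalLine.
Variables (R : realType) (k : surface).
Local Notation pt := 'rV[R]_3.
Implicit Types (x y z u v w p q n : pt) (s t r e : R).

Lemma versk_double t : versk k (2 * t) = 2 * sink k t ^+ 2 :> R.
Proof.
have -> : 2 * t = t + t by ring.
have h := cosk2 k t; case: k h => /= h; last first.
- by rewrite verskH coskD /curv; move: h; rewrite /curv => h; lra.
- by rewrite verskE sinkE; field.
- by rewrite verskS coskD /curv; move: h; rewrite /curv => h; lra.
Qed.

Lemma cosk_versk t : cosk k t = 1 - curv k * versk k t :> R.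
Proof. by case: k; rewrite /curv ?verskS ?verskH ?coskE; ring. Qed.

(** Half the squared ambient chord in all three geometries: a polynomial, whose variation along the
    curve is given by the ambient velocity. *)
Lemma vers_form x y : points k x -> points k y -> vers k x y = form k (x - y) (x - y) / 2.
Proof.
case: k => /=.
- rewrite /vers => xx yy; rewrite !formE xx yy (formC _ y x); lra.
- by rewrite /vers.
- rewrite /vers => -[xx _] [yy _]; rewrite !formE xx yy (formC _ y x); lra.
Qed.

Lemma form_tvec x v p : tangent k x v -> form k v (tvec k x p) = form k v (p - x).
Proof.
case: k => /= h; rewrite /tvec ?formDr ?formNr ?formZr; last first.
- by rewrite (formC _ v x) h; ring.
- by rewrite /cosd mul1r.
- by rewrite (formC _ v x) h; ring.
Qed.

Lemma sink_near0 : exists2 d : R, 0 < d & forall t, `|t| < d -> `|sink k t| <= 2 * `|t|.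
Proof.
have [d d0 H] := near0_sink k (ltr01 : 0 < 1 :> R); exists d => // t /H h.
have := ler_normD (sink k t - t) t; rewrite subrK mul1r in h *; lra.
Qed.

Lemma geod_velocity x u e : 0 < e -> exists2 d, 0 < d & forall h : R, h != 0 -> `|h| < d ->
  `|u - h^-1 *: (geod k x u h - x)| <= e.
Proof.
move=> e0.
pose M := 1 + `|x| + `|u|.
have x0 := normr_ge0 x; have u0 := normr_ge0 u.
have M0 : 0 < M by rewrite /M; lra.
have eM : 0 < e / M by rewrite divr_gt0.
have [d1 d10 H1] := near0_sink k eM; have [d2 d20 H2] := sink_near0.
exists (Num.min d1 (Num.min d2 (e / M / 2))); first by rewrite !lt_min d10 d20 divr_gt0.
move=> h; rewrite !lt_min => h0 /and3P[h1 h2 h3]; rewrite /geod.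
have ha : 0 < `|h| by rewrite normr_gt0.
have -> : u - h^-1 *: (cosk k h *: x + sink k h *: u - x) =
  (h^-1 * (h - sink k h)) *: u + (h^-1 * (1 - cosk k h)) *: x.
  apply: row3P; rewrite !coordE; field; exact: h0.
apply: le_trans (ler_normD _ _) _; rewrite !normrZ !normfV.
have e1 : `|h|^-1 * `|h - sink k h| <= e / M.
  by rewrite mulrC ler_pdivrMr // distrC; exact: H1.
have e2 : `|h|^-1 * `|1 - cosk k h| <= e / M.
  rewrite mulrC ler_pdivrMr //.
  have -> : 1 - cosk k h = curv k * versk k (2 * (h / 2)).
    by rewrite (_ : 2 * (h / 2) = h); [rewrite cosk_versk; ring|field].
  rewrite versk_double; have hh : `|h / 2| = `|h| / 2 by rewrite normrM [`|2^-1|]ger0_norm.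
  have := H2 (h / 2); rewrite hh => /(_ _); have -> : `|h| / 2 < d2 by lra.
  move=> /(_ isT); set S := sink k _ => hS.
  have {}hS : `|S| <= `|h| by lra.
  have hS2 : `|2 * S ^+ 2| <= 2 * (`|h| * `|h|).
    by rewrite normrM normrX ger0_norm // ler_wpM2l // expr2 ler_pM.
  have : `|curv k * (2 * S ^+ 2)| <= `|2 * S ^+ 2|.
    by case: (k); rewrite /curv ?mul0r ?mul1r ?mulN1r ?normrN ?normr0.
  move=> h4; nra.
have := ler_wpM2r u0 e1; have := ler_wpM2r x0 e2.
have : e / M * M = e by rewrite divfK // gt_eqF.
have : 0 <= e / M by exact: ltW.
by rewrite {3}/M; nra.
Qed.

Lemma geod_derive x u : is_derive (0 : R) (1 : R) (geod k x u) u.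
Proof.
suff H : (h^-1 *: ((geod k x u \o shift 0) (h *: (1 : R)) - geod k x u 0)) @[h --> (0 : R)^'] --> u.
  apply: DeriveDef; first by apply/cvg_ex; exists u.
  exact: cvg_lim H.
apply/cvgrPdist_le => e e0; have [d d0 H] := geod_velocity x u e0.
apply/nbhs_ballP; exists d => //= h; rewrite /ball /= sub0r normrN => hd h0.
by rewrite /= /shift /= addr0 /GRing.scale /= mulr1 geod0; exact: H.
Qed.

Lemma rotation x v : points k x -> tangent k x v -> exists w,
  [/\ tangent k x w, form k v w = 0, form k w w = form k v v &
      forall a, tangent k x a -> form k v v *: a = form k v a *: v + form k w a *: w].
Proof.
move=> kx xv.
have [w [xw vw ww]] : exists w, [/\ tangent k x w, form k v w = 0 & form k w w = form k v v].
  (* A quarter turn of [v] in the tangent plane: the cross product with [x], taken for the Lorentz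
     form in the hyperbolic case. *)
  case: k kx xv => /= [xx xv|_ v0|[xx _] xv].
  - exists (vec (c1 x * c2 v - c2 x * c1 v) (c2 x * c0 v - c0 x * c2 v) (c0 x * c1 v - c1 x * c0
    v)).
    move: xx xv; rewrite /form !(c0vec, c1vec, c2vec) => xx xv; split; [ring|ring|].
    transitivity ((c0 x * c0 x + c1 x * c1 x + c2 x * c2 x) * (c0 v * c0 v + c1 v * c1 v + c2 v *
      c2 v)
      - (c0 x * c0 v + c1 x * c1 v + c2 x * c2 v) ^+ 2); first by ring.
    by rewrite xx xv; ring.
  - by exists (vec 0 (- c2 v) (c1 v)); rewrite /form !(c0vec, c1vec, c2vec); split; ring.
  - exists (vec (- (c1 x * c2 v - c2 x * c1 v)) (c2 x * c0 v - c0 x * c2 v) (c0 x * c1 v - c1 x *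
    c0 v)).
    move: xx xv; rewrite /form !(c0vec, c1vec, c2vec) => xx xv; split; [ring|ring|].
    transitivity (- (c1 x * c1 x + c2 x * c2 x - c0 x * c0 x) * (c1 v * c1 v + c2 v * c2 v - c0 v
      * c0 v)
      + (c1 x * c1 v + c2 x * c2 v - c0 x * c0 v) ^+ 2); first by ring.
    by rewrite xx xv; ring.
exists w; split => // a xa; apply/eqP; rewrite -subr_eq0; apply/eqP.
(* The remainder is orthogonal to [v] and to [w], which in the tangent plane forces it to vanish. *)
set d := _ - _.
have xd : tangent k x d.
  by apply: tangentD; [exact: tangentZ|apply: tangentN; apply: tangentD; exact: tangentZ].
have vd : form k v d = 0 by rewrite /d !formE vw; ring.
have wd : form k w d = 0 by rewrite /d !formE (formC k w v) vw ww; ring.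
have [v0|v0] := eqVneq (form k v v) 0.
  rewrite /d v0 scale0r (tangent_eq0 kx xv v0) (tangent_eq0 kx xw); last by rewrite ww.
  by rewrite !scaler0 addr0 subr0.
have h1 := tangent_cross kx xv xw xd; rewrite vw vd mul0r mulr0 subr0 in h1.
have {}h1 : det3 x w d = 0 by apply/eqP; move/eqP: h1; rewrite mulf_eq0 (negbTE v0).
have h2 := tangent_gram kx xw xd xd; rewrite wd h1 !mul0r addr0 ww in h2.
by apply: (tangent_eq0 kx xd); apply/eqP; move/eqP: h2; rewrite mulf_eq0 (negbTE v0).
Qed.

Lemma geod_maximal x u : points k x -> unit_tangent k x u -> maximal_geodesic k (geod k x u).
Proof.
move=> kx ku; split=> [t|t]; first exact: geod_points.
exists 1 => // r s hr hs.
have := dist_geod2 (s := r) (t := s) kx ku; rewrite ds.unlock; apply => _.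
have := pi_ge2 R; have := ler_distD t r s; rewrite (distrC t s); lra.
Qed.

(** The half-plane condition does not tell on which side of the normal line the past lies; one past
    point strictly behind decides. The linear form [n] vanishes on [x] and on the direction of the
    normal line, so that on [tvec] it is a multiple of [form k v]. *)
Lemma half_space_past x v (P : set pt) p' : points k x -> tangent k x v ->
  (forall L, line_orthogonal_at k x v L -> exists2 H, closed_half_space k L H & P `<=` H) ->
  P `<=` points k -> P p' -> form k v (tvec k x p') < 0 ->
  forall p, P p -> form k v (tvec k x p) <= 0.
Proof.
move=> kx xv HL PX Pp' p'0 p Pp.
have [w [xw vw ww dec]] := rotation kx xv.
have vv_gt0 : 0 < form k v v.
  rewrite lt_neqAle (tangent_ge0 kx xv) andbT eq_sym; apply/eqP => v0.
  by move: p'0; rewrite (tangent_eq0 kx xv v0) form0l ltxx.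
pose r := Num.sqrt (form k v v).
have r0 : 0 < r by rewrite sqrtr_gt0.
have r2 : r ^+ 2 = form k v v by rewrite sqr_sqrtr // ltW.
pose u := r^-1 *: w.
have ku : unit_tangent k x u.
  split; first exact: tangentZ.
  by rewrite /u formZl formZr ww -r2; field; rewrite gt_eqF.
have uv : form k u v = 0 by rewrite /u formZl formC vw mulr0.
have [|H [n [Ln Hn]] PH] := HL (range (geod k x u)).
  exists (geod k x u), u; split=> //; [exact: geod_maximal|exact: geod0|exact: geod_derive].
have dotE q : \sum_(i < 3) n ord0 i * q ord0 i = form Sphere n q.
  rewrite !big_ord_recr big_ord0 /= add0r /form /c0 /c1 /c2 !inord3E.
  by congr (_ + _ + _); congr (n _ _ * q _ _); apply: val_inj.
have on_line t : form Sphere n (geod k x u t) = 0.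
  have : range (geod k x u) (geod k x u t) by exists t.
  by rewrite Ln => -[_]; rewrite dotE.
have nx : form Sphere n x = 0 by have := on_line 0; rewrite geod0.
have nu : form Sphere n u = 0.
  have s1 : 0 < sink k (1 : R) by apply: sink_gt0 => // _; have := pi_ge2 R; lra.
  have := on_line 1; rewrite /geod formDr !formZr nx mulr0 add0r => /eqP.
  by rewrite mulf_eq0 (gt_eqF s1) => /eqP.
have nw : form Sphere n w = 0.
  have -> : w = r *: u by rewrite /u scalerA divff ?scale1r // gt_eqF.
  by rewrite formZr nu mulr0.
have key q : points k q -> form k v v * form Sphere n q = form k v (tvec k x q) * form Sphere n v.
  move=> kq; have -> : form Sphere n q = form Sphere n (tvec k x q).
    by rewrite [in RHS]/tvec formDr formNr formZr nx mulr0 subr0.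
  by rewrite -formZr dec ?formDr ?formZr ?nw ?mulr0 ?addr0 //; exact: tvec_tangent.
have pos q : P q -> 0 <= form Sphere n q by move=> /PH; rewrite Hn => -[_]; rewrite dotE.
(* Otherwise [p'] would lie on the normal line, along which [tvec] is orthogonal to [v]. *)
have nv : form Sphere n v < 0.
  rewrite ltNge; apply/negP => nv.
  have : form Sphere n p' = 0.
    have := key _ (PX _ Pp'); have := pos _ Pp'; nra.
  move=> np'; have : range (geod k x u) p' by rewrite Ln; split; [exact: PX|rewrite dotE].
  move=> [t _ E]; move: p'0; rewrite -E tvec_geod // formZr formC uv mulr0 ltxx //.
have := key _ (PX _ Pp); have := pos _ Pp; nra.
Qed.

End OrthogonalLine.

(** * The half-plane condition in terms of velocities *)

Section GCurve.
Variables (R : realType) (k : surface) (a b : R) (g : R -> 'rV[R]_3).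
Local Notation pt := 'rV[R]_3.
Implicit Types (x y z u v w : pt) (s t r e : R).
Hypothesis ab : a <= b.
Hypothesis g_G : G_curve k a b g.
Hypothesis g_short : forall s t, a <= s <= b -> a <= t <= b -> short k (ds k (g s) (g t)).

Local Notation D := (fun s t : R => ds k (g s) (g t)).
Local Notation coords := [:: @c0 R; @c1 R; @c2 R].

Let g_ac : ac_curve k a b g := g_G.1.
Let kg s : a <= s <= b -> points k (g s) := curve_points g_ac (s := s).

(* Almost everywhere growth propagates: the exceptional null set is absorbed by
   a monotone function of arbitrarily small total variation. *)
Lemma ae_creeping (N : set R) (F : R -> R) K s1 s2 :
  (@lebesgue_measure R).-negligible N -> 0 <= K -> a <= s1 -> s1 <= s2 -> s2 <= b ->
  (forall s t, s1 <= s -> s < t -> t <= s2 -> F s <= F t + K * D s t) ->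
  (forall s e, s1 <= s < s2 -> ~ N s -> 0 < e -> exists2 d, 0 < d &
     forall t, s < t < s + d -> t <= s2 -> F s <= F t + e * (t - s)) ->
  F s1 <= F s2.
Proof.
move=> N0 K0 as1 s12 s2b lip grow; apply/ler_addgt0Pr => e' e'0.
(* The errors add up to at most [e * (s2 - s1) + K * e]; the term 1 makes [M] positive. *)
pose M := s2 - s1 + K + 1.
have M0 : 0 < M by rewrite /M; lra.
pose e := e' / M.
have e0 : 0 < e by rewrite divr_gt0.
have [psi [psi_e psi_mono psi_N]] := null_negligible ab (curve_dist_refl g_ac)
  (curve_triangle g_ac) (curve_family_ac g_ac) N0 e0.
have : F s1 + e * s1 + K * psi s1 <= F s2 + e * s2 + K * psi s2.
  (* On [N] the growth of [psi] compensates the possible decrease [K * D s t]; elsewhere the term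
     [e * s] absorbs the error in the growth of [F]. *)
  apply: (creeping (F := fun s => F s + e * s + K * psi s)) => // [s|s e1].
    move=> /andP[s1s ss2]; have [Ns|Ns] := pselect (N s).
      have [|d d0 H] := psi_N _ Ns; first by apply/andP; split; lra.
      exists d => // t st ts2; have st' : s < t by case/andP: st.
      have h1 := lip _ _ s1s st' ts2; have h2 := ler_wpM2l K0 (H _ st (le_trans ts2 s2b)).
      have h3 : e * s <= e * t by rewrite ler_wpM2l // ltW.
      lra.
    have [|d d0 H] := grow s e _ Ns e0; first by rewrite s1s.
    exists d => // t st ts2; have st' : s <= t by case/andP: st => /ltW.
    have h1 := H _ st ts2; have h2 := ler_wpM2l K0 (psi_mono _ _ st' (le_trans ts2 s2b)).
    lra.
  move=> /andP[s1s ss2] e10.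
  have [|d d0 H] := curve_continuous g_ac (e := e1 / (K + 1)).
    by rewrite divr_gt0 //; lra.
  exists d => // t /andP[dt ts] s1t.
  have h1 := lip _ _ s1t ts ss2.
  have h2 : D t s < e1 / (K + 1) by apply: H; lra.
  have h3 : K * D t s <= e1.
    have [t1 t2] : a <= t <= b /\ a <= s <= b by split; apply/andP; split; lra.
    have := dist_ge0 (kg t1) (kg t2).
    move: h2; rewrite ltr_pdivlMr; last by lra.
    nra.
  have h4 := ler_wpM2l K0 (psi_mono _ _ (ltW ts) (le_trans ss2 s2b)).
  have h5 : e * t <= e * s by rewrite ler_wpM2l // ltW.
  lra.
have /andP[p1 _] := psi_e s1 (le_trans s12 s2b); have /andP[_ p2] := psi_e s2 s2b.
have h1 := ler_wpM2l K0 p2; have h2 : 0 <= K * psi s1 by rewrite mulr_ge0.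
have : e * M = e' by rewrite /e divfK // gt_eqF.
rewrite /M; lra.
Qed.

Lemma coords_bound x : exists2 A, 1 <= A & forall c, c \in coords -> `|c x| <= A.
Proof.
exists (1 + `|x|) => [|c cc]; first by rewrite lerDl.
by have := coord_norm x cc; lra.
Qed.

Section AtVelocity.
Variables (s : R) (v : pt).
Hypothesis s_in : a < s < b.
Hypothesis v_vel : has_velocity a b g s v.
Let x := g s.
Let s_in' : a <= s <= b. Proof. by case/andP: s_in => h1 h2; rewrite !ltW. Qed.
Let kx : points k x := kg s_in'.

Lemma velocity_form y e : 0 < e -> exists2 d, 0 < d & forall t, a <= t <= b -> `|t - s| < d ->
  `|form k y (g t - x) - (t - s) * form k y v| <= e * `|t - s|.
Proof.
move=> e0; have [A A1 HA] := coords_bound y.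
have e0' : 0 < e / (3 * A) by rewrite divr_gt0 //; lra.
have [d d0 H] := velocity_eps v_vel e0'; exists d => // t tab td.
have := form_bound k HA (H t tab td); rewrite formDr formNr formZr -/x => h.
apply: le_trans h _; rewrite le_eqVlt; apply/orP; left; apply/eqP; field.
by apply: lt0r_neq0; lra.
Qed.

Lemma velocity_sqr e : 0 < e -> exists2 d, 0 < d & forall t, a <= t <= b -> `|t - s| < d ->
  `|form k (g t - x) (g t - x)| <= e * `|t - s|.
Proof.
move=> e0; have [A A1 HA] := coords_bound v.
have [d d0 H] := velocity_eps v_vel ltr01.
have B0 : 0 < 3 * (1 + A) ^+ 2 by rewrite mulr_gt0 // exprn_gt0 //; lra.
exists (Num.min d (e / (3 * (1 + A) ^+ 2))); first by rewrite lt_min d0 divr_gt0.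
move=> t tab; rewrite lt_min ltr_pdivlMr // => /andP[td te].
have h c : c \in coords -> `|c (g t - x)| <= (1 + A) * `|t - s|.
  move=> cc; have h1 := H t tab td c cc; have h2 := HA _ cc.
  have E : c (g t - x) = c (g t - g s - (t - s) *: v) + (t - s) * c v.
    by move: cc; rewrite !inE => /or3P[] /eqP ->; rewrite !coordE; ring.
  rewrite E; apply: le_trans (ler_normD _ _) _; rewrite normrM mulrDl.
  by rewrite lerD // mulrC ler_wpM2r.
apply: le_trans (form_bound k h h) _.
have := normr_ge0 (t - s); move: te; nra.
Qed.

Let small e : 0 < e -> exists t, [/\ a <= t <= b, 0 < t - s & t - s < e].
Proof.
move=> e0; case/andP: s_in => h1 h2.
exists (s + Num.min (b - s) (e / 2)); rewrite addrAC subrr add0r.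
have [h|h] := leP (b - s); split; try (apply/andP; split); lra.
Qed.

Let squeeze0 (r C : R) : (forall e, 0 < e -> `|r| <= C * e) -> r = 0.
Proof.
move=> H; apply/eqP; rewrite -normr_le0; apply/ler_addgt0Pr => e e0; rewrite add0r.
have C0 : 0 <= C by have := H 1 ltr01; rewrite mulr1; apply: le_trans.
have e0' : 0 < e / (C + 1) by rewrite divr_gt0 //; lra.
apply: le_trans (H _ e0') _; rewrite mulrA ler_pdivrMr; nra.
Qed.

(** On the two quadrics, the product of [x] with a chord from [x] is minus half the square of the
    chord, hence of second order in time. *)
Lemma velocity_tangent : tangent k x v.
Proof.
have H e : 0 < e -> (k <> Euclidean -> `|form k x v| <= 2 * e) /\ (k = Euclidean ->
  `|c0 v| <= 2 * e).
  move=> e0; have [d1 d10 H1] := velocity_form x e0; have [d2 d20 H2] := velocity_sqr e0.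
  have [d3 d30 H3] := velocity_eps v_vel e0.
  have [|t [tab t0]] := @small (Num.min d1 (Num.min d2 d3)); first by rewrite !lt_min d10 d20.
  rewrite !lt_min => /and3P[h1 h2 h3]; have n : `|t - s| = t - s by rewrite gtr0_norm.
  have {}H1 := H1 t tab; have {}H2 := H2 t tab; have {}H3 := H3 t tab.
  rewrite n in H1 H2 H3; have {}H1 := H1 h1; have {}H2 := H2 h2; have {}H3 := H3 h3.
  have kt := kg tab.
  split=> [kE|kE].
    have E : form k x (g t - x) = - (form k (g t - x) (g t - x) / 2).
      move: kx kt kE; rewrite -/x; case: (k) => //=.
      - by move=> xx tt _; rewrite !formE xx tt (formC _ (g t) x); lra.
      - by move=> [xx _] [tt _] _; rewrite !formE xx tt (formC _ (g t) x); lra.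
    have : (t - s) * `|form k x v| <= (t - s) * (2 * e); last by rewrite ler_pM2l.
    rewrite -{1}n -normrM; move: H1 H2; rewrite E.
    rewrite !ler_norml => /andP[? ?] /andP[? ?]; apply/andP; split; lra.
  have {}H3 := H3 _ (mem_head _ _); move: H3; rewrite !coordE.
  have [-> ->] : c0 (g t) = 1 /\ c0 (g s) = 1.
    by move: kx kt; rewrite kE.
  rewrite subrr sub0r normrN normrM n (mulrC e) ler_pM2l // => h; lra.
have [kE|kE] := pselect (k = Euclidean).
  by rewrite kE /=; apply: (@squeeze0 _ 2) => e /H[_]; exact.
have : form k x v = 0 by apply: (@squeeze0 _ 2) => e /H[+ _]; exact.
by case: (k) kE.
Qed.

Lemma velocity_tvec e : 0 < e -> exists2 d, 0 < d & forall t, a <= t <= b -> `|t - s| < d ->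
  `|form k v (tvec k x (g t)) - (t - s) * form k v v| <= e * `|t - s|.
Proof.
move=> /(velocity_form v)[d d0 H]; exists d => // t tab td.
by rewrite form_tvec; [exact: H|exact: velocity_tangent].
Qed.

(** To first order, a point of the curve just before [g s] is strictly behind it; this decides the
    side for the whole past by [half_space_past]. *)
Lemma velocity_past r : a <= r <= s -> form k v (tvec k x (g r)) <= 0.
Proof.
move=> ar; have tv := velocity_tangent.
have [v0|v0] := eqVneq v 0; first by rewrite v0 form0l.
have vv : 0 < form k v v.
  rewrite lt_neqAle (tangent_ge0 kx tv) andbT eq_sym; apply/eqP => vv.
  by move: v0; rewrite (tangent_eq0 kx tv vv) eqxx.
have [|d d0 H] := @velocity_tvec (form k v v / 2); first by rewrite divr_gt0.
pose r' := Num.max a (s - d / 2).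
have [h1 h2 h3] : [/\ a <= r', r' < s & s - r' < d].
  by case/andP: s_in => h1 h2; rewrite /r'; case: (leP a (s - d / 2)) => h; split; lra.
have r'ab : a <= r' <= b by apply/andP; split => //; case/andP: s_in => _ ?; lra.
apply: (half_space_past (P := [set g r | r in [set r | a <= r <= s]]) (p' := g r') kx tv).
- move=> L HL; have [|H' H1 H2] := g_G.2 s v _ v_vel v0 _ HL; first by rewrite in_itv.
  by exists H' => // _ [t ht <-]; exact: H2.
- by move=> _ [t /= /andP[t1 t2] <-]; apply: kg; rewrite t1; case/andP: s_in' => _; exact: le_trans.
- by exists r' => //=; rewrite h1 ltW.
- have := H r' r'ab; rewrite distrC gtr0_norm ?subr_gt0 // => /(_ h3).
  rewrite ler_norml => /andP[_]; nra.
- by exists r.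
Qed.

End AtVelocity.
End GCurve.

(** * Growth of the inscribed polygons *)

Section SelfExpanding.
Variables (R : realType) (k : surface) (a b : R) (g : R -> 'rV[R]_3).
Local Notation pt := 'rV[R]_3.
Implicit Types (x y z u v w : pt) (s t r e : R).
Hypothesis ab : a <= b.
Hypothesis g_G : G_curve k a b g.

Local Notation D := (fun s t : R => ds k (g s) (g t)).
Local Notation coords := [:: @c0 R; @c1 R; @c2 R].

Let g_ac : ac_curve k a b g := g_G.1.
Let kg s : a <= s <= b -> points k (g s) := curve_points g_ac (s := s).

Lemma vers_sub y p q : points k y -> points k p -> points k q ->
  vers k y q - vers k y p = form k (p - y + 2^-1 *: (q - p)) (q - p).
Proof.
move=> ky kp kq; rewrite !vers_form // !(form_subC k y).
have -> : q - y = (p - y) + (q - p) by rewrite [RHS]addrC addrA subrK.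
move: (p - y) (q - p) => A B; rewrite !formE (formC k B A); lra.
Qed.

Lemma curve_vers_lipschitz : exists2 K, 0 <= K & forall r s t,
  a <= r <= b -> a <= s -> s <= t -> t <= b ->
  `|vers k (g r) (g t) - vers k (g r) (g s)| <= K * D s t.
Proof.
have [B HB] := curve_bounded ab g_ac; have [K K0 HK] := curve_lipschitz ab g_ac.
have [B0 |B0] := leP 0 B; last first.
  have := HB a; rewrite lexx ab => /(_ isT); rewrite (curve_dist_refl g_ac) //; lra.
have aab : a <= a <= b by rewrite lexx ab.
have M s c : a <= s <= b -> c \in coords -> `|c (g s) - c (g a)| <= K * B.
  move=> sab cc; case/andP: (sab) => h1 h2.
  by apply: le_trans (HK c cc a s (lexx a) h1 h2) _; rewrite ler_wpM2l // HB.
have KB : 0 <= K * B by rewrite mulr_ge0.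
exists (3 * (3 * (K * B) * K)) => [|r s t rab h1 h2 h3]; first by rewrite !mulr_ge0.
have sab : a <= s <= b by rewrite h1 (le_trans h2).
have tab : a <= t <= b by rewrite h3 (le_trans h1).
rewrite vers_sub; [|exact: kg..].
have -> : 3 * (3 * (K * B) * K) * D s t = 3 * (3 * (K * B) * (K * D s t)) by ring.
have cB c x y : c \in coords -> c (x + y) = c x + c y.
  by rewrite !inE => /or3P[] /eqP ->; rewrite !coordE.
have cN c x : c \in coords -> c (- x) = - c x.
  by rewrite !inE => /or3P[] /eqP ->; rewrite !coordE.
have cZ c t' x : c \in coords -> c (t' *: x) = t' * c x.
  by rewrite !inE => /or3P[] /eqP ->; rewrite !coordE.
apply: form_bound => c cc; rewrite !(cB, cN, cZ) //; last exact: HK.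
have := M r c rab cc; have := M s c sab cc; have := M t c tab cc.
rewrite !ler_norml => /andP[? ?] /andP[? ?] /andP[? ?]; apply/andP; split; lra.
Qed.

(** Along the curve [vers k (g s0)] has as derivative the form of the chord from [g s0] with the
    velocity, nonnegative by [velocity_past]. This holds almost everywhere, and [ae_creeping]
    integrates it. *)
Lemma self_expanding s0 s1 s2 : a <= s0 -> s0 <= s1 -> s1 <= s2 -> s2 <= b ->
  D s0 s1 <= D s0 s2.
Proof.
move=> h0 h01 h12 h2.
have s0ab : a <= s0 <= b by apply/andP; split; lra.
have s1ab : a <= s1 <= b by apply/andP; split; lra.
have s2ab : a <= s2 <= b by apply/andP; split; lra.
have [e|ne] := eqVneq s0 s1.
  by rewrite -e (curve_dist_refl g_ac) //; [apply: dist_ge0; exact: kg|lra].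
have lt01 : s0 < s1 by rewrite lt_neqAle ne.
have [N N0 HN] := velocity_ae ab g_ac.
have [K K0 HK] := curve_vers_lipschitz.
apply: vers_le_dist; [exact: kg..|].
apply: (ae_creeping ab g_G (F := fun s => vers k (g s0) (g s)) N0 K0); rewrite ?h01 //.
- exact: le_trans h01.
- move=> s t h1 h3 h4; have := HK s0 s t s0ab.
  have -> : a <= s by lra. have -> : s <= t by lra. have -> : t <= b by lra.
  by move=> /(_ isT isT isT); rewrite ler_norml => /andP[]; lra.
move=> s e /andP[s1s ss2] Ns e0.
have s_in : a < s < b by apply/andP; split; lra.
have sab : a <= s <= b by apply/andP; split; lra.
have [v v_vel] := HN s s_in Ns.
have ha : 0 < e / 2 by rewrite divr_gt0.
have [d1 d10 H1] := velocity_form k v_vel (g s - g s0) ha.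
have [d2 d20 H2] := velocity_sqr k v_vel ha.
exists (Num.min d1 d2); first by rewrite lt_min d10.
move=> t /andP[st]; rewrite -ltrBlDl lt_min => /andP[t1 t2] ts2.
have tab : a <= t <= b by apply/andP; split; lra.
have n : `|t - s| = t - s by rewrite gtr0_norm // subr_gt0.
have := H1 t tab; have := H2 t tab; rewrite n => /(_ t2) h4 /(_ t1) h5.
have past : form k v (tvec k (g s) (g s0)) <= 0.
  by apply: (velocity_past g_G s_in v_vel); rewrite h0; lra.
rewrite (form_tvec _ (velocity_tangent g_G s_in v_vel)) in past.
have {}past : 0 <= form k (g s - g s0) v.
  by rewrite formC -opprB formNr -oppr_le0 opprK.
have E := vers_sub (kg s0ab) (kg sab) (kg tab); rewrite formDl formZl in E.
have : 0 <= (t - s) * form k (g s - g s0) v by rewrite mulr_ge0 // subr_ge0 ltW.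
move: h4 h5; rewrite !ler_norml => /andP[? ?] /andP[? ?]; lra.
Qed.

Hypothesis g_short : forall s t, a <= s <= b -> a <= t <= b -> short k (ds k (g s) (g t)).
Local Notation past s := [set g r | r in [set r | a <= r <= s]].

(** Of two past points, the older one is at least as far from [g t] as from the younger one, by
    [self_expanding]. *)
Lemma curve_newest s t : a <= s -> s <= t -> t <= b -> newest k (past s) (g t).
Proof.
move=> as_ st tb.
have i r : a <= r <= s -> a <= r <= b by case/andP=> h1 h2; apply/andP; split; lra.
have tab r : a <= r <= s -> a <= t <= b by case/andP=> h1 h2; apply/andP; split; lra.
split.
- by apply: kg; rewrite tb (le_trans as_).
- by move=> _ [r /= h <-]; apply: kg; exact: i.
- by move=> _ [r /= h <-]; apply: g_short; [exact: tab h|exact: i].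
- by move=> _ _ [r /= h <-] [r' /= h' <-]; apply: g_short; exact: i.
move=> _ _ [r /= h <-] [r' /= h' <-]; rewrite ![ds k (g t) _]distC.
case/andP: h => h1 h2; case/andP: h' => h3 h4.
have [rr'|/ltW rr'] := leP r r'; [left|right; rewrite (distC k (g r))];
  by apply: self_expanding => //; lra.
Qed.
End SelfExpanding.

(** * The length of the curve is bounded by the inscribed polygons *)

Section LengthBound.
Variables (R : realType) (k : surface) (a b : R) (g : R -> 'rV[R]_3).
Local Notation pt := 'rV[R]_3.
Implicit Types (x y z u v w : pt) (s t r e : R) (q : nat -> pt).
Hypothesis ab : a <= b.
Hypothesis g_G : G_curve k a b g.
Hypothesis g_short : forall s t, a <= s <= b -> a <= t <= b -> short k (ds k (g s) (g t)).

Local Notation D := (fun s t : R => ds k (g s) (g t)).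
Local Notation past s := [set g r | r in [set r | a <= r <= s]].

Let g_ac : ac_curve k a b g := g_G.1.
Let kg s : a <= s <= b -> points k (g s) := curve_points g_ac (s := s).

Lemma past_sub s t : s <= t -> past s `<=` past t.
Proof.
move=> st _ [r /= /andP[h1 h2] <-]; exists r => //=.
by rewrite h1 (le_trans h2).
Qed.

(** For a distance [h], half the squared chord equals [2 * sink k (h / 2) ^+ 2]; a zero ambient
    velocity thereby makes [h] small against the elapsed time. *)
Lemma stationary_dist s e : a < s < b -> has_velocity a b g s 0 -> 0 < e ->
  exists2 d : R, 0 < d & forall t, s < t < s + d -> t <= b -> D s t <= e * (t - s).
Proof.
move=> s_in v_vel e0; have sab : a <= s <= b by case/andP: s_in => ? ?; rewrite !ltW.
have [|d1 d10 H1] := velocity_eps v_vel (e := e / 4); first by rewrite divr_gt0.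
have [d2 d20 H2] := @first_order_reach R k 1 (introT andP (conj ltr01 (lexx 1))).
have [d3 d30 H3] := curve_continuous g_ac d20.
exists (Num.min d1 d3); first by rewrite lt_min d10.
move=> t /andP[st]; rewrite -ltrBlDl lt_min => /andP[t1 t3] tb.
have tab : a <= t <= b by rewrite tb; case/andP: sab => ? _; lra.
have n : `|t - s| = t - s by rewrite gtr0_norm // subr_gt0.
have h0 := dist_ge0 (kg sab) (kg tab).
have hd : ds k (g s) (g t) < d2 by apply: H3 => //; [case/andP: sab|exact: ltW].
have vE := versk_dist (kg sab) (kg tab); rewrite vers_form ?(form_subC k (g s)) in vE;
  [|exact: kg..].
have H c : c \in [:: @c0 R; @c1 R; @c2 R] -> `|c (g t - g s)| <= e / 4 * (t - s).
  by move=> cc; have := H1 t tab; rewrite n scaler0 subr0; apply.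
have := form_bound k H H; rewrite ler_norml => /andP[_].
have E : ds k (g s) (g t) = 2 * (ds k (g s) (g t) / 2) by field.
move: vE; rewrite {1}E versk_double => vE.
set h := ds k (g s) (g t) in h0 hd vE *.
have [h00|h00] := eqVneq h 0.
  by rewrite h00 => _; rewrite mulr_ge0 ?ltW // subr_gt0.
have [|_ h1 _] := H2 (h / 2); first by apply/andP; split; lra.
move=> h2; have T0 : 0 <= e * (t - s) by rewrite mulr_ge0 ?ltW // subr_gt0.
have {h2} : h ^+ 2 <= (e * (t - s)) ^+ 2.
  have h3 : (h / 4) ^+ 2 <= sink k (h / 2) ^+ 2 by rewrite ler_sqr ?nnegrE; lra.
  move: h2 h3 vE; set S := sink _ _ ^+ 2; set f := form _ _ _; rewrite !expr2.
  have -> : 3 * (e / 4 * (t - s) * (e / 4 * (t - s))) = 3 / 16 * (e * (t - s) * (e * (t - s))) by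
    field.
  have -> : h / 4 * (h / 4) = h * h / 16 by field.
  have := mulr_ge0 T0 T0.
  move: (h * h) (e * (t - s) * _) => hh T4 h7 h4 h5 h6; lra.
by rewrite ler_sqr.
Qed.

(** For [t] close to [s] the hypotheses of [polygon_growth] hold. It is applied after
    [insert_newest], with [g s] as the newest point of its own past, has made [g s] a vertex. *)
Lemma moving_growth s v (eps : R) : a < s < b -> has_velocity a b g s v -> v <> 0 ->
  0 < eps <= 1 ->
  exists2 d : R, 0 < d & forall t, s < t < s + d -> t <= b ->
    forall n q, spoly (past s) n q -> exists n' q', spoly (past t) n' q' /\
      plen k n q + (1 - 3 * eps) * D s t <= plen k n' q'.
Proof.
move=> s_in v_vel v0 /andP[eps0 eps1].
have sab : a <= s <= b by case/andP: s_in => ? ?; rewrite !ltW.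
have kx := kg sab; have tv := velocity_tangent g_G s_in v_vel.
have vv : 0 < form k v v.
  by rewrite lt_neqAle (tangent_ge0 kx tv) andbT eq_sym; apply/eqP => /(tangent_eq0 kx tv).
pose r := Num.sqrt (form k v v).
have r0 : 0 < r by rewrite sqrtr_gt0.
have r2 : r * r = form k v v by rewrite -expr2 sqr_sqrtr // ltW.
pose A := 1 + `|c0 (g s)|.
have A0 : 0 < A by rewrite /A; have := normr_ge0 (c0 (g s)); lra.
(* [form_bound] costs a factor [3 * A], and replacing [(t - s) * r] by the distance ([slow]) a
   factor 4; the resulting error is [eps] times the distance. *)
pose e1 := eps * r / (12 * A).
have e10 : 0 < e1 by rewrite /e1 divr_gt0 ?mulr_gt0.
have e1E : 12 * (A * e1) = eps * r by rewrite /e1; field; rewrite gt_eqF.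
have [d1 d10 H1] := velocity_eps v_vel e10.
have [d2 d20 H2] := velocity_tvec g_G s_in v_vel (divr_gt0 vv (ltr0n _ 2)).
have [|d3 d30 H3] := @first_order_reach R k eps; first by rewrite eps0.
have [d4 d40 H4] := sink_near0 R k.
have [|d5 d50 H5] := curve_continuous g_ac (e := Num.min d3 d4); first by rewrite lt_min d30.
exists (Num.min d1 (Num.min d2 d5)); first by rewrite !lt_min d10 d20.
move=> t /andP[st]; rewrite -ltrBlDl !lt_min => /and3P[t1 t2 t5] tb n q sq.
have tab : a <= t <= b by rewrite tb; case/andP: sab => ? _; lra.
have nt : `|t - s| = t - s by rewrite gtr0_norm // subr_gt0.
have kz := kg tab; have h0 := dist_ge0 kx kz.
have : ds k (g s) (g t) < Num.min d3 d4 by apply: H5 => //; [case/andP: sab|exact: ltW].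
rewrite lt_min => /andP[h3 h4].
have aS : a <= s by case/andP: sab.
have Xx := curve_newest ab g_G g_short aS (lexx s) (andP sab).2.
have Xz := curve_newest ab g_G g_short aS (ltW st) tb.
have Xs : past s (g s) by exists s => //=; rewrite aS lexx.
have XY := past_sub (ltW st).
have Yz : past t (g t) by exists t => //=; rewrite lexx andbT (le_trans aS) // ltW.
have {H2} fwd := H2 t tab; rewrite nt in fwd; have {}fwd := fwd t2.
have fwd1 : (t - s) * (r * r) / 2 <= form k v (tvec k (g s) (g t)).
  by rewrite r2; move: fwd; rewrite ler_norml => /andP[]; lra.
have ts0 : 0 < t - s by rewrite subr_gt0.
have forward : 0 < form k v (tvec k (g s) (g t)).
  by apply: lt_le_trans fwd1; rewrite divr_gt0 // !mulr_gt0.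
have xz : g s <> g t by move=> E; move: forward; rewrite -E tvecxx // form0r ltxx.
have hpos : 0 < ds k (g s) (g t) by exact: dist_gt0.
(* One factor 2 comes from [fwd1], the other from bounding [sink] of the distance by twice the
   distance. *)
have slow : (t - s) * r <= 4 * ds k (g s) (g t).
  have kv : unit_tangent k (g s) (r^-1 *: v).
    by split; [exact: tangentZ|rewrite formZl formZr -r2; field; rewrite gt_eqF].
  have := form_le_sink kx kz kv; rewrite formZl ler_norml => /andP[_ h6].
  have := H4 (ds k (g s) (g t)); rewrite (ger0_norm h0) => /(_ h4).
  rewrite ler_norml => /andP[_ h7].
  have : r^-1 * ((t - s) * (r * r) / 2) <= 2 * ds k (g s) (g t).
    by apply: le_trans h7; apply: le_trans h6; rewrite ler_wpM2l // invr_ge0 ltW.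
  have -> : r^-1 * ((t - s) * (r * r) / 2) = (t - s) * r / 2 by field; rewrite gt_eqF.
  lra.
have [|sk _ fo] := H3 (ds k (g s) (g t)); first by rewrite hpos.
have almost u : unit_tangent k (g s) u -> 0 <= form k u v ->
    - (eps * ds k (g s) (g t)) <= form k u (tvec k (g s) (g t)).
  move=> ku uv; rewrite form_tvec; last by case: ku.
  have H := H1 t tab; rewrite nt in H; have {}H := H t1.
  have := form_bound k (unit_tangent_bound kx ku) H.
  rewrite formDr formNr formZr -/A ler_norml => /andP[+ _].
  have p0 : 0 <= (t - s) * form k u v by rewrite mulr_ge0 // ltW.
  have p1 : eps * ((t - s) * r) <= eps * (4 * ds k (g s) (g t)) by rewrite ler_wpM2l // ltW.
  have p2 : 12 * (A * (e1 * (t - s))) = eps * ((t - s) * r).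
    by transitivity (12 * (A * e1) * (t - s)); [ring|rewrite e1E; ring].
  lra.
have [n' [q' [sq' q'0 le']]] := insert_newest Xx (@subset_refl _ (past s)) Xs sq.
have [||n'' [q'' [sq'' le'']]] := polygon_growth Xx Xz Xs XY Yz xz _ tv (ltW eps0) _ forward
  almost fo sk sq' q'0.
- move=> _ [r' /= /andP[h1 h2] <-]; apply: (self_expanding ab g_G) => //; exact: ltW.
- by move=> _ [r' /= h <-]; exact: (velocity_past g_G s_in v_vel).
by exists n'', q''; split => //; apply: le_trans le''; rewrite lerD2r.
Qed.

Lemma curve_growth s v (eps : R) e : a < s < b -> has_velocity a b g s v ->
  0 < eps <= 1 -> 0 < e ->
  exists2 d : R, 0 < d & forall t, s < t < s + d -> t <= b ->
    forall n q, spoly (past s) n q -> exists n' q', spoly (past t) n' q' /\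
      plen k n q + (1 - 3 * eps) * D s t <= plen k n' q' + e * (t - s).
Proof.
move=> s_in v_vel eps_in e0; have [v0|v0] := pselect (v = 0).
  rewrite v0 in v_vel; have [d d0 H] := stationary_dist s_in v_vel e0.
  exists d => // t st tb n q sq; exists n, q; have st' : s < t by case/andP: st.
  split; first by apply: spoly_sub sq; exact/past_sub/ltW.
  have := H t st tb; have : 0 <= ds k (g s) (g t).
    by apply: dist_ge0; apply: kg; case/andP: s_in => ? ?; apply/andP; split; lra.
  case/andP: eps_in; nra.
have [d d0 H] := moving_growth s_in v_vel v0 eps_in.
exists d => // t st tb n q sq; have [n' [q' [sq' h]]] := H t st tb n q sq.
exists n', q'; split=> //; apply: le_trans h _; rewrite lerDl mulr_ge0 ?ltW // subr_gt0.
by case/andP: st.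
Qed.

Section Sup.
Variable B : R.
Hypothesis bounded : forall n q, spoly (past b) n q -> plen k n q <= B.

Definition polygon_sup s : R :=
  sup [set l | exists n q, spoly (past s) n q /\ l = plen k n q].

Let sup_P s : a <= s <= b ->
  has_sup [set l | exists n q, spoly (past s) n q /\ l = plen k n q].
Proof.
move=> /andP[as_ sb]; split.
  have [|q sq _] := @spoly1 R (past s) (g a); first by exists a => //=; rewrite lexx.
  by exists (plen k 1 q), 1%N, q.
exists B => _ [n [q [sq ->]]]; apply: bounded.
by apply: spoly_sub sq; exact: past_sub.
Qed.

Let sup_ub s n q : a <= s <= b -> spoly (past s) n q -> plen k n q <= polygon_sup s.
Proof. by move=> sab sq; apply: (ub_le_sup (sup_P sab).2); exists n, q. Qed.

Let sup_le s C : a <= s <= b -> (forall n q, spoly (past s) n q -> plen k n q <= C) ->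
  polygon_sup s <= C.
Proof.
move=> sab H; apply: (ge_sup (sup_P sab).1) => _ [n [q [sq ->]]]; exact: H.
Qed.

(** [ae_creeping] is applied to [polygon_sup s - c * D r s] with [c = 1 - 3 * eps]: the supremum
    grows at rate [c] with respect to [D s u], which dominates the increment of [D r] by the
    triangle inequality. *)
Lemma polygon_sup_growth (eps : R) r t : 0 < eps <= 3^-1 -> a <= r -> r <= t -> t <= b ->
  (1 - 3 * eps) * D r t <= polygon_sup t - polygon_sup r.
Proof.
move=> eps_in ar rt tb.
have [N N0 HN] := velocity_ae ab g_ac.
(* The endpoint [a] joins the exceptional set because [velocity_ae] concerns interior points. *)
have N0' : (@lebesgue_measure R).-negligible (N `|` [set a]).
  by apply: negligibleU => //; apply/negligibleP => //; exact: lebesgue_measure_set1.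
pose c := 1 - 3 * eps.
have := ae_creeping ab g_G (F := fun s => polygon_sup s - c * D r s) (K := 2)
  N0' (ler0n _ _) ar rt tb.
rewrite (curve_dist_refl g_ac ar (le_trans rt tb)) mulr0 subr0 => H.
suff : polygon_sup r <= polygon_sup t - c * ds k (g r) (g t) by rewrite /c; lra.
have [e0 e1] := andP eps_in; have c0 : 0 <= c by rewrite /c; lra.
have c1 : c <= 1 by rewrite /c; lra.
have {}eps_in : 0 < eps <= 1 by rewrite e0; lra.
apply: H => [s u rs su ut|s e /andP[rs st] Ns e_gt0].
  have sab : a <= s <= b by apply/andP; split; lra.
  have uab : a <= u <= b by apply/andP; split; lra.
  have rab : a <= r <= b by apply/andP; split; lra.
  have h1 : polygon_sup s <= polygon_sup u.
    by apply: sup_le => // n q sq; apply: sup_ub => //; apply: spoly_sub sq; exact/past_sub/ltW.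
  have h2 := dist_triangle (kg rab) (kg sab) (kg uab).
  have h3 := dist_triangle (kg rab) (kg uab) (kg sab); rewrite (distC k (g u)) in h3.
  have h0 := dist_ge0 (kg sab) (kg uab).
  move: h1 h2 h3 h0; move: (polygon_sup s) (polygon_sup u) (ds k (g r) (g u)) (ds k (g r) (g s))
    (ds k (g s) (g u)) => p1 p2 d1 d2 d3 h1 h2 h3 h0.
  have : c * d1 <= c * (d2 + d3) by rewrite ler_wpM2l.
  have : c * d3 <= 1 * d3 by rewrite ler_wpM2r.
  lra.
have sab : a <= s <= b by apply/andP; split; lra.
have s_in : a < s < b.
  apply/andP; split; last lra.
  rewrite lt_neqAle eq_sym; case/andP: sab => -> _; rewrite andbT; apply/eqP => sa.
  by apply: Ns; right.
have [|v v_vel] := HN s s_in; first by move=> ?; apply: Ns; left.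
have [d d0 H] := curve_growth s_in v_vel eps_in e_gt0.
exists d => // u su ut.
have su' : s < u by case/andP: su.
have uab : a <= u <= b by apply/andP; split; lra.
have rab : a <= r <= b by apply/andP; split; lra.
have h2 := dist_triangle (kg rab) (kg sab) (kg uab).
have : polygon_sup s <= polygon_sup u + e * (u - s) - c * ds k (g s) (g u).
  apply: sup_le => // n q sq; have [n' [q' [sq' h]]] := H u su (le_trans ut tb) n q sq.
  by have := sup_ub uab sq'; rewrite /c; lra.
have c3 : c * ds k (g r) (g u) <= c * (ds k (g r) (g s) + ds k (g s) (g u)) by rewrite ler_wpM2l.
lra.
Qed.

Lemma polygon_sup_ge0 s : a <= s <= b -> 0 <= polygon_sup s.
Proof.
move=> sab; have [|q sq _] := @spoly1 R (past s) (g a).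
  by exists a => //=; rewrite lexx; case/andP: sab.
have <- : plen k 1 q = 0; last exact: sup_ub.
apply: plen1 sq => _ [r /= /andP[h1 h2] <-]; apply: kg; case/andP: sab => _ h3.
by rewrite h1 (le_trans h2).
Qed.

Lemma curve_length_le : (curve_length k a b g <= B%:E)%E.
Proof.
have aab : a <= a <= b by rewrite lexx.
have bab : a <= b <= b by rewrite lexx ab.
apply: ge_ereal_sup => _ [l hl <-]; rewrite lee_fin.
have sum_le (eps : R) r m : 0 < eps <= 3^-1 -> a <= r -> path <%R r m -> last r m = b ->
    (1 - 3 * eps) * \sum_(0 <= i < size m) dist k (g (nth b (r :: m) i)) (g (nth b (r :: m) i.+1))
    <= polygon_sup b - polygon_sup r.
  move=> he; elim: m r => [|t m IH] r ar /=.
    by move=> _ ->; rewrite big_nil mulr0 subrr.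
  move=> /andP[rt pm] lm; rewrite big_nat_recl //= mulrDr.
  have tb : t <= b.
    by have := @itv_partition_le _ _ t b m; rewrite /itv_partition lm eqxx; apply.
  have := IH t (le_trans ar (ltW rt)) pm lm.
  have := polygon_sup_growth he ar (ltW rt) tb; rewrite ds.unlock.
  lra.
case: hl => pl /eqP ll.
have supB : polygon_sup b <= B by apply: sup_le => //; exact: bounded.
have sup0 := polygon_sup_ge0 aab.
set S := \sum_(_ <= _ < _) _.
have H (eps : R) : 0 < eps <= 3^-1 -> (1 - 3 * eps) * S <= B.
  by move=> he; have := sum_le eps a l he (lexx _) pl ll; rewrite -/S; lra.
have [S0|S0] := leP S 0.
  apply: le_trans S0 _; apply: le_trans (polygon_sup_ge0 bab) supB.
apply/ler_addgt0Pr => e e0.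
have Se : 0 < S + e by rewrite addr_gt0.
(* For this [eps], [3 * eps * S] is [e * S / (S + e)], hence at most [e]. *)
have := H (e / (3 * (S + e))).
rewrite divr_gt0 ?mulr_gt0 //= ler_pdivrMr ?mulr_gt0 // mulrA mulVf // mul1r => /(_ _).
have -> : (1 - 3 * (e / (3 * (S + e)))) * S = S - S / (S + e) * e.
  by field; rewrite gt_eqF.
rewrite lerDr (ltW S0) => /(_ isT).
have : S / (S + e) <= 1 by rewrite ler_pdivrMr // mul1r; lra.
nra.
Qed.

End Sup.
End LengthBound.

(** * Pushing a polygon to the boundary *)

Section Exit.
Variables (R : realType) (k : surface).
Local Notation pt := 'rV[R]_3.
Implicit Types (x y z u v w p q : pt) (s t r e : R) (Q : set pt).

Lemma c0_continuous : continuous (@c0 R). Proof. exact: coord_continuous. Qed.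
Lemma c1_continuous : continuous (@c1 R). Proof. exact: coord_continuous. Qed.
Lemma c2_continuous : continuous (@c2 R). Proof. exact: coord_continuous. Qed.

Lemma vers_continuous y : continuous (vers k y).
Proof.
move=> z; have h0 := @c0_continuous z; have h1 := @c1_continuous z; have h2 := @c2_continuous z.
have M c (f : pt -> R) : {for z, continuous f} -> {for z, continuous (fun p => c * f p)}.
  by move=> hf; apply: continuousM; [exact: cst_continuous|exact: hf].
have S (f : pt -> R) (c : R) : {for z, continuous f} ->
  {for z, continuous (fun p => (c - f p) * (c - f p))}.
  by move=> hf; apply: continuousM; (apply: continuousB; [exact: cst_continuous|exact: hf]).
suff : {for z, continuous (vers k y)} by [].
case: k.
- have -> : vers Sphere y = fun p => 1 - (c0 y * c0 p + c1 y * c1 p + c2 y * c2 p) by [].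
  apply: continuousB; first exact: cst_continuous.
  by apply: continuousD; [apply: continuousD|]; exact: M.
- have -> : vers Euclidean y =
      (fun p => ((c1 y - c1 p) * (c1 y - c1 p) + (c2 y - c2 p) * (c2 y - c2 p)) / 2).
    by apply/funext => p; rewrite /vers /form !coordE.
  by apply: continuousM; [apply: continuousD; exact: S|exact: cst_continuous].
- have -> : vers Hyperbolic y = fun p => - (c1 y * c1 p + c2 y * c2 p - c0 y * c0 p) - 1 by [].
  apply: continuousB; last exact: cst_continuous.
  by apply: continuousN; apply: continuousB; [apply: continuousD|]; exact: M.
Qed.

Lemma closure_le (f : pt -> R) c Q : continuous f -> (forall p, Q p -> f p <= c) ->
  forall p, closure Q p -> f p <= c.
Proof.
move=> cf H p Qp; rewrite leNgt; apply/negP => cp.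
have /cvgrPdist_lt := cf p; move=> /(_ (f p - c)); rewrite subr_gt0 => /(_ cp) /Qp[q [/= /H h]].
by rewrite ltr_norml => /andP[_]; lra.
Qed.

Lemma geod_continuous x u : continuous (geod k x u).
Proof.
move=> t; apply: cvgD; apply: cvgZr_tmp; [exact: continuous_cosk|exact: continuous_sink].
Qed.

Section Ball.
Variables (Q : set pt) (y0 : pt) (B : R).
Hypotheses (ky0 : points k y0) (Qpts : Q `<=` points k).
Hypothesis Q_ball : forall p, Q p -> ds k y0 p <= B.
Hypotheses (B0 : 0 <= B) (B_short : short k B).

Let Z : set pt := points k `&` closure Q.

Let B_range : in_range k B.
Proof. by move=> kS; have := B_short kS; have := pi_gt0 R; lra. Qed.

Lemma closure_ball p : Z p -> ds k y0 p <= B.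
Proof.
move=> [kp Qp]; apply: (@le_versk R k); [exact: dist_range|exact: B0|].
rewrite versk_dist //; apply: (closure_le (@vers_continuous y0) _ Qp) => q Qq.
rewrite -versk_dist; [|by []|exact: Qpts].
by apply: versk_le (Q_ball Qq) B_range; apply: dist_ge0 => //; exact: Qpts.
Qed.

Lemma closure_diameter p q : Z p -> Z q -> ds k p q <= 2 * B.
Proof.
move=> Zp Zq; have := dist_triangle Zp.1 ky0 Zq.1; rewrite (distC k p y0).
by have := closure_ball Zp; have := closure_ball Zq; lra.
Qed.

Lemma closure_nonantipodal p q : Z p -> Z q -> nonantipodal k p q.
Proof. by move=> Zp Zq kS; have := closure_diameter Zp Zq; have := B_short kS; lra. Qed.

(** At a length beyond [2 * B] the geodesic is outside [Q]. The infimum [t] of the times from [x] on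
    at which it meets the closure of the complement is an exit time: between the two it runs in [Q],
    so that the exit point adheres to both [Q] and its complement. *)
Lemma first_exit A x : Z A -> Z x -> A <> x -> exists t,
  [/\ ds k A x <= t, k = Sphere -> t < pi, boundary k Q (geod k A (dir k A x) t) &
      forall s, ds k A x <= s <= t -> Z (geod k A (dir k A x) s)].
Proof.
move=> ZA Zx Ax; have [kA kx] := (ZA.1, Zx.1).
have nA := closure_nonantipodal ZA Zx.
have ku := dir_unit kA kx Ax nA; set y := geod k A (dir k A x); set r := ds k A x.
have r0 : 0 < r by exact: dist_gt0.
have yr : y r = x by exact: geod_dir.
have ky t : points k (y t) by exact: geod_points.
have r2B : r <= 2 * B by exact: closure_diameter.
have [T [rT T2B Tpi]] : exists T, [/\ r <= T, 2 * B < T & k = Sphere -> T < pi].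
  have [kS|kS] := pselect (k = Sphere); last by exists (2 * B + 1); split => //; lra.
  (* A length strictly between [2 * B] and pi, since [B < pi / 2]. *)
  exists (B + pi / 2); have := B_short kS; split=> // [||_]; lra.
pose E := [set t | r <= t <= T /\ closure (points k `\` Q) (y t)].
have ET : E T.
  split; first by rewrite rT lexx.
  apply: subset_closure; split; first exact: ky.
  move=> QyT; have := closure_diameter ZA (conj (ky T) (subset_closure QyT)).
  rewrite dist_geod; [lra|exact: kA|exact: ku|by apply: le_trans rT; exact: ltW|].
  by move=> kS; apply/ltW/Tpi.
have infE : has_inf E by split; [exists T|exists r => t [/andP[]]].
pose t := inf E.
have rt : r <= t by apply: lb_le_inf => [|s [/andP[]]]; first exact: infE.1.
have tT : t <= T by apply: ge_inf ET; exact: infE.2.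
have below s : r <= s -> s < t -> Q (y s).
  move=> rs st; apply: contrapT => nQ.
  have : t <= s; last by rewrite leNgt st.
  apply: ge_inf; first exact: infE.2.
  split; first by rewrite rs (le_trans (ltW st)).
  by apply: subset_closure; split.
have cy := @geod_continuous A (dir k A x) t.
have Qt : closure Q (y t).
  have [<-|rt'] := eqVneq r t; first by rewrite yr; exact: Zx.2.
  have {}rt' : r < t by rewrite lt_neqAle rt'.
  move=> U /cy /nbhs_ballP[d /= d0 HU].
  pose s := Num.max r (t - d / 2).
  have [rs st ds_] : [/\ r <= s, s < t & t - s < d].
    by rewrite /s; case: (leP r (t - d / 2)) => h; split; lra.
  exists (y s); split; first exact: below.
  by apply: HU; rewrite /ball /= gtr0_norm // subr_gt0.
exists t; split; first exact: rt.
- by move=> kS; apply: le_lt_trans tT (Tpi kS).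
- split; first by split; [exact: ky|exact: Qt].
  apply: closed_closure => U /cy /nbhs_ballP[d /= d0 HU].
  have [s [/andP[rs sT] Es] st] := inf_adherent d0 infE.
  have ts : t <= s by apply: ge_inf; [exact: infE.2|split; [rewrite rs|]].
  exists (y s); split; first exact: Es.
  by apply: HU; rewrite /ball /= distrC ger0_norm ?subr_ge0 // ltrBlDl.
- move=> s /andP[rs]; rewrite le_eqVlt => /predU1P[->|st]; first by split; [exact: ky|].
  by split; [exact: ky|apply: subset_closure; exact: below].
Qed.

End Ball.
End Exit.

(** * Sliding the vertices of a polygon to the boundary *)

Section PushStrict.
Variables (R : realType) (k : surface).
Local Notation pt := 'rV[R]_3.
Implicit Types (x y z u v w p : pt) (q : nat -> pt) (s t r e : R) (X : set pt).

Definition set_first y q : nat -> pt := fun i => if i is 0%N then y else q i.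
Definition drop_second y q : nat -> pt := fun i => if i is 0%N then y else q i.+1.

(* Moving [q 0] away from [q m.+2] keeps the polygon strict as long as it does not
   cross the line through [q 1] and [q 2]. *)
Lemma moved_strict X m q y (c d : R) : spoly X m.+3 q ->
  y = c *: q m.+2 + d *: q 0%N -> 0 < d -> 0 <= det3 y (q 1%N) (q 2) ->
  forall i j, (0 < i)%N -> (i < j)%N -> (j <= m.+2)%N -> (2 < j)%N \/ 0 < det3 y (q 1%N) (q 2) ->
    0 < det3 y (q i) (q j).
Proof.
move=> [_ _ sq] yE d0 f0.
have last_edge i : (0 < i)%N -> (i < m.+2)%N -> 0 < det3 y (q i) (q m.+2).
  move=> i0 im; have -> : det3 y (q i) (q m.+2) = d * det3 (q 0%N) (q i) (q m.+2).
    by rewrite yE det3_lin det3xyx mulr0 add0r.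
  by rewrite mulr_gt0 //; apply: sq.
have second j : (2 < j)%N \/ 0 < det3 y (q 1%N) (q 2) -> (1 < j)%N -> (j <= m.+2)%N ->
    0 < det3 y (q 1%N) (q j).
  move=> hj j1; rewrite leq_eqVlt => /predU1P[->|jm]; first exact: last_edge.
  move: j1; rewrite leq_eqVlt => /predU1P[E|j2].
    by rewrite -E in hj *; case: hj.
  have := plucker (q 1%N) y (q 2) (q j) (q m.+2).
  rewrite !(det3_swap12 y (q 1%N)).
  have h1 : 0 < det3 (q 1%N) (q j) (q m.+2) by apply: sq => //; exact: ltnW.
  have h2 : 0 < det3 (q 1%N) (q 2) (q m.+2) by apply: sq => //; exact: ltn_trans jm.
  have h3 : 0 < det3 (q 1%N) (q 2) (q j) by apply: sq => //; exact: ltnW.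
  have h4 : 0 < det3 y (q 1%N) (q m.+2) by exact: last_edge.
  move=> E; have : 0 < det3 y (q 1%N) (q j) * det3 (q 1%N) (q 2) (q m.+2);
    last by rewrite pmulr_lgt0.
  have := mulr_gt0 h4 h3; have := mulr_ge0 f0 (ltW h1); lra.
move=> i j i0 ij; rewrite leq_eqVlt => /predU1P[jE|jm] hj.
  by rewrite jE in ij *; exact: last_edge.
move: i0; rewrite leq_eqVlt => /predU1P[E|i1].
  by rewrite -E in ij *; apply: second => //; exact: ltnW.
have im : (i < m.+2)%N by exact: ltn_trans jm.
have := plucker (q i) y (q 1%N) (q j) (q m.+2).
have h0 : 0 <= det3 y (q 1%N) (q i).
  move: i1; rewrite leq_eqVlt => /predU1P[<-//|i2].
  by apply/ltW; apply: second; [left|exact: ltnW|exact: ltnW].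
have h1 : 0 < det3 (q i) (q j) (q m.+2) by apply: sq.
have h2 : 0 < det3 (q 1%N) (q i) (q m.+2) by apply: sq.
have h3 : 0 < det3 (q 1%N) (q i) (q j) by apply: sq => //; exact: ltnW.
have h4 := last_edge i (ltnW i1) im.
rewrite (det3_swap12 y (q i) (q j)) (det3_swap12 (q 1%N) (q i) (q m.+2)) (det3_swap12 y (q i) (q
  m.+2))
  (det3_swap12 (q 1%N) (q i) (q j)) (det3_cycle (q i) y (q 1%N)) => E.
have : 0 < det3 y (q i) (q j) * det3 (q 1%N) (q i) (q m.+2); last by rewrite pmulr_lgt0.
have := mulr_gt0 h4 h3; have := mulr_ge0 h0 (ltW h1); lra.
Qed.


Lemma plen_split m q : plen k m.+2 q =
  ds k (q 0%N) (q 1%N) + chain_length k q 1 m.+1 + ds k (q m.+1) (q 0%N).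
Proof. by rewrite /plen /chain_length /= big_ltn. Qed.

Lemma plen_set_first m q y : plen k m.+2 (set_first y q) =
  ds k y (q 1%N) + chain_length k q 1 m.+1 + ds k (q m.+1) y.
Proof.
rewrite plen_split /=; congr (_ + _ + _).
by apply: eq_big_nat => -[|i].
Qed.

Lemma plen_drop_second m q y : plen k m.+2 (drop_second y q) =
  ds k y (q 2) + chain_length k q 2 m.+2 + ds k (q m.+2) y.
Proof.
rewrite plen_split /=; congr (_ + _ + _).
by rewrite /chain_length [RHS]big_add1 /=; apply: eq_big_nat => -[|i].
Qed.

Section Ball.
Variables (Q : set pt) (y0 : pt) (B : R).
Hypotheses (ky0 : points k y0) (Qpts : Q `<=` points k).
Hypothesis Q_ball : forall p, Q p -> ds k y0 p <= B.
Hypotheses (B0 : 0 <= B) (B_short : short k B).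

Local Notation Z := (points k `&` closure Q).
Let nonanti p p' := @closure_nonantipodal R k Q y0 B ky0 Qpts Q_ball B0 B_short p p'.

(** The vertex [q 0] slides along the ray from its predecessor [A]; by the triangle inequality the
    sum of its two edges does not decrease. If it meets the line through [q 1] and [q 2], then [q 1]
    lies between it and [q 2] and is dropped without loss; otherwise it arrives at the boundary. *)
Lemma push_first m q : spoly Z m.+3 q ->
  (exists q', spoly Z m.+2 q' /\ plen k m.+3 q <= plen k m.+2 q') \/
  exists y, [/\ boundary k Q y, spoly Z m.+3 (set_first y q) &
                plen k m.+3 q <= plen k m.+3 (set_first y q)].
Proof.
move=> sq_; have [_ Zq sq] := sq_.
set x := q 0%N; set A := q m.+2.
have ZA : Z A by apply: Zq.
have Zx : Z x by apply: Zq.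
have Z1 : Z (q 1%N) by apply: Zq.
have Z2 : Z (q 2) by apply: Zq.
have Ax : A <> x.
  by move=> E; have := sq 0%N 1%N m.+2 isT isT (ltnSn _); rewrite -/A E det3xyx ltxx.
have [t [rt tpi bt Zy]] := first_exit ky0 Qpts Q_ball B0 B_short ZA Zx Ax.
have [kA kx] := (ZA.1, Zx.1); have nA := nonanti ZA Zx.
have ku := dir_unit kA kx Ax nA.
set r := ds k A x in rt Zy *; set y := geod k A (dir k A x) in bt Zy.
have r0 : 0 < r by exact: dist_gt0.
have yr : y r = x by exact: geod_dir.
have rng s : s <= t -> in_range k s.
  by move=> st kS; apply: le_trans st _; exact/ltW/tpi.
have sr0 : 0 < sink k r by apply: sink_gt0 => // kS; exact: le_lt_trans (tpi kS).
have yE s : exists2 c, y s = c *: A + (sink k s / sink k r) *: x & True.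
  by exists (sink k (r - s) / sink k r) => //; exact: geod_dir_combination.
have coef s : r <= s <= t -> 0 < sink k s / sink k r.
  move=> /andP[rs st]; rewrite divr_gt0 // sink_gt0 ?(lt_le_trans r0) // => kS.
  exact: le_lt_trans (tpi kS).
have dAy s : r <= s <= t -> ds k A (y s) = s.
  move=> /andP[rs st]; rewrite dist_geod //; last exact: rng.
  by apply: le_trans rs; exact: ltW.
have dxy s : r <= s <= t -> ds k x (y s) = s - r.
  move=> /andP[rs st]; rewrite -yr dist_geod2 // distrC ger0_norm ?subr_ge0 //.
  by apply: rng; lra.
have longer s p : r <= s <= t -> points k p ->
    ds k x p + ds k A x <= ds k (y s) p + ds k A (y s).
  move=> rst kp; have := dist_triangle kx (Zy s rst).1 kp.
  by rewrite dxy // dAy // -/r; lra.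
pose f s := det3 (y s) (q 1%N) (q 2).
have fE s : f s = cosk k s * det3 A (q 1%N) (q 2) + sink k s * det3 (dir k A x) (q 1%N) (q 2).
  by rewrite /f /y /geod det3_lin.
have fr : 0 < f r by rewrite /f yr; apply: sq.
have cf : continuous f.
  move=> s; have -> : f = fun s => cosk k s * det3 A (q 1%N) (q 2) +
    sink k s * det3 (dir k A x) (q 1%N) (q 2) by apply/funext.
  have M (h : R -> R) (c : R) : continuous h -> {for s, continuous (fun s => h s * c)}.
    by move=> ch; apply: continuousM; [exact: ch|exact: cst_continuous].
  suff H : {for s, continuous (fun s => cosk k s * det3 A (q 1%N) (q 2) +
    sink k s * det3 (dir k A x) (q 1%N) (q 2))} by [].
  by apply: continuousD; apply: M; [exact: continuous_cosk|exact: continuous_sink].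
have [ft|ft] := ltP 0 (f t).
  right; exists (y t); have tt : r <= t <= t by rewrite rt lexx.
  have [c yc _] := yE t; split=> //.
    split=> // [[|i] /= im|[|i] [|j] [|l] //= ij jl lm].
    - exact: Zy.
    - exact: Zq.
    - by apply: (moved_strict sq_ yc (coef _ tt) (ltW ft)) => //; right.
    - exact: sq.
  rewrite plen_split plen_set_first; have := longer t (q 1%N) tt Z1.1; rewrite -/x -/A; lra.
left.
have [s srt fs] : exists2 s, s \in `[r, t] & f s = 0.
  apply: IVT => //; first exact/continuous_subspaceT/cf.
  by rewrite ge_min le_max ft (ltW fr) orbT.
rewrite in_itv /= in srt; have [c yc _] := yE s.
(* In a triangle [A] is [q 2], and the ray from [q 2] through [q 0] does not return to the line
   through [q 1] and [q 2]. *)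
have m0 : (0 < m)%N.
  rewrite lt0n; apply/eqP => m0; have AE : A = q 2 by rewrite /A m0.
  move: fs; rewrite /f -AE yc det3_lin det3xyx mulr0 add0r => /eqP.
  by rewrite gt_eqF // mulr_gt0 ?coef // /x AE; apply: sq; rewrite // m0.
have fs0 : 0 <= det3 (y s) (q 1%N) (q 2) by rewrite -[det3 _ _ _]/(f s) fs.
have strict i j : (0 < i)%N -> (i < j)%N -> (2 < j)%N -> (j <= m.+2)%N ->
  0 < det3 (y s) (q i) (q j).
  by move=> i0 ij j2 jm; apply: (moved_strict sq_ yc (coef _ srt) fs0) => //; left.
exists (drop_second (y s) q); split.
  split=> // [[|i] /= im|[|i] [|j] [|l] //= ij jl lm].
  - exact: Zy.
  - exact: Zq.
  - by apply: strict => //; rewrite ltnS; exact: leq_ltn_trans jl.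
  - exact: sq.
rewrite plen_split plen_drop_second (_ : chain_length k q 1 m.+2 = ds k (q 1%N) (q 2) +
  chain_length k q 2 m.+2); last first.
  by rewrite /chain_length big_ltn.
have h12A : 0 < det3 (q 1%N) (q 2) A by apply: sq.
have hy2A : 0 < det3 (y s) (q 2) A by apply: strict.
have hy1A : 0 < det3 (y s) (q 1%N) A by apply: strict.
(* Since [f s = 0], the term in [A] disappears from [cramer3], which leaves [q 1] as a positive
   combination of its two neighbours. *)
have q1E : q 1%N = (det3 (q 1%N) (q 2) A / det3 (y s) (q 2) A) *: y s
    + (det3 (y s) (q 1%N) A / det3 (y s) (q 2) A) *: q 2.
  have := cramer3 (y s) (q 1%N) (q 2) A; rewrite -[det3 (y s) (q 1%N) (q 2)]/(f s) fs scale0r subr0.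
  move=> E; have h0 : det3 (y s) (q 2) A != 0 by rewrite gt_eqF.
  apply: (scalerI h0); rewrite scalerDr !scalerA !(mulrC (det3 (y s) (q 2) A)) !divfK //.
  by apply/eqP; rewrite eq_sym -subr_eq0 addrAC E.
have := dist_between (Zy s srt).1 Z2.1 Z1.1 (nonanti Z1 (Zy s srt)) (nonanti Z1 Z2) q1E
  (divr_gt0 h12A hy2A) (divr_gt0 hy1A hy2A).
have := longer s (q 1%N) srt Z1.1; rewrite -/x -/A; lra.
Qed.

Lemma push_first2 q : spoly Z 2 q -> q 0%N <> q 1%N ->
  exists y, [/\ boundary k Q y, spoly Z 2 (set_first y q) & plen k 2 q <= plen k 2 (set_first y q)].
Proof.
move=> [_ Zq _] ne.
have [ZA Zx] : Z (q 1%N) /\ Z (q 0%N) by split; apply: Zq.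
have ne' : q 1%N <> q 0%N by move=> E; apply: ne.
have [t [rt tpi bt Zy]] := first_exit ky0 Qpts Q_ball B0 B_short ZA Zx ne'.
have ku := dir_unit ZA.1 Zx.1 ne' (nonanti ZA Zx).
exists (geod k (q 1%N) (dir k (q 1%N) (q 0%N)) t); split; first exact: bt.
  split; first by [].
    move=> [_|[_|i]].
    - by apply: Zy; rewrite rt lexx.
    - exact: ZA.
    - move=> h; by exfalso.
  by move=> [|[|i]] [|[|j]] [|[|l]].
rewrite !plen2 /= ler_pM2l // (distC k _ (q 1%N)) [leRHS]distC dist_geod //.
- exact: ZA.1.
- by apply: le_trans rt; apply: dist_ge0; [exact: ZA.1|exact: Zx.1].
- by move=> kS; exact/ltW/tpi.
Qed.

(** Double induction, on the number of vertices and on the number [j] of vertices at the end of the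
    list that may still be off the boundary. The first alternative covers polygons reduced to a
    point, where no edge gives a direction for pushing. *)
Lemma push_to_boundary n q : spoly Z n q ->
  plen k n q <= 0 \/ exists n' q', spoly (boundary k Q) n' q' /\ plen k n q <= plen k n' q'.
Proof.
elim/ltn_ind: n q => n IHn.
suff H j q : (j <= n)%N -> spoly Z n q -> (forall i, (i < n - j)%N -> boundary k Q (q i)) ->
    plen k n q <= 0 \/ exists n' q', spoly (boundary k Q) n' q' /\ plen k n q <= plen k n' q'.
  by move=> q sq; apply: (H n q) => // i; rewrite subnn.
elim: j q => [|j IHj] q jn sq bq.
  by right; exists n, q; case: sq => n0 _ dq; split=> //; split=> // i; rewrite -{1}(subn0 n);
    exact: bq.
(* The first vertex that may be off the boundary comes to index 0, where it can be pushed; a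
   rotation by [j.+1] then restores the order. *)
have [q1 [sq1 <-] q1E] := rotate k (n - j.+1) sq.
have push y : boundary k Q y -> spoly Z n (set_first y q1) ->
  plen k n q1 <= plen k n (set_first y q1) ->
    plen k n q1 <= 0 \/ exists n' q', spoly (boundary k Q) n' q' /\ plen k n q1 <= plen k n' q'.
  move=> by_ sq2 le2; have [q3 [sq3 e3] q3E] := rotate k j.+1 sq2.
  have [|h|[n' [q' [sq' h]]]] := IHj q3 (ltnW jn) sq3.
  - move=> i ij; have n0 : (0 < n)%N by apply: leq_ltn_trans jn.
    rewrite q3E; last by apply: leq_trans ij _; rewrite leq_subr.
    have [e|ltn] : (j.+1 + i)%N = n \/ (j.+1 + i < n)%N.
      move: ij; rewrite ltn_subRL => ij; move: (ij); rewrite leq_eqVlt => /predU1P[<-|h];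
        [left|right] => //.
    - by rewrite e modnn.
    rewrite modn_small //= q1E //.
    have -> : ((n - j.+1) + (j + i).+1 = i + n)%N.
      by rewrite -addSn addnA subnK // addnC.
    have i_n : (i < n)%N by apply: leq_ltn_trans ltn; rewrite leq_addl.
    by rewrite modnDr modn_small //; apply: bq; rewrite ltn_subRL.
  - by left; apply: le_trans le2 _; rewrite -e3.
  - by right; exists n', q'; split => //; apply: le_trans le2 _; rewrite -e3.
case: n => [|[|[|m]]] in IHn IHj jn sq bq q1 sq1 q1E push *.
- by case: sq.
- by left; rewrite (plen1 _ sq1) // => x [].
- have [E|ne] := pselect (q1 0%N = q1 1%N).
    left; rewrite plen2 E distxx ?mulr0 //.
    by case: sq1 => _ /(_ 1%N isT)[].
  by have [y [h1 h2 h3]] := push_first2 sq1 ne; exact: push h3.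
- have [[q' [sq' h]]|[y [h1 h2 h3]]] := push_first sq1; last exact: push h3.
  have [h'|[n' [q'' [sq'' h']]]] := IHn m.+2 (ltnSn _) q' sq'.
    by left; exact: le_trans h'.
  by right; exists n', q''; split=> //; exact: le_trans h'.
Qed.
End Ball.
End PushStrict.

(** * Convexity of balls *)

Section BallConvex.
Variables (R : realType) (k : surface).
Local Notation pt := 'rV[R]_3.
Implicit Types (x y z u v w p q : pt) (s t r e : R) (c : R -> pt).

Section Segment.
Variables (x y : pt).
Hypotheses (kx : points k x) (ky : points k y) (nxy : nonantipodal k x y).

Definition between z : Prop := points k z /\ ds k x z + ds k z y = ds k x y.

Let d := ds k x y.
Let d0 : 0 <= d. Proof. exact: dist_ge0. Qed.

(** The constant path is treated apart because [dir k x x] is not a unit vector. *)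
Definition geodesic_path t : pt := if x == y then x else geod k x (dir k x y) (d * t).

Lemma geodesic_path_points t : points k (geodesic_path t).
Proof.
rewrite /geodesic_path; case: eqP => [//|ne].
by apply: geod_points => //; exact: dir_unit.
Qed.

Lemma geodesic_path_dist s t : 0 <= s <= 1 -> 0 <= t <= 1 -> s <= t ->
  ds k (geodesic_path s) (geodesic_path t) = d * (t - s).
Proof.
move=> hs ht st; rewrite /geodesic_path; case: eqP => [e|ne].
  by rewrite distxx // /d -e distxx // mul0r.
have E : `|d * s - d * t| = d * (t - s).
  by rewrite -mulrBr normrM (ger0_norm d0) distrC ger0_norm // subr_ge0.
rewrite dist_geod2 //; first exact: dir_unit.
rewrite E => kS; have := nxy kS; rewrite -/d.
case/andP: hs => ? ?; case/andP: ht => ? ?; have := d0; nra.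
Qed.

Lemma geodesic_path0 : geodesic_path 0 = x.
Proof. by rewrite /geodesic_path mulr0 geod0 if_same. Qed.

Lemma geodesic_path1 : geodesic_path 1 = y.
Proof. by rewrite /geodesic_path mulr1; case: eqP => [//|ne]; exact: geod_dir. Qed.

Lemma geodesic_path_continuous : continuous_curve k 0 1 geodesic_path.
Proof.
split=> [s _|]; first exact: geodesic_path_points.
apply: continuous_subspaceT => t; rewrite /geodesic_path.
case: eqP => [e|ne]; first exact: cst_continuous.
apply: (@continuous_comp _ _ _ (fun t => d * t) (geod k x (dir k x y))).
  exact: mulrl_continuous.
exact: geod_continuous.
Qed.

Lemma geodesic_path_length : curve_length k 0 1 geodesic_path = d%:E.
Proof.
have sum_eq r m : 0 <= r -> path <%R r m -> last r m = 1 ->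
    \sum_(0 <= i < size m) dist k (geodesic_path (nth 1 (r :: m) i)) (geodesic_path (nth 1 (r ::
      m) i.+1))
    = d * (1 - r).
  elim: m r => [|t m IH] r r0 /=; first by move=> _ ->; rewrite big_nil subrr mulr0.
  move=> /andP[rt pm] lm; rewrite big_nat_recl //=.
  have t1 : t <= 1.
    by have := @itv_partition_le _ _ t 1 m; rewrite /itv_partition lm eqxx; apply.
  have t0 := le_trans r0 (ltW rt).
  have E : ds k (geodesic_path r) (geodesic_path t) = d * (t - r).
    by apply: geodesic_path_dist; rewrite ?r0 ?t0 ?t1 ?(ltW rt) // (le_trans (ltW rt)).
  by rewrite ds.unlock in E; rewrite IH // E -mulrDr; congr (_ * _); ring.
apply/le_anti/andP; split.
  apply: ge_ereal_sup => _ [m [pm /eqP lm] <-].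
  by rewrite sum_eq // subr0 mulr1.
apply: ereal_sup_ubound; exists [:: 1]; first exact: itv_partition1.
by rewrite sum_eq ?subr0 ?mulr1 //= ltr01.
Qed.

Lemma between_dist_inj z z' : between z -> between z' -> ds k x z = ds k x z' -> z = z'.
Proof.
move=> [kz bz] [kz' bz'] e; have [xy|ne] := pselect (x = y).
  have x_of p : points k p -> ds k x p + ds k p y = ds k x y -> p = x.
    move=> kp; rewrite -xy distxx // (distC k p) => h.
    have := dist_ge0 kx kp => h'; apply/esym/(dist0_eq kx kp); lra.
  by rewrite (x_of z) // (x_of z').
by rewrite (segment_geod kx ky kz ne nxy bz) (segment_geod kx ky kz' ne nxy bz') e.
Qed.

(** The partition at a single time [t] shows that [c t] gives equality in the triangle inequality.
    Conversely, a point of [between] is determined by its distance to [x], and the intermediate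
    value theorem for [vers k x] along [c] attains every such distance. *)
Lemma short_curve_image c : continuous_curve k 0 1 c -> c 0 = x -> c 1 = y ->
  (curve_length k 0 1 c <= d%:E)%E -> c @` `[0, 1] = between.
Proof.
move=> [kc cc] c0 c1 lc.
have kc' t : 0 <= t <= 1 -> points k (c t) by move=> h; apply: kc; rewrite in_itv.
have sub t : 0 <= t <= 1 -> between (c t).
  move=> h; split; first exact: kc'; apply/le_anti; rewrite (dist_triangle kx (kc' t h) ky) andbT.
  have [t0|t0] := eqVneq t 0; first by rewrite t0 c0 distxx // add0r.
  have [t1|t1] := eqVneq t 1; first by rewrite t1 c1 distxx // addr0.
  have : ((ds k x (c t) + ds k (c t) y)%:E <= curve_length k 0 1 c)%E.
    apply: ereal_sup_ubound; exists [:: t; 1].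
      split; rewrite //= !lt_neqAle eq_sym t0 t1 /=; case/andP: h => -> ->; by [].
    by rewrite big_nat_recl //= big_nat1 /= c0 c1 ds.unlock.
  by move=> h'; have := le_trans h' lc; rewrite lee_fin.
apply/seteqP; split=> [_ [t /= + <-]|z bz]; first by rewrite in_itv; exact: sub.
have [kz ez] := bz.
have cv : {within `[0, 1], continuous (vers k x \o c)}.
  by apply: within_continuous_comp cc => p _; exact: vers_continuous.
have zd : ds k x z <= d by have := dist_ge0 kz ky; rewrite /d -ez; lra.
have [t t01 et] : exists2 t, t \in `[0, 1] & vers k x (c t) = vers k x z.
  apply: (IVT ler01 cv); rewrite /= c0 c1 (vers_xx kx) ge_min le_max; apply/andP; split.
    apply/orP; left; rewrite -(versk_dist kx kz) -(versk0 R k).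
    by apply: versk_le => //; [exact: dist_ge0|exact: dist_range].
  by apply/orP; right; apply: dist_le_vers.
exists t => //; rewrite in_itv /= in t01; apply: between_dist_inj => //; first exact: sub.
by apply/le_anti/andP; split; apply: vers_le_dist => //; rewrite ?et //; exact: kc'.
Qed.

Lemma segmentE A : segment k x y A <-> A = between.
Proof.
have H : geodesic_path @` `[0, 1] = between.
  apply: short_curve_image; [exact: geodesic_path_continuous|exact: geodesic_path0|
    exact: geodesic_path1|by rewrite geodesic_path_length].
split=> [[c [cc c0 c1 -> cmin]]|->].
  apply: short_curve_image => //; rewrite -geodesic_path_length; apply: cmin;
    [exact: geodesic_path_continuous|exact: geodesic_path0|exact: geodesic_path1].
exists geodesic_path; split; [exact: geodesic_path_continuous|exact: geodesic_path0|
  exact: geodesic_path1|by rewrite H|].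
move=> c' _ c0 c1; rewrite geodesic_path_length; apply: ereal_sup_ubound.
exists [:: 1]; first exact: itv_partition1.
by rewrite big_nat1 /= c0 c1 /d ds.unlock.
Qed.

End Segment.

(** The point [z] is a combination of [x] and [y] with nonnegative coefficients [al] and [be]. Their
    sum is at least 1 on the sphere, where [z] has to have a large cosine with [y0] and [cos B] is
    nonnegative; it is at most 1 in the hyperbolic case, where [cosd] has to stay small. In the
    plane it is 1, and the square is convex. *)
Lemma ball_between y0 B x y z : points k y0 -> points k x -> points k y -> 0 <= B ->
  short k B -> nonantipodal k x y -> ds k y0 x <= B -> ds k y0 y <= B -> between x y z ->
  ds k y0 z <= B.
Proof.
move=> k0 kx ky B0 sB nxy hx hy [kz ez].
have [xy|ne] := pselect (x = y).
  suff -> : z = x by [].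
  apply: (@between_dist_inj x y) => //.
  - by split => //; rewrite distxx // add0r.
  - by have := dist_ge0 kx kz; have := dist_ge0 kz ky; rewrite distxx // -xy distxx // in ez *; lra.
have rB : in_range k B by move=> kS; have := sB kS; have := pi_gt0 R; lra.
have vB p : points k p -> ds k y0 p <= B -> vers k y0 p <= versk k B.
  by move=> kp hp; rewrite -versk_dist //; apply: versk_le => //; exact: dist_ge0.
have {}hx := vB x kx hx; have {}hy := vB y ky hy.
apply: (@le_versk R k) => //; first exact: dist_range.
rewrite versk_dist //.
have d0 : 0 < ds k x y by exact: dist_gt0.
have s0 := sink_dist_gt0 kx ky ne nxy.
set t := ds k x z in ez; have t0 : 0 <= t by exact: dist_ge0.
have td : t <= ds k x y by have := dist_ge0 kz ky; lra.
have zE := segment_geod kx ky kz ne nxy ez; rewrite -/t geod_dir_combination // in zE.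
set d := ds k x y in d0 s0 td zE.
have dr : in_range k d by exact: dist_range.
have a0 : 0 <= sink k (d - t).
  by apply: sink_ge0; [lra|move=> kS; have := dr kS; lra].
have b0 : 0 <= sink k t by apply: sink_ge0 => // kS; have := dr kS; lra.
have sE : sink k d = sink k (d - t) * cosk k t + cosk k (d - t) * sink k t.
  by rewrite -sinkD subrK.
have := (divr_ge0 a0 (ltW s0)); have := (divr_ge0 b0 (ltW s0)).
have abE : sink k (d - t) / sink k d + sink k t / sink k d = (sink k (d - t) + sink k t) / sink k d.
  by rewrite mulrDl.
move: zE abE; move: (sink k (d - t) / _) (sink k t / _) => al be -> abE be0 al0.
clear ez kz t0 td d0.
case: k k0 kx ky sB rB hx hy s0 a0 b0 sE abE => k0 kx ky sB rB hx hy s0 a0 b0 sE abE.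
- have cB : 0 <= cosk Sphere B by apply: cosk_ge0 => _; have := sB erefl; have := pi_gt0 R; lra.
  have ab1 : 1 <= al + be.
    rewrite abE ler_pdivlMr // mul1r sE !coskS lerD //.
      by have := cos_le1 t; nra.
    by have := cos_le1 (d - t); nra.
  move: hx hy; rewrite verskS /vers formDr !formZr; nra.
- move: hx hy; rewrite verskE /vers.
  have ab1 : al + be = 1.
    rewrite abE !sinkE subrK divff //; move: s0; rewrite sinkE => s0; exact: lt0r_neq0.
  have -> : y0 - (al *: x + be *: y) = al *: (y0 - x) + be *: (y0 - y).
    have -> : al = 1 - be by lra.
    by apply: row3P; rewrite !coordE; ring.
  rewrite /form !coordE; move: (c1 y0 - c1 x) (c2 y0 - c2 x) (c1 y0 - c1 y) (c2 y0 - c2 y) => X1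
    X2 Y1 Y2.
  have -> : be = 1 - al by lra.
  have al1 : al <= 1 by lra.
  move: (B ^+ 2) => B2; have h1 := sqr_ge0 (X1 - Y1); have h2 := sqr_ge0 (X2 - Y2).
  have h3 : 0 <= al * (1 - al) * ((X1 - Y1) ^+ 2 + (X2 - Y2) ^+ 2).
    by apply: mulr_ge0; [apply: mulr_ge0; rewrite ?subr_ge0|exact: addr_ge0].
  move=> hx hy.
  have := ler_wpM2l al0 hx; have : (1 - al) * ((Y1 * Y1 + Y2 * Y2) / 2) <= (1 - al) * (B2 / 2).
    by rewrite ler_wpM2l // subr_ge0.
  move: h3; rewrite !expr2; lra.
- have cB := coskH_ge1 B.
  have ab1 : al + be <= 1.
    rewrite abE ler_pdivrMr // mul1r sE lerD //.
      by have := coskH_ge1 t; nra.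
    by have := coskH_ge1 (d - t); nra.
  move: hx hy; rewrite verskH /vers formDr !formZr; nra.
Qed.

Lemma ball_convex y0 B : points k y0 -> 0 <= B -> short k B ->
  convex k [set p | points k p /\ ds k y0 p <= B].
Proof.
move=> k0 B0 sB; split=> [p []//|x y [kx hx] [ky hy]].
have nxy : nonantipodal k x y.
  move=> kS; have := dist_triangle kx k0 ky; rewrite (distC k x y0).
  by have := sB kS; lra.
split=> [|A /(segmentE kx ky nxy) -> z bz].
  exists (between x y); split; first exact/segmentE.
  by move=> A /(segmentE kx ky nxy) ->.
split; first by case: bz.
exact: (ball_between k0 kx ky).
Qed.

End BallConvex.

(** * Comparison with the perimeter, and the theorem *)

Section Perimeter.
Variables (R : realType) (k : surface).
Local Notation pt := 'rV[R]_3.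
Implicit Types (Q : set pt) (q : nat -> pt).

Lemma perimeter_ge0 Q : (0 <= perimeter k Q)%E.
Proof.
apply: ereal_sup_ubound; exists 0%N, (fun=> 0); split; last first.
  by rewrite /closed_polygon_length big_ord0.
by split; case.
Qed.

Lemma plen_le_perimeter Q n q : spoly (boundary k Q) n q -> ((plen k n q)%:E <= perimeter k Q)%E.
Proof.
case: n => [[]//|n] [_ bq dq]; apply: ereal_sup_ubound; exists n.+1, (fun i => q i); split.
  split=> [i|i j l ij jl]; first exact: bq.
  by rewrite orientationE; exact: dq.
congr EFin; rewrite /closed_polygon_length big_ord_recr /= modnn /plen /chain_length /=.
rewrite big_mkord ds.unlock; congr (_ + _); apply: eq_bigr => i _.
by rewrite /= modn_small // ltnS.
Qed.

End Perimeter.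

Theorem theorem1p1 (R : realType) (k : surface) (a b : R) (g : R -> 'rV[R]_3)
    (hab : a <= b) (hg : G_curve k a b g)
    (hdiam : k = Sphere -> (diameter k (g @` `[a, b]) < (pi / 2)%:E)%E) :
  (curve_length k a b g <= perimeter k (convex_hull k (g @` `[a, b])))%E.
Proof.
have kg s : a <= s <= b -> points k (g s) := curve_points hg.1 (s := s).
have in_image s : a <= s <= b -> (g @` `[a, b]) (g s) by move=> h; exists s => //=; rewrite in_itv.
have le_diam s t : a <= s <= b -> a <= t <= b ->
    ((ds k (g s) (g t))%:E <= diameter k (g @` `[a, b]))%E.
  move=> hs ht; apply: ereal_sup_ubound; exists (g s, g t); last by rewrite ds.unlock.
  by split; exact: in_image.
have aab : a <= a <= b by rewrite lexx.
have g_short s t : a <= s <= b -> a <= t <= b -> short k (ds k (g s) (g t)).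
  move=> hs ht kS; rewrite -lte_fin; exact: le_lt_trans (le_diam _ _ hs ht) (hdiam kS).
(* A ball centred at [g a]: on the sphere its radius is the diameter of the curve, below pi / 2;
   otherwise any bound from absolute continuity will do. *)
have [B [B0 sB HB]] : exists B, [/\ 0 <= B, short k B & forall s, a <= s <= b ->
  ds k (g a) (g s) <= B].
  have [kS|kS] := pselect (k = Sphere); last first.
    have [B HB] := curve_bounded hab hg.1; exists B; split; [|by move=> ?|exact: HB].
    by have := HB a aab; rewrite (distxx (kg a aab)).
  have d0 := le_diam a a aab aab; rewrite (distxx (kg a aab)) in d0.
  have dE : diameter k (g @` `[a, b]) = (fine (diameter k (g @` `[a, b])))%:E.
    rewrite fineK // ge0_fin_numE //; apply: lt_trans (hdiam kS) _; exact: ltry.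
  exists (fine (diameter k (g @` `[a, b]))); split.
  - by rewrite -lee_fin -dE.
  - by move=> _; rewrite -lte_fin -dE; exact: hdiam.
  - by move=> s hs; rewrite -lee_fin -dE; exact: le_diam.
set Q := convex_hull k _.
have Q_sub p : Q p -> points k p /\ ds k (g a) p <= B.
  move=> Qp; apply: (Qp [set p | points k p /\ ds k (g a) p <= B]); split.
    by apply: ball_convex => //; exact: kg.
  by move=> _ [s /= + <-]; rewrite in_itv /= => h; split; [exact: kg|exact: HB].
have image_sub : g @` `[a, b] `<=` Q by move=> p gp X [_]; apply.
have [->|Poo] := eqVneq (perimeter k Q) +oo%E; first by rewrite leey.
have PE : perimeter k Q = (fine (perimeter k Q))%:E.
  by rewrite fineK // ge0_fin_numE ?perimeter_ge0 // lt_neqAle Poo leey.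
rewrite PE; apply: (curve_length_le hab hg g_short) => n q sq.
have sq' : spoly (points k `&` closure Q) n q.
  apply: spoly_sub sq => _ [s /= h <-].
  by split; [exact: kg|apply: subset_closure; apply: image_sub; exact: in_image].
have [h|[n' [q' [sq'' h]]]] := push_to_boundary (kg a aab) (fun p Qp => (Q_sub p Qp).1)
  (fun p Qp => (Q_sub p Qp).2) B0 sB sq'.
  by apply: le_trans h _; rewrite -lee_fin -PE perimeter_ge0.
by apply: le_trans h _; rewrite -lee_fin -PE; exact: plen_le_perimeter.
Qed.
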